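(* Let $a\in(-1,1)$ and let $H$ be the operator in $L^2((-\frac{\pi}{2},\frac{\pi}{2}))$ defined by $H\psi=-\psi''$ on the domain $\mathsf{D}(H)=\{\psi\in H^2((-\frac{\pi}{2},\frac{\pi}{2})) : \psi(-\frac{\pi}{2})=\psi(\frac{\pi}{2}a)=\psi(\frac{\pi}{2})\}$. 1. If $a\notin\mathbb{Q}$, then the eigenfunctions of $H$ form a minimal complete set but not a conditional basis in $L^2((-\frac{\pi}{2},\frac{\pi}{2}))$. 2. If $a\in\mathbb{Q}$, then the eigenfunctions of $H$ do not form a minimal complete set in $L^2((-\frac{\pi}{2},\frac{\pi}{2}))$.
   Context: $L^2((-\frac{\pi}{2},\frac{\pi}{2}))$ is the complex Hilbert space of square-integrable functions and $H^2$ denotes the usual Sobolev space, whose elements are identified with their continuous representatives on $[-\frac{\pi}{2},\frac{\pi}{2}]$. ''The eigenfunctions of $H$'' means a countable family $\{\psi_j\}_{j\in\mathbb{N}}$ obtained by choosing, for every eigenvalue $\lambda$ of $H$, a basis of the (finite-dimensional) eigenspace $\ker(H-\lambda)$, and enumerating all the chosen vectors (the choice and the enumeration are arbitrary). A family $\{\psi_j\}_{j\in\mathbb{N}}$ of vectors in a Hilbert space $\mathcal{H}$ is complete if its linear span is dense in $\mathcal{H}$; it is minimal complete if it is complete and the removal of any term makes it incomplete. It is a conditional (Schauder) basis if for every $f\in\mathcal{H}$ there is a unique sequence $\{\alpha_j\}_{j\in\mathbb{N}}\subset\mathbb{C}$ such that $f=\sum_{j=0}^\infty\alpha_j\psi_j$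 (with convergence in norm). *)

(* Defs.v *)
From HB Require Import structures.
From mathcomp Require Import all_boot all_order all_algebra.
From mathcomp Require Import complex.
From mathcomp Require Import all_classical all_reals all_analysis.

Set Implicit Arguments.
Unset Strict Implicit.
Unset Printing Implicit Defensive.

Import Order.TTheory GRing.Theory Num.Theory.
Import numFieldNormedType.Exports.

Local Open Scope classical_set_scope.
Local Open Scope ring_scope.
Local Open Scope complex_scope.

(* Elements of L^2 are handled through representatives R -> R[i]; only their
   restriction to the interval matters, and two representatives are the same
   vector when they agree a.e. there. *)
Section L2_interval.
Context {R : realType}.
Implicit Types (f g u : R -> R[i]) (psi : nat -> R -> R[i]).

Local Notation mu := (@lebesgue_measure R).

Definition Omega : set R := `]- (pi / 2), (pi / 2)[.

Definition Omega_closed : set R := `[- (pi / 2), (pi / 2)].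

Definition eq_L2 f g : Prop := ae_eq mu Omega f g.

Definition L2 f : Prop :=
  (((fun x => complex.Re (f x)) \_ Omega : R -> R) \in Lfun mu 2%:E) /\
  (((fun x => complex.Im (f x)) \_ Omega : R -> R) \in Lfun mu 2%:E).

Definition L2norm f : R := Num.sqrt (\int[mu]_(x in Omega) (Normc.normc (f x) ^+ 2)).

Definition cintegral f : R[i] :=
  (\int[mu]_(x in Omega) complex.Re (f x)) +i* (\int[mu]_(x in Omega) complex.Im (f x)).

(* Real-valued C_c^oo(Omega); by linearity, testing against complex-valued
   functions gives the same weak derivatives. *)
Definition test_function (phi : R -> R) : Prop :=
  [/\ forall n x, derivable (phi^`(n))%classic x 1,
      compact (closure [set x | phi x != 0]) &
      closure [set x | phi x != 0] `<=` Omega].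

(* Meaningful when f and g are locally integrable on Omega. *)
Definition weak_derivative (n : nat) f g : Prop :=
  forall phi, test_function phi ->
    cintegral (fun x => f x * ((phi^`(n))%classic x)%:C) =
    (-1) ^+ n * cintegral (fun x => g x * (phi x)%:C).

Definition sobolev (k : nat) f : Prop :=
  L2 f /\
  forall n, (n <= k)%N -> exists2 g, L2 g & weak_derivative n f g.

(* R[i] has no topology in the library: continuity is componentwise. *)
Definition continuous_representative f u : Prop :=
  [/\ {within Omega_closed, continuous (fun x => complex.Re (u x))},
      {within Omega_closed, continuous (fun x => complex.Im (u x))} &
      eq_L2 f u].

Definition domH (a : R) f : Prop :=
  sobolev 2 f /\
  exists2 u, continuous_representative f u &
    u (- (pi / 2)) = u (pi / 2 * a) /\ u (pi / 2 * a) = u (pi / 2).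

(* Graph of H: g represents H f, i.e. - g is the second weak derivative of f. *)
Definition opH (a : R) f g : Prop :=
  [/\ domH a f, L2 g & weak_derivative 2 f (fun x => - g x)].

Definition kerH (a : R) (l : R[i]) f : Prop := opH a f (fun x => l * f x).

Definition eigenvalueH (a : R) (l : R[i]) : Prop :=
  exists2 f, kerH a l f & ~ eq_L2 f (fun=> 0).

Definition lincomb (J : pred nat) psi (n : nat) (alpha : nat -> R[i]) :
    R -> R[i] :=
  fun x => \sum_(j < n | J j) alpha j * psi j x.

Definition independent (J : pred nat) psi : Prop :=
  forall n alpha, eq_L2 (lincomb J psi n alpha) (fun=> 0) ->
    forall j, (j < n)%N -> J j -> alpha j = 0.

Definition basis_of (V : set (R -> R[i])) (J : pred nat) psi : Prop :=
  [/\ forall j, J j -> V (psi j),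
      independent J psi &
      forall f, V f -> exists n alpha, eq_L2 f (lincomb J psi n alpha)].

(* lam j is the eigenvalue to which the j-th term of the family belongs. *)
Definition eigenfunctionsH (a : R) psi : Prop :=
  exists lam : nat -> R[i],
    (forall j, eigenvalueH a (lam j)) /\
    (forall l, eigenvalueH a l ->
       basis_of (kerH a l) (fun j => lam j == l) psi).

(* The terms psi j with J j have dense linear span. *)
Definition complete_family (J : pred nat) psi : Prop :=
  forall f, L2 f -> forall e : R, 0 < e ->
    exists n alpha, L2norm (fun x => f x - lincomb J psi n alpha x) < e.

Definition minimal_complete psi : Prop :=
  complete_family xpredT psi /\
  forall k, ~ complete_family (fun j => j != k) psi.

Definition conditional_basis psi : Prop :=
  forall f, L2 f -> exists! alpha : nat -> R[i],
    L2norm (fun x => f x - lincomb xpredT psi n alpha x) @[n --> \oo] --> 0.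

End L2_interval.

(* Main.v *)
(* Write u = k (1 + a) pi / 4 and v = k (1 - a) pi / 4.  By elliptic regularity,
   uniqueness for W'' = - l W and the boundary conditions, an eigenvalue is k ^ 2
   with k >= 0 and its eigenfunctions are A cos (k x) + B sin (k x) with
   B sin (u + v) = 0 and sin v (A sin u - B cos u) = 0.

   For irrational a and k > 0, u and v are not both multiples of pi, so every
   eigenvalue is simple.  The adjoint eigenfunction (Dirichlet at the ends,
   continuous at the interior point, total jump of the derivative zero) is
   orthogonal to all the other eigenfunctions, which gives minimality.

   Completeness: the closed span contains cos (2 pi j x / L1) and
   cos (2 pi j x / L2), where L1 >= L2 (say) are the lengths of the two subintervals.
   The longer length gives all functions of | |x| - L1 / 2 |; in particular the
   second family may be cut off to the interval of length L2 around L1 / 2,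
   where irrationality extracts sin (2 pi j (|x| - L1 / 2) / L2).  Together they
   yield all even functions; the eigenfunctions with k = 2 j then yield
   sin (2 j x), hence everything.

   No basis: the eigenfunction with k = 2 m has inner product proportional to
   sin u with its dual sin (2 m x), and sin u can be made arbitrarily small by
   the pigeonhole principle.  A lacunary sine series has unbounded coefficients.

   For rational a = p / q and k = 4 q, one of the functions that equal c1 sin (k x)
   on the left subinterval and c2 sin (k x) on the right one is orthogonal to all
   eigenfunctions, so these are not even complete. *)

Require Import Defs.
From mathcomp Require Import normedtype.
Import numFieldNormedType.Exports.
From mathcomp Require Import all_boot all_order all_algebra.
From mathcomp Require Import complex.
From mathcomp Require Import all_classical all_reals all_analysis.
From mathcomp Require Import measurable_realfun ring lra.

Set Implicit Arguments.
Unset Strict Implicit.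
Unset Printing Implicit Defensive.

Import Order.TTheory GRing.Theory Num.Theory.
Import numFieldNormedType.Exports.

Local Open Scope classical_set_scope.
Local Open Scope ring_scope.

(** * Derivatives and the fundamental theorem of calculus *)

(** [H] is not symmetric, so neither real eigenvalues nor completeness come from self-adjointness;
    both are obtained from reflections. For completeness the point is that cos t determines |t| only
    while |t| <= pi. On the interval, | |x| - L1 / 2 | is at most L1 / 2, so the angle 2 pi (|x| -
    L1 / 2) / L1 respects this bound and its cosines reach every continuous function of | |x| - L1 /
    2 |. With L2 in the denominator the angle can exceed pi and the cosines fold; the cutoff removes
    the fold, and what is cut away is again a function of | |x| - L1 / 2 |, because |x| < L1 / 2
    there. The rational case is a degenerate form of the irrational one. At k = 4 q the eigenspace
    is spanned by cos (k x) and sin (k x), the adjoint eigenspace by the sines cut to the two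
    subintervals, and both of these are orthogonal to cos (k x). The pairing of the two planes is
    therefore singular: sin u vanishes instead of merely being small. *)

Section Calculus.
Context {R : realType}.
Implicit Types (f g F G : R -> R) (a b c x y k s : R).
Local Notation mu := (@lebesgue_measure R).

(* A plain alias of [is_derive], so that hypotheses and goals of this form are
   not handed to type class resolution. *)
Definition has_derivative f x d : Prop := is_derive x (1 : R) f d.

Lemma near_dist_lt x e : 0 < e -> \forall y \near x, `|y - x| < e.
Proof.
move=> e0; near=> y; rewrite distrC; near: y.
by apply: (@cvgr_dist_lt _ _ _ (nbhs x) _ id x _ e e0); exact: cvg_id.
Unshelve. all: by end_near. Qed.

Lemma has_derivative_eq f x a b : has_derivative f x a -> a = b ->
  has_derivative f x b.
Proof. by move=> ? <-. Qed.

Lemma has_derivative_unique f x a b :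
  has_derivative f x a -> has_derivative f x b -> a = b.
Proof. by move=> [_ <-] [_ <-]. Qed.

Lemma near_eq_has_derivative f g x a : {near x, f =1 g} ->
  has_derivative f x a -> has_derivative g x a.
Proof. exact: near_eq_is_derive. Qed.

Lemma has_derivative_cst x c : has_derivative (fun=> c) x 0.
Proof. exact: is_derive_cst. Qed.

Lemma has_derivative_id x : has_derivative id x 1.
Proof. exact: is_derive_id. Qed.

Lemma has_derivativeD f g x a b : has_derivative f x a -> has_derivative g x b ->
  has_derivative (fun y => f y + g y) x (a + b).
Proof. by move=> ? ?; exact: is_deriveD. Qed.

Lemma has_derivativeB f g x a b : has_derivative f x a -> has_derivative g x b ->
  has_derivative (fun y => f y - g y) x (a - b).
Proof. by move=> ? ?; exact: is_deriveB. Qed.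

Lemma has_derivativeM f g x a b : has_derivative f x a -> has_derivative g x b ->
  has_derivative (fun y => f y * g y) x (a * g x + f x * b).
Proof.
move=> fa gb; apply: (is_derive_eq (is_deriveM fa gb)).
by rewrite addrC /GRing.scale/= [g x * a]mulrC.
Qed.

Lemma has_derivativeZ f x a c : has_derivative f x a ->
  has_derivative (fun y => c * f y) x (c * a).
Proof. by move=> ?; exact: is_deriveZ. Qed.

Lemma has_derivative_comp f g x a b : has_derivative f (g x) a -> has_derivative g x b ->
  has_derivative (fun y => f (g y)) x (a * b).
Proof.
move=> fa gb; apply: (is_derive_eq (is_derive1_comp fa gb)).
by rewrite /GRing.scale/= mulrC.
Qed.

Lemma has_derivative_affine x k c : has_derivative (fun y => k * y + c) x k.
Proof.
have H := has_derivativeZ k (has_derivative_id x).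
by apply: (has_derivative_eq (has_derivativeD H (has_derivative_cst x c))); rewrite mulr1 addr0.
Qed.

Lemma has_derivative_cos x k c :
  has_derivative (fun y => cos (k * y + c)) x (- k * sin (k * x + c)).
Proof.
apply: (has_derivative_eq (has_derivative_comp (is_derive_cos _) (has_derivative_affine x k c))).
by rewrite mulrC mulrN mulNr.
Qed.

Lemma has_derivative_sin x k c :
  has_derivative (fun y => sin (k * y + c)) x (k * cos (k * x + c)).
Proof.
apply: (has_derivative_eq (has_derivative_comp (is_derive_sin _) (has_derivative_affine x k c))).
by rewrite mulrC.
Qed.

Lemma has_derivative_continuous f x a : has_derivative f x a -> {for x, continuous f}.
Proof. by move=> [df _]; apply/differentiable_continuous/derivable1_diffP. Qed.

Lemma has_derivative_within f f' a b :
  (forall x, x \in `[a, b] -> has_derivative f x (f' x)) ->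
  {within `[a, b], continuous f}.
Proof.
move=> df; apply: continuous_in_subspaceT => x /set_mem/df.
exact: has_derivative_continuous.
Qed.

Lemma derive_ge0_le f f' a b : a <= b ->
  (forall x, x \in `[a, b] -> has_derivative f x (f' x)) ->
  (forall x, x \in `[a, b] -> 0 <= f' x) -> f a <= f b.
Proof.
move=> ab df f'0.
have df' x : x \in `]a, b[ -> has_derivative f x (f' x).
  by move=> /subset_itv_oo_cc; exact: df.
have [c cab e] := MVT_segment ab df' (has_derivative_within df).
by rewrite -subr_ge0 e mulr_ge0 ?subr_ge0// f'0.
Qed.

Lemma derive_eq0_eq f a b :
  (forall x, x \in `[a, b] -> has_derivative f x 0) ->
  forall x, x \in `[a, b] -> f x = f a.
Proof.
move=> df x xab; have ax : a <= x by move: xab; rewrite in_itv/= => /andP[].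
have sub y : y \in `[a, x] -> y \in `[a, b].
  move: xab; rewrite !in_itv/= => /andP[_ xb] /andP[-> yx].
  exact: le_trans xb.
have df' y : y \in `[a, x] -> has_derivative f y 0 by move=> /sub/df.
have df'' y : y \in `]a, x[ -> has_derivative f y 0.
  by move=> /subset_itv_oo_cc/df'.
have [c cab e] := @MVT_segment R f (fun=> 0) a x ax df'' (has_derivative_within df').
by apply/eqP; rewrite -subr_eq0 e mul0r.
Qed.

(** A nondecreasing function with equal end values is constant. In this form an energy identity with
    vanishing boundary terms forces its nonnegative integrand to vanish, without any integration. *)
Lemma derive_ge0_eq0 f f' a b :
  (forall x, x \in `[a, b] -> has_derivative f x (f' x)) ->
  (forall x, x \in `[a, b] -> 0 <= f' x) -> f a = f b ->
  forall x, x \in `]a, b[ -> f' x = 0.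
Proof.
move=> df f'0 fab x xab.
have mono c d : c \in `[a, b] -> d \in `[a, b] -> c <= d -> f c <= f d.
  rewrite !in_itv/= => /andP[ac cb] /andP[ad db] cd.
  apply: (@derive_ge0_le f f' c d cd) => y; rewrite in_itv/= => /andP[cy yd];
    [apply: df|apply: f'0]; rewrite in_itv/= (le_trans ac cy)/=;
    exact: le_trans db.
have fa y : y \in `[a, b] -> f y = f a.
  move=> yab; have /andP[ay yb] : a <= y <= b by move: yab; rewrite in_itv.
  have aab : a \in `[a, b] by rewrite in_itv/= lexx (le_trans ay yb).
  have bab : b \in `[a, b] by rewrite in_itv/= lexx (le_trans ay yb).
  by apply/eqP; rewrite eq_le {1}fab !mono.
have : has_derivative f x 0.
  apply: (near_eq_has_derivative (f := cst (f a))); last exact: has_derivative_cst.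
  near=> y; rewrite [RHS]fa//; apply: subset_itv_oo_cc.
  by near: y; exact: near_in_itvoo.
by move=> [_ <-]; have [_ ->] := df _ (subset_itv_oo_cc xab).
Unshelve. all: by end_near. Qed.

Lemma integrable_within_continuous f a b : {within `[a, b], continuous f} ->
  mu.-integrable `]a, b[ (EFin \o f).
Proof.
move=> cf; apply: (@integrableS _ _ _ mu `[a, b]) => //.
  exact: subset_itv_oo_cc.
apply: continuous_compact_integrable => //; exact: segment_compact.
Qed.

Lemma Rintegral_oo_cc f a b : {within `[a, b], continuous f} ->
  \int[mu]_(x in `]a, b[) f x = \int[mu]_(x in `[a, b]) f x.
Proof.
move=> cf; have fi := integrable_within_continuous cf.
have fi' : mu.-integrable `[a, b] (EFin \o f).
  apply: continuous_compact_integrable => //; exact: segment_compact.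
rewrite Rintegral_itv_bndo_bndc ?Rintegral_itv_obnd_cbnd//.
by apply: (integrableS _ _ _ fi') => //; exact: subset_itv_oc_cc.
Qed.

Lemma FTC_oo f f' a b : a <= b ->
  (forall x, x \in `[a, b] -> has_derivative f x (f' x)) ->
  {within `[a, b], continuous f'} ->
  \int[mu]_(x in `]a, b[) f' x = f b - f a.
Proof.
rewrite le_eqVlt => /predU1P[<- _ _|ab df cf'].
  by rewrite set_itvoo0 Rintegral_set0 subrr.
rewrite Rintegral_oo_cc// /Rintegral (@continuous_FTC2 _ f' f)//.
- have cf x (xab : x \in `[a, b]) : {for x, continuous f}.
    exact: has_derivative_continuous (df _ xab).
  split.
  + by move=> x /subset_itv_oo_cc/df[].
  + by apply: cvg_at_right_filter; apply: cf; rewrite bound_itvE ltW.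
  + by apply: cvg_at_left_filter; apply: cf; rewrite bound_itvE ltW.
- by move=> x /subset_itv_oo_cc/df[_]; rewrite derive1E.
Qed.

Lemma continuous_antiderivative f : continuous f ->
  exists F, forall x, has_derivative F x (f x).
Proof.
move=> cf.
pose I a x := \int[mu]_(t in `[a, x]) f t.
have fi a b : mu.-integrable `[a, b] (EFin \o f).
  apply: continuous_compact_integrable; first exact: segment_compact.
  exact: continuous_subspaceT.
have dI a x : a < x -> has_derivative (I a) x (f x).
  move=> ax; have [||dI eI] := @continuous_FTC1_closed _ f a x (x + 1) _ _ ax (cf x).
  - by rewrite ltrDl.
  - exact: fi.
  split; first exact dI.
  by rewrite -[RHS]eI; exact: (esym (derive1E (I a) x)).
have IB a c x : a < c -> c < x -> I a x - I a c = I c x.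
  move=> ac cx; have := @Rintegral_itvB _ f (BLeft a) (BRight x) c (fi _ _).
  rewrite !bnd_simp => /(_ (ltW ac) (ltW cx)) ->.
  rewrite Rintegral_itv_obnd_cbnd//.
  by apply: integrableS (fi c x) => //; exact: subset_itv_oc_cc.
(* The base point moves left with [x]; subtracting the value at 0 makes the result independent of
   it, which yields one primitive on the whole line. *)
pose F x := I (- (`|x| + 1)) x - I (- (`|x| + 1)) 0.
have FE a x : a < 0 -> a < - (`|x| + 1) -> F x = I a x - I a 0.
  move=> a0 ax.
  have h0 : - (`|x| + 1) < 0 by rewrite oppr_lt0 ltr_wpDl.
  have hx : - (`|x| + 1) < x.
    by rewrite ltrNl (le_lt_trans (ler_norm _))// normrN ltrDl.
  by rewrite /F -(IB a (- (`|x| + 1)) x)// -(IB a (- (`|x| + 1)) 0)//; ring.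
exists F => x.
(* When y is at distance less than 1 from [x], this point lies left of the base point of y, so it
   serves a whole neighbourhood of [x]. *)
pose a := - (`|x| + 3).
have a0 : a < 0 by rewrite oppr_lt0 ltr_wpDl.
have ax : a < x.
  by rewrite ltrNl (le_lt_trans (ler_norm _))// normrN ltrDl.
apply: (near_eq_has_derivative (f := fun y => I a y - I a 0)); last first.
  have H := has_derivativeB (dI a x ax) (has_derivative_cst x (I a 0)).
  by apply: (has_derivative_eq H); rewrite subr0.
near=> y; rewrite (FE a)// /a ltrN2.
have : `|y - x| < 1 by near: y; exact: near_dist_lt.
have := ler_dist_dist y x; have := ler_norm (`|y| - `|x|).
lra.
Unshelve. all: by end_near. Qed.

End Calculus.

(** * The equation W'' = - l W *)

Section HelmholtzODE.
Context {R : realType}.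
Implicit Types (f P dP Q dQ : R -> R) (a b c h k l s x y : R).

(* W = P + iQ solves W'' = - l W on [a, b], where l = l1 + i l2. *)
Definition helmholtz l1 l2 P dP Q dQ a b : Prop :=
  forall x, x \in `[a, b] ->
    [/\ has_derivative P x (dP x),
        has_derivative dP x (- (l1 * P x - l2 * Q x)),
        has_derivative Q x (dQ x) &
        has_derivative dQ x (- (l1 * Q x + l2 * P x))].

Lemma helmholtzS l1 l2 P dP Q dQ a b a' b' : a <= a' -> b' <= b ->
  helmholtz l1 l2 P dP Q dQ a b -> helmholtz l1 l2 P dP Q dQ a' b'.
Proof.
move=> aa' bb' H x; rewrite in_itv/= => /andP[ax xb]; apply: H.
by rewrite in_itv/= (le_trans aa' ax) (le_trans xb bb').
Qed.

(* The energy E = |W|^2 + |W'|^2 satisfies |E'| <= C E. *)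
Lemma helmholtz_unique l1 l2 P dP Q dQ a b x0 :
  helmholtz l1 l2 P dP Q dQ a b -> x0 \in `[a, b] ->
  P x0 = 0 -> dP x0 = 0 -> Q x0 = 0 -> dQ x0 = 0 ->
  forall x, x \in `[a, b] -> P x = 0 /\ Q x = 0.
Proof.
move=> H x0ab P0 dP0 Q0 dQ0.
pose E y := P y * P y + dP y * dP y + (Q y * Q y + dQ y * dQ y).
pose C := 1 + `|l1| + `|l2|.
pose E' y := 2 * (P y * dP y + dP y * (- (l1 * P y - l2 * Q y))
                + (Q y * dQ y + dQ y * (- (l1 * Q y + l2 * P y)))).
have dE y : y \in `[a, b] -> has_derivative E y (E' y).
  move=> /H[HP HdP HQ HdQ].
  apply: (has_derivative_eq (has_derivativeD
    (has_derivativeD (has_derivativeM HP HP) (has_derivativeM HdP HdP))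
    (has_derivativeD (has_derivativeM HQ HQ) (has_derivativeM HdQ HdQ)))).
  by rewrite /E'; ring.
have amgm (u v l : R) : 2 * (l * (u * v)) <= `|l| * (u ^+ 2 + v ^+ 2) /\
    - (`|l| * (u ^+ 2 + v ^+ 2)) <= 2 * (l * (u * v)).
  have h1 : 0 <= (u - v) ^+ 2 by exact: sqr_ge0.
  have h2 : 0 <= (u + v) ^+ 2 by exact: sqr_ge0.
  have := mulr_ge0 (normr_ge0 l) h1; have := mulr_ge0 (normr_ge0 l) h2.
  by have [l0|l0] := ger0P l; split; lra.
have E'E y : - (C * E y) <= E' y <= C * E y.
  have := amgm (P y) (dP y) 1; have := amgm (Q y) (dQ y) 1.
  have := amgm (P y) (dP y) (- l1); have := amgm (Q y) (dQ y) (- l1).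
  have := amgm (dP y) (Q y) l2; have := amgm (dQ y) (P y) (- l2).
  rewrite /E' /E /C !normrN normr1.
  move: (P y) (dP y) (Q y) (dQ y) `|l1| `|l2| => p dp q dq m1 m2.
  by move=> [? ?] [? ?] [? ?] [? ?] [? ?] [? ?]; apply/andP; split; lra.
have E0 : E x0 = 0 by rewrite /E P0 dP0 Q0 dQ0; ring.
have Epos y : 0 <= E y.
  by rewrite /E -!expr2 !addr_ge0// sqr_ge0.
pose G d y := E y * expR (d * y + 0).
have dG d y : y \in `[a, b] ->
    has_derivative (G d) y ((E' y + d * E y) * expR (d * y + 0)).
  move=> yab; apply: (has_derivative_eq (has_derivativeM (dE _ yab)
    (has_derivative_comp (is_derive_expR _) (has_derivative_affine y d 0)))).
  by ring.
suff E0' x : x \in `[a, b] -> E x = 0.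
  move=> x /E0'; rewrite /E => e.
  have : P x ^+ 2 = 0.
    have := sqr_ge0 (P x); have := sqr_ge0 (Q x); have := sqr_ge0 (dP x).
    have := sqr_ge0 (dQ x); rewrite !expr2; lra.
  have : Q x ^+ 2 = 0.
    have := sqr_ge0 (P x); have := sqr_ge0 (Q x); have := sqr_ge0 (dP x).
    have := sqr_ge0 (dQ x); rewrite !expr2; lra.
  by move=> /eqP; rewrite sqrf_eq0 => /eqP-> /eqP; rewrite sqrf_eq0 => /eqP->.
move=> xab; apply/eqP; rewrite eq_le Epos andbT.
move: (x0ab) (xab); rewrite !in_itv/= => /andP[ax0 x0b] /andP[ax xb].
have [x0x|/ltW xx0] := lerP x0 x.
- have sub y : y \in `[x0, x] -> y \in `[a, b].
    rewrite !in_itv/= => /andP[? ?].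
    by rewrite (le_trans ax0)//= (le_trans _ xb).
  have := @derive_ge0_le R (fun y => 0 - G (- C) y)
    (fun y => 0 - (E' y + - C * E y) * expR (- C * y + 0)) x0 x x0x.
  have h1 y : y \in `[x0, x] -> has_derivative (fun y => 0 - G (- C) y) y
      (0 - (E' y + - C * E y) * expR (- C * y + 0)).
    by move=> /sub yab; apply: has_derivativeB (has_derivative_cst _ _) (dG _ _ yab).
  move=> /(_ h1); rewrite {1 2}/G E0 mul0r subr0.
  have h2 y : y \in `[x0, x] -> 0 <= 0 - (E' y + - C * E y) * expR (- C * y + 0).
    move=> _; rewrite sub0r -mulNr mulr_ge0 ?expR_ge0//.
    by have /andP[_] := E'E y; lra.
  by move=> /(_ h2); rewrite sub0r oppr_ge0 pmulr_lle0 ?expR_gt0.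
- have sub y : y \in `[x, x0] -> y \in `[a, b].
    rewrite !in_itv/= => /andP[? ?].
    by rewrite (le_trans ax)//= (le_trans _ x0b).
  have := @derive_ge0_le R (G C) (fun y => (E' y + C * E y) * expR (C * y + 0))
    x x0 xx0.
  have h1 y : y \in `[x, x0] -> has_derivative (G C) y
      ((E' y + C * E y) * expR (C * y + 0)) by move=> /sub/dG.
  move=> /(_ h1); rewrite {1 2}/G E0 mul0r.
  have h2 y : y \in `[x, x0] -> 0 <= (E' y + C * E y) * expR (C * y + 0).
    by move=> _; rewrite mulr_ge0 ?expR_ge0//; have /andP[+ _] := E'E y; lra.
  by move=> /(_ h2); rewrite pmulr_lle0 ?expR_gt0.
Qed.

(* [P dQ - Q dP] and [P dP + Q dQ] have derivatives [- l2 |W|^2] and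
   [|W'|^2 - l1 |W|^2], and vanish at both ends. *)
Lemma helmholtz_sign l1 l2 P dP Q dQ a b :
  helmholtz l1 l2 P dP Q dQ a b ->
  (P a = 0 /\ Q a = 0) \/ (dP a = 0 /\ dQ a = 0) ->
  (P b = 0 /\ Q b = 0) \/ (dP b = 0 /\ dQ b = 0) ->
  (forall x, x \in `]a, b[ -> P x = 0 /\ Q x = 0) \/ (l2 = 0 /\ 0 <= l1).
Proof.
move=> H Ha Hb.
have solve (g g' : R -> R) :
    (forall x, x \in `[a, b] -> has_derivative g x (g' x)) ->
    (forall x, 0 <= g' x) -> g a = 0 -> g b = 0 ->
    (forall x, g' x = 0 -> P x * P x + Q x * Q x = 0) ->
    forall x, x \in `]a, b[ -> P x = 0 /\ Q x = 0.
  move=> dg g'0 ga gb g'PQ x xab.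
  have /g'PQ := derive_ge0_eq0 dg (fun x _ => g'0 x) (etrans ga (esym gb)) xab.
  rewrite -!expr2 => /eqP; rewrite paddr_eq0 ?sqr_ge0//.
  by rewrite !sqrf_eq0 => /andP[/eqP-> /eqP->].
pose F y := P y * dQ y - Q y * dP y.
pose N y := P y * P y + Q y * Q y.
have N0 y : 0 <= N y by rewrite /N -!expr2 addr_ge0// sqr_ge0.
have dF y : y \in `[a, b] -> has_derivative F y (- l2 * N y).
  move=> /H[HP HdP HQ HdQ].
  apply: (has_derivative_eq (has_derivativeB (has_derivativeM HP HdQ)
    (has_derivativeM HQ HdP))).
  by rewrite /N; ring.
have [Fa Fb] : F a = 0 /\ F b = 0.
  by rewrite /F; split; [case: Ha|case: Hb] => -[-> ->]; ring.
have [l2lt|l2gt|l20] := ltrgtP l2 0.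
- left; apply: (solve F _ dF _ Fa Fb) => x.
    by rewrite mulr_ge0// oppr_ge0 ltW.
  by move=> /eqP; rewrite mulf_eq0 oppr_eq0 lt_eqF//= => /eqP.
- left; apply: (solve (fun y => (-1) * F y) (fun y => -1 * (- l2 * N y))) => //.
  + by move=> x /dF; exact: has_derivativeZ.
  + by move=> x; rewrite mulN1r mulNr opprK mulr_ge0// ltW.
  + by rewrite Fa mulr0.
  + by rewrite Fb mulr0.
  + by move=> x /eqP; rewrite mulN1r mulNr opprK mulf_eq0 gt_eqF//= => /eqP.
have [l10|l10] := lerP 0 l1; first by right.
left; apply: (solve (fun y => P y * dP y + Q y * dQ y)
    (fun y => dP y ^+ 2 + dQ y ^+ 2 - l1 * N y)) => //.
- move=> y /H[HP HdP HQ HdQ].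
  apply: (has_derivative_eq (has_derivativeD (has_derivativeM HP HdP)
    (has_derivativeM HQ HdQ))).
  by rewrite /N l20; ring.
- move=> x; rewrite subr_ge0 (@le_trans _ _ 0)//; last by rewrite addr_ge0// sqr_ge0.
  by rewrite mulr_le0_ge0// ltW.
- by case: Ha => -[-> ->]; ring.
- by case: Hb => -[-> ->]; ring.
- move=> x e; apply/eqP; rewrite eq_le N0 andbT -(nmulr_rge0 _ l10).
  have := sqr_ge0 (dP x); have := sqr_ge0 (dQ x); rewrite -/(N x); lra.
Qed.

Lemma has_derivative_odd_part f s y d e :
  has_derivative f (s + y) d -> has_derivative f (s - y) e ->
  has_derivative (fun z => f (s + z) - f (s - z)) y (d + e).
Proof.
move=> fd fe.
have H1 : has_derivative (fun z => s + z) y 1.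
  apply: (has_derivative_eq (has_derivativeD (has_derivative_cst y s)
    (has_derivative_id y))); exact: add0r.
have H2 : has_derivative (fun z => s - z) y (-1).
  apply: (has_derivative_eq (has_derivativeB (has_derivative_cst y s)
    (has_derivative_id y))); exact: sub0r.
apply: (has_derivative_eq (has_derivativeB
  (has_derivative_comp (f := f) (g := fun z => s + z) fd H1)
  (has_derivative_comp (f := f) (g := fun z => s - z) fe H2))).
by ring.
Qed.

Lemma has_derivative_even_part f s y d e :
  has_derivative f (s + y) d -> has_derivative f (s - y) e ->
  has_derivative (fun z => f (s + z) + f (s - z)) y (d - e).
Proof.
move=> fd fe.
have H1 : has_derivative (fun z => s + z) y 1.
  apply: (has_derivative_eq (has_derivativeD (has_derivative_cst y s)
    (has_derivative_id y))); exact: add0r.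
have H2 : has_derivative (fun z => s - z) y (-1).
  apply: (has_derivative_eq (has_derivativeB (has_derivative_cst y s)
    (has_derivative_id y))); exact: sub0r.
apply: (has_derivative_eq (has_derivativeD
  (has_derivative_comp (f := f) (g := fun z => s + z) fd H1)
  (has_derivative_comp (f := f) (g := fun z => s - z) fe H2))).
by ring.
Qed.

Lemma helmholtz_odd_part l1 l2 P dP Q dQ s h :
  helmholtz l1 l2 P dP Q dQ (s - h) (s + h) ->
  helmholtz l1 l2 (fun y => P (s + y) - P (s - y)) (fun y => dP (s + y) + dP (s - y))
    (fun y => Q (s + y) - Q (s - y)) (fun y => dQ (s + y) + dQ (s - y)) 0 h.
Proof.
move=> H y; rewrite in_itv/= => /andP[y0 yh].
have [|H1 H2 H3 H4] := H (s + y).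
  by rewrite in_itv/=; apply/andP; split; lra.
have [|K1 K2 K3 K4] := H (s - y).
  by rewrite in_itv/=; apply/andP; split; lra.
split.
- exact: has_derivative_odd_part.
- by apply: (has_derivative_eq (has_derivative_even_part H2 K2)); ring.
- exact: has_derivative_odd_part.
- by apply: (has_derivative_eq (has_derivative_even_part H4 K4)); ring.
Qed.

Lemma even_derivative_eq0 f s h d : 0 < h -> has_derivative f s d ->
  (forall y, y \in `]0, h[ -> f (s + y) - f (s - y) = 0) -> d = 0.
Proof.
move=> h0 fd fe.
have H0 : has_derivative (fun z => f (s + z) - f (s - z)) 0 (d + d).
  by apply: has_derivative_odd_part; rewrite ?addr0 ?subr0.
have H1 : has_derivative (fun z => f (s + z) - f (s - z)) 0 0.
  apply: (near_eq_has_derivative (f := fun=> 0)); last exact: has_derivative_cst.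
  near=> y => /=.
  have yh : `|y| < h.
    by rewrite -[y]subr0; near: y; exact: near_dist_lt.
  have [y0|y0|->] := ltrgtP y 0; last by rewrite addr0 subr0 subrr.
  - have := fe (- y); rewrite opprK in_itv/= oppr_gt0 y0/=.
    by rewrite -(ltr0_norm y0) yh => /(_ isT) e; rewrite -opprB e oppr0.
  - by rewrite fe// in_itv/= y0/= -(gtr0_norm y0).
by have := has_derivative_unique H0 H1; lra.
Unshelve. all: by end_near. Qed.

(** Since W takes one value at - b, c and b, its odd parts about 0 and about the midpoint s of
    [- b, c] solve Dirichlet problems. Hence l >= 0, or W is even about both points. In the second
    case W' vanishes at s and at 0, and the Neumann problem on [s, 0] gives the same alternative. *)
Lemma helmholtz_real l1 l2 P dP Q dQ b c : -b < c -> c < b ->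
  helmholtz l1 l2 P dP Q dQ (- b) b ->
  P (- b) = P c -> P c = P b -> Q (- b) = Q c -> Q c = Q b ->
  (forall x, x \in `[- b, b] -> P x = 0 /\ Q x = 0) \/ (l2 = 0 /\ 0 <= l1).
Proof.
move=> bc cb H P1 P2 Q1 Q2.
have b0 : 0 < b by lra.
pose s := (c - b) / 2; pose h := (c + b) / 2.
have h0 : 0 < h by rewrite /h; lra.
have s0 : s < 0 by rewrite /s; lra.
have H0 : helmholtz l1 l2 P dP Q dQ (0 - b) (0 + b) by rewrite sub0r add0r.
have shb : s - h = - b by rewrite /s /h; lra.
have shc : s + h = c by rewrite /s /h; lra.
have Hs : helmholtz l1 l2 P dP Q dQ (s - h) (s + h).
  by apply: helmholtzS H; rewrite ?shb ?shc// ltW.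
have [||E0|] := helmholtz_sign (helmholtz_odd_part H0); last by right.
- by left; rewrite !addr0 !subr0 !subrr.
- by left; rewrite !add0r P1 P2 Q1 Q2 !subrr.
have [||Es|] := helmholtz_sign (helmholtz_odd_part Hs); last by right.
- by left; rewrite !addr0 !subr0 !subrr.
- by left; rewrite shb shc P1 Q1 !subrr.
have in0 : 0 \in `[- b, b] by rewrite in_itv/=; apply/andP; split; lra.
have ins : s \in `[- b, b] by rewrite in_itv/=; apply/andP; split; rewrite /s; lra.
have [D1 _ D2 _] := H _ in0; have [D3 _ D4 _] := H _ ins.
have dP0 : dP 0 = 0 by apply: (even_derivative_eq0 b0 D1) => y /E0[].
have dQ0 : dQ 0 = 0 by apply: (even_derivative_eq0 b0 D2) => y /E0[].
have dPs : dP s = 0 by apply: (even_derivative_eq0 h0 D3) => y /Es[].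
have dQs : dQ s = 0 by apply: (even_derivative_eq0 h0 D4) => y /Es[].
have Hs0 : helmholtz l1 l2 P dP Q dQ s 0.
  by apply: helmholtzS H; rewrite /s; lra.
have [||Z|] := helmholtz_sign Hs0; last by right.
- by right.
- by right.
(* W vanishes on ]s, 0[, so its Cauchy data at the interior point m are zero, and uniqueness spreads
   this to [- b, b]. *)
left; pose m := s / 2.
have ms : m \in `]s, 0[ by rewrite in_itv/= /m; apply/andP; split; lra.
have mb : m \in `[- b, b] by rewrite in_itv/= /m /s; apply/andP; split; lra.
have [HP _ HQ _] := H _ mb; have [Pm Qm] := Z _ ms.
have zero f d : has_derivative f m d -> (forall x, x \in `]s, 0[ -> f x = 0) -> d = 0.
  move=> fd f0; apply: (has_derivative_unique fd).
  apply: (near_eq_has_derivative (f := fun=> 0)); last exact: has_derivative_cst.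
  by near=> y; rewrite f0//; near: y; exact: near_in_itvoo.
by apply: (helmholtz_unique H mb) => //;
  [apply: zero HP _ => x /Z[]|apply: zero HQ _ => x /Z[]].
Unshelve. all: by end_near. Qed.

Lemma helmholtz_explicit k p dp b : 0 < b ->
  (forall x, x \in `[- b, b] -> has_derivative p x (dp x)) ->
  (forall x, x \in `[- b, b] -> has_derivative dp x (- (k ^+ 2 * p x))) ->
  (k != 0 -> exists A B, forall x, x \in `[- b, b] ->
     p x = A * cos (k * x) + B * sin (k * x)) /\
  (k = 0 -> exists A B, forall x, x \in `[- b, b] -> p x = A + B * x).
Proof.
move=> b0 Hp Hdp.
have in0 : 0 \in `[- b, b] by rewrite in_itv/=; apply/andP; split; lra.
(* Comparison with a candidate that has the same Cauchy data at 0: the difference is taken as the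
   real part of a solution whose imaginary part is zero. *)
have uniq q dq ddq : (forall x, has_derivative q x (dq x)) ->
    (forall x, has_derivative dq x (ddq x)) ->
    (forall x, ddq x = - (k ^+ 2 * q x)) -> q 0 = p 0 -> dq 0 = dp 0 ->
    forall x, x \in `[- b, b] -> p x = q x.
  move=> Hq Hdq ddqE q0 dq0 x xb.
  have H : helmholtz (k ^+ 2) 0 (fun y => p y - q y) (fun y => dp y - dq y)
      (fun=> 0) (fun=> 0) (- b) b.
    move=> y yb; split.
    - by apply: has_derivativeB => //; exact: Hp.
    - apply: (has_derivative_eq (has_derivativeB (Hdp _ yb) (Hdq y))).
      by rewrite ddqE; ring.
    - exact: has_derivative_cst.
    - by apply: (has_derivative_eq (has_derivative_cst _ _)); ring.
  have [] := helmholtz_unique H in0 _ _ _ _ xb => //=.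
  - by rewrite q0 subrr.
  - by rewrite dq0 subrr.
  by move=> /eqP; rewrite subr_eq0 => /eqP.
split=> [k0|k0].
- exists (p 0), (dp 0 / k).
  pose q x := p 0 * cos (k * x + 0) + dp 0 / k * sin (k * x + 0).
  move=> x xb; have -> : p 0 * cos (k * x) + dp 0 / k * sin (k * x) = q x.
    by rewrite /q addr0.
  apply: (uniq q (fun x => p 0 * (- k * sin (k * x + 0)) + dp 0 / k * (k * cos (k * x + 0)))
    (fun x => p 0 * (- k * (k * cos (k * x + 0))) + dp 0 / k * (k * (- k * sin (k * x + 0))))) => //.
  + move=> y; exact: (has_derivativeD (has_derivativeZ _ (has_derivative_cos _ _ _))
      (has_derivativeZ _ (has_derivative_sin _ _ _))).
  + move=> y; exact: (has_derivativeD
      (has_derivativeZ _ (has_derivativeZ _ (has_derivative_sin _ _ _)))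
      (has_derivativeZ _ (has_derivativeZ _ (has_derivative_cos _ _ _)))).
  + by move=> y; rewrite /q; ring.
  + by rewrite /q mulr0 addr0 cos0 sin0; ring.
  + by rewrite mulr0 addr0 cos0 sin0; field.
- exists (p 0), (dp 0) => x xb; rewrite addrC.
  apply: (uniq (fun x => dp 0 * x + p 0) (fun=> dp 0) (fun=> 0)) => //.
  + by move=> y; exact: has_derivative_affine.
  + by move=> y; exact: has_derivative_cst.
  + by move=> y; rewrite k0; ring.
  + by rewrite mulr0 add0r.
Qed.

End HelmholtzODE.

(** * Test functions and weak derivatives *)

Section TestFunctions.
Context {R : realType}.
Implicit Types (f g : R -> R) (a b c e s x y : R) (i j m n : nat).

Definition smooth f : Prop := forall n x, derivable (f^`(n))%classic x 1.

Lemma has_derivativeE f f' : (forall x, has_derivative f x (f' x)) ->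
  (f^`())%classic = f'.
Proof. by move=> df; apply/funext => x; rewrite derive1E; have [_ ->] := df x. Qed.

(** A class closed under differentiation contains all iterated derivatives of its members, so
    smoothness of bumps follows without formulas for these derivatives. *)
Lemma smooth_stable (S : set (R -> R)) :
  (forall f, S f -> exists2 f', S f' & forall x, has_derivative f x (f' x)) ->
  forall f, S f -> smooth f.
Proof.
move=> HS f Sf n.
suff [_ ? //] : S (f^`(n))%classic /\ forall x, derivable (f^`(n))%classic x 1.
elim: n => [|n [/HS[f' Sf' df'] _]].
  by split => // x; have [f' _ /(_ x)[]] := HS _ Sf.
rewrite derive1nS (has_derivativeE df').
by split => // x; have [f'' _ /(_ x)[]] := HS _ Sf'.
Qed.

Lemma smooth_antiderivative f f' :
  (forall x, has_derivative f x (f' x)) -> smooth f' -> smooth f.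
Proof.
move=> df sf' [|n] x; first by have [] := df x.
by rewrite derive1Sn (has_derivativeE df).
Qed.

Lemma has_derivative_quadratic f x C : f x = 0 ->
  (forall y, `|f y| <= C * (y - x) ^+ 2) -> has_derivative f x 0.
Proof.
move=> fx fC.
have C0 : 0 <= C.
  by have := fC (x + 1); rewrite addrAC subrr add0r expr1n mulr1; exact: le_trans.
suff H : (fun h : R => h^-1 *: ((f \o shift x) (h *: (1 : R)) - f x)) @ 0^' --> (0 : R).
  by split; [exact: (cvgP _ H)|exact: (cvg_lim _ H)].
apply/cvgrPdist_lt => e e0; near=> h.
have h0 : h != 0 by near: h; exact: nbhs_dnbhs_neq.
rewrite fx subr0 sub0r normrN /= /GRing.scale/= mulr1 normrM normfV.
rewrite ltr_pdivrMl ?normr_gt0//.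
apply: (le_lt_trans (fC _)); rewrite addrK -real_normK ?num_real// expr2 mulrCA.
rewrite ltr_pM2l ?normr_gt0//.
have hC : `|h| < e / (C + 1).
  rewrite -[h]subr0; near: h; apply: nbhs_dnbhs; apply: near_dist_lt.
  by rewrite divr_gt0// ltr_wpDl.
rewrite ltr_pdivlMr ?ltr_wpDl// in hC.
have := normr_ge0 h; nra.
Unshelve. all: by end_near. Qed.

(** The flat function e^(-1/x) with the negative powers of x that differentiation produces: index n
    leads to n + 1 and n + 2, so the span of the family is closed under derivation. *)
Definition expinv n x := if 0 < x then (x^-1) ^+ n * expR (- x^-1) else 0.

Lemma expinv_ge0 n x : 0 <= expinv n x.
Proof.
by rewrite /expinv; case: ifPn => // x0; rewrite mulr_ge0 ?expR_ge0 ?exprn_ge0 ?invr_ge0 ?ltW.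
Qed.

Lemma expinv_le0 n x : x <= 0 -> expinv n x = 0.
Proof. by rewrite /expinv ltNge => ->. Qed.

(** Raise y <= e^y at y = x / m to the power m. *)
Lemma expR_ge_exprn m x : 0 <= x -> x ^+ m <= m%:R ^+ m * expR x.
Proof.
case: m => [|m] x0.
  by rewrite !expr0 mul1r -expR0 ler_expR.
have H : x / m.+1%:R <= expR (x / m.+1%:R).
  by rewrite (le_trans _ (expR_ge1Dx _))// lerDr.
have := @lerXn2r R m.+1 (x / m.+1%:R) (expR (x / m.+1%:R)).
rewrite !nnegrE divr_ge0// expR_ge0 => /(_ isT isT H).
rewrite -expRM_natl mulrCA divff ?pnatr_eq0// mulr1 expr_div_n.
by rewrite ler_pdivrMr ?exprn_gt0// mulrC.
Qed.

(** The exponential bound at 1 / x with exponent n + 2 leaves a factor x ^ 2, as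
    [has_derivative_quadratic] requires at the junction point 0. *)
Lemma expinv_quadratic n x : `|expinv n x| <= n.+2%:R ^+ n.+2 * x ^+ 2.
Proof.
rewrite ger0_norm ?expinv_ge0// /expinv; case: ifPn => x0; last first.
  by rewrite mulr_ge0 ?sqr_ge0// exprn_ge0.
have := @expR_ge_exprn n.+2 x^-1; rewrite invr_ge0 => /(_ (ltW x0)).
rewrite -(ler_pM2r (x := x ^+ 2 * expR (- x^-1))); last first.
  by rewrite mulr_gt0 ?expR_gt0 ?exprn_gt0.
have -> : n.+2%:R ^+ n.+2 * expR x^-1 * (x ^+ 2 * expR (- x^-1)) =
   n.+2%:R ^+ n.+2 * x ^+ 2 * (expR x^-1 * expR (- x^-1)) by ring.
rewrite expRxMexpNx_1 mulr1; apply: le_trans.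
rewrite mulrA ler_pM2r ?expR_gt0// -[n.+2]addn2 exprD -mulrA -exprMn mulVf ?gt_eqF//.
by rewrite expr1n mulr1.
Qed.

Lemma has_derivative_expinv n x :
  has_derivative (expinv n) x (expinv n.+2 x - n%:R * expinv n.+1 x).
Proof.
have [x0|x0|->] := ltrgtP x 0.
- rewrite !expinv_le0 ?ltW// mulr0 subr0.
  apply: (near_eq_has_derivative (f := fun=> 0)); last exact: has_derivative_cst.
  near=> y; rewrite expinv_le0//; apply: ltW; near: y.
  exact: lt_nbhsl.
- apply: (near_eq_has_derivative (f := fun y => (y^-1) ^+ n * expR (- y^-1))).
    near=> y; rewrite /expinv ifT//; near: y; exact: lt_nbhsr.
  have dV : has_derivative (fun y => y^-1) x (- (x^-1 ^+ 2)).
    have x0' := lt0r_neq0 x0.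
    have H := @is_deriveV R idfun x 1 1 x0' (is_derive_id x (1 : R)).
    by apply: (has_derivative_eq H); rewrite /GRing.scale/= mulr1 exprVn.
  have dN : has_derivative (fun y => - y^-1) x (x^-1 ^+ 2).
    have H := is_deriveN dV.
    by apply: (has_derivative_eq H); rewrite opprK.
  have dX : has_derivative (fun y => (y^-1) ^+ n) x (- (n%:R * x^-1 ^+ n.+1)).
    elim: n => [|n IH].
      by apply: (has_derivative_eq (has_derivative_cst x 1)); ring.
    rewrite (_ : (fun y => _) = fun y => y^-1 * y^-1 ^+ n); last first.
      by apply/funext => y; rewrite exprS.
    apply: (has_derivative_eq (has_derivativeM dV IH)).
    by rewrite !exprS; ring.
  apply: (has_derivative_eq (has_derivativeM dX
    (has_derivative_comp (is_derive_expR _) dN))).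
  by rewrite /expinv x0 !exprS; ring.
- have Z m : expinv m 0 = 0 by rewrite expinv_le0.
  rewrite !Z mulr0 subr0; apply: has_derivative_quadratic (Z n) _ => y.
  by rewrite subr0; exact: expinv_quadratic.
Unshelve. all: by end_near. Qed.

(** Sums of products that vanish outside ]s - e, s + e[; the centre s may change from term to term.
    This is the class to which [smooth_stable] is applied. *)
Inductive bump_span e : (R -> R) -> Prop :=
| bump_base c s i j : bump_span e
    (fun x => c * (expinv i (-1 * x + (s + e)) * expinv j (1 * x + (e - s))))
| bump_add f g : bump_span e f -> bump_span e g ->
    bump_span e (fun x => f x + g x).

Lemma bump_span_smooth e f : bump_span e f -> smooth f.
Proof.
apply: smooth_stable => {}f; elim=> [c s i j|{}f g _ [f' Sf' df'] _ [g' Sg' dg']];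
    last first.
  exists (fun x => f' x + g' x); first exact: bump_add.
  by move=> x; exact: has_derivativeD.
pose b c i j x := c * (expinv i (-1 * x + (s + e)) * expinv j (1 * x + (e - s))).
exists (fun x => b (- c) i.+2 j x + b (c * i%:R) i.+1 j x +
                 (b c i j.+2 x + b (- c * j%:R) i j.+1 x)).
  by apply: bump_add; apply: bump_add; exact: bump_base.
move=> x; apply: (has_derivative_eq (has_derivativeZ c (has_derivativeM
  (has_derivative_comp (has_derivative_expinv i _) (has_derivative_affine x (-1) (s + e)))
  (has_derivative_comp (has_derivative_expinv j _) (has_derivative_affine x 1 (e - s)))))).
by rewrite /b; ring.
Qed.

(** [P1] and [P2] are the first and second primitives of the bump [rho] that vanish on the left; on
    the right they become the total mass [c] and an affine function. Test functions will be
    combinations of three translates of [P2], whose second derivatives are the combinations of [rho]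
    declared smooth here. *)
Lemma bump_exists e : 0 < e -> exists (rho P1 P2 : R -> R) c d,
  [/\ 0 < c, forall x, 0 <= rho x,
      forall x, has_derivative P1 x (rho x) /\ has_derivative P2 x (P1 x),
      (forall x, x <= - e -> [/\ rho x = 0, P1 x = 0 & P2 x = 0]) /\
      (forall x, e <= x -> [/\ rho x = 0, P1 x = c & P2 x = c * x + d]) &
      (forall w s w' s' w'' s'', smooth (fun x =>
         w * rho (x - s) + w' * rho (x - s') + w'' * rho (x - s''))) /\
      continuous rho].
Proof.
move=> e0; pose rho x := 1 * (expinv 0 (-1 * x + e) * expinv 0 (1 * x + e)).
have drho : exists rho', forall x, has_derivative rho x (rho' x).
  eexists => x; exact: (has_derivativeZ _ (has_derivativeM
  (has_derivative_comp (has_derivative_expinv 0 _) (has_derivative_affine x (-1) e))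
  (has_derivative_comp (has_derivative_expinv 0 _) (has_derivative_affine x 1 e)))).
have crho : continuous rho.
  by case: drho => rho' drho x; exact: has_derivative_continuous (drho x).
have [F1 dF1] := continuous_antiderivative crho.
pose P1 x := F1 x - F1 (- e).
have dP1 x : has_derivative P1 x (rho x).
  by apply: (has_derivative_eq (has_derivativeB (dF1 x) (has_derivative_cst x _))); rewrite subr0.
have cP1 : continuous P1 by move=> x; exact: has_derivative_continuous (dP1 x).
have [F2 dF2] := continuous_antiderivative cP1.
pose P2 x := F2 x - F2 (- e).
have dP2 x : has_derivative P2 x (P1 x).
  by apply: (has_derivative_eq (has_derivativeB (dF2 x) (has_derivative_cst x _))); rewrite subr0.
have rho0 x : 0 <= rho x by rewrite /rho mul1r mulr_ge0// expinv_ge0.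
have rhol x : x <= - e -> rho x = 0.
  by move=> xe; rewrite /rho (@expinv_le0 0 (1 * x + e)) ?mulr0//; lra.
have rhor x : e <= x -> rho x = 0.
  by move=> xe; rewrite /rho (@expinv_le0 0 (-1 * x + e)) ?mul0r ?mulr0//; lra.
have P1l x : x <= - e -> P1 x = 0.
  move=> xe; have := @derive_eq0_eq R P1 x (- e).
  have H y : y \in `[x, - e] -> has_derivative P1 y 0.
    by rewrite in_itv/= => /andP[_ ye]; rewrite -(rhol y ye).
  by move=> /(_ H (- e)); rewrite in_itv/= lexx xe => /(_ isT) <-; rewrite /P1 subrr.
have P2l x : x <= - e -> P2 x = 0.
  move=> xe; have := @derive_eq0_eq R P2 x (- e).
  have H y : y \in `[x, - e] -> has_derivative P2 y 0.
    by rewrite in_itv/= => /andP[_ ye]; rewrite -(P1l y ye).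
  by move=> /(_ H (- e)); rewrite in_itv/= lexx xe => /(_ isT) <-; rewrite /P2 subrr.
have P1r x : e <= x -> P1 x = P1 e.
  move=> ex; apply: (@derive_eq0_eq R P1 e x) => [y|]; rewrite in_itv/= ?lexx ?ex//.
  by move=> /andP[ey _]; rewrite -(rhor y ey).
exists rho, P1, P2, (P1 e), (P2 e - P1 e * e); split => //.
- rewrite lt_neqAle; apply/andP; split; last first.
    rewrite -(P1l (- e))//; apply: (@derive_ge0_le R P1 rho) => //; lra.
  apply/eqP => /esym P1e.
  have := @derive_ge0_eq0 R P1 rho (- e) e (fun x _ => dP1 x) (fun x _ => rho0 x).
  rewrite P1l// P1e => /(_ erefl 0); rewrite in_itv/= oppr_lt0 e0 => /(_ isT).
  rewrite /rho !mulr0 !add0r mul1r /expinv e0 !expr0 !mul1r => /eqP.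
  by rewrite mulf_eq0 orbb gt_eqF// expR_gt0.
- split=> x xe; split; [exact: rhol|exact: P1l|exact: P2l|exact: rhor|exact: P1r|].
  have := @derive_eq0_eq R (fun y => P2 y - (P1 e * y + 0)) e x.
  have H y : y \in `[e, x] -> has_derivative (fun y => P2 y - (P1 e * y + 0)) y 0.
    rewrite in_itv/= => /andP[ey _].
    apply: (has_derivative_eq (has_derivativeB (dP2 y) (has_derivative_affine y _ _))).
    by rewrite P1r// subrr.
  move=> /(_ H x); rewrite in_itv/= lexx xe => /(_ isT); rewrite !addr0 => E.
  by rewrite -[P2 x](subrK (P1 e * x)) E; ring.
- split=> // w s w' s' w'' s''; apply: (@bump_span_smooth e).
  pose b c t x := c * (expinv 0 (-1 * x + (t + e)) * expinv 0 (1 * x + (e - t))).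
  have bE c t x : c * rho (x - t) = b c t x.
    rewrite /rho /b; congr (_ * _); rewrite mul1r; congr (expinv _ _ * expinv _ _); ring.
  rewrite (_ : (fun x => _) = fun x => b w s x + b w' s' x + b w'' s'' x); last first.
    by apply/funext => x; rewrite !bE.
  by apply: bump_add; [apply: bump_add|]; exact: bump_base.
Qed.

End TestFunctions.

Lemma measurable_Omega {R : realType} : @measurable _ (measurableTypeR R) (@Omega R).
Proof. by rewrite /Omega. Qed.
#[export] Hint Extern 0 (@measurable _ _ (@Omega _)) =>
  exact: measurable_Omega : core.

(** * Integration by parts against test functions *)

Section WeakToClassical.
Context {R : realType}.
Implicit Types (f g h phi : R -> R) (a b c e x y : R).
Local Notation mu := (@lebesgue_measure R).
Local Notation halfpi := (pi / 2 : R).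

Lemma halfpi_gt0 : 0 < halfpi.
Proof. by have := pihalf_ge1 R; apply: lt_le_trans. Qed.

Lemma test_function_smooth phi : test_function phi -> smooth phi.
Proof. by case=> sphi _ _; exact: sphi. Qed.

Lemma smooth_has_derivative phi n x : smooth phi ->
  has_derivative (phi^`(n))%classic x ((phi^`(n.+1))%classic x).
Proof. by move=> sphi; split; [exact: sphi|rewrite derive1nS derive1E]. Qed.

Lemma smooth_continuous phi n : smooth phi -> continuous (phi^`(n))%classic.
Proof.
by move=> sphi x; exact: has_derivative_continuous (smooth_has_derivative n x sphi).
Qed.

(** Such a point has a neighbourhood disjoint from the closed support. At both ends of the interval
    this removes the boundary terms of integration by parts. *)
Lemma test_function_boundary phi x : test_function phi -> ~ Omega x ->
  phi x = 0 /\ (phi^`(1))%classic x = 0.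
Proof.
move=> /[dup] tphi [_ _ sub] xO.
have cl : ~ closure [set x | phi x != 0] x by move=> /sub.
have phi0 : \forall y \near x, phi y = 0.
  have : nbhs x (~` closure [set x | phi x != 0]).
    by apply: open_nbhs_nbhs; split=> //; exact/closed_openC/closed_closure.
  apply: filterS => y ycl; apply/eqP/negP => /negP y0.
  by apply: ycl; exact: subset_closure.
split; first exact: nbhs_singleton phi0.
have H := @smooth_has_derivative phi 0 x (test_function_smooth tphi).
apply: (has_derivative_unique H).
apply: (near_eq_has_derivative (f := fun=> 0)); last exact: has_derivative_cst.
by apply: filterS phi0 => y; exact: esym.
Qed.

Lemma halfpi_notin : ~ Omega (- halfpi) /\ ~ Omega halfpi.
Proof. by rewrite /Omega/=; split; rewrite in_itv/= ltxx ?andbF. Qed.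

Lemma parts1_test f f' phi : test_function phi ->
  (forall x, x \in `[- halfpi, halfpi] -> has_derivative f x (f' x)) ->
  {within `[- halfpi, halfpi], continuous f'} ->
  \int[mu]_(x in Omega) (f x * (phi^`(1))%classic x) =
  - \int[mu]_(x in Omega) (f' x * phi x).
Proof.
move=> tphi df cf'; have sphi := test_function_smooth tphi.
have le : - halfpi <= halfpi by have := halfpi_gt0; lra.
have cphi n : {within `[- halfpi, halfpi], continuous (phi^`(n))%classic}.
  by apply: continuous_subspaceT; exact: smooth_continuous.
have cf := has_derivative_within df.
have c1 : {within `[- halfpi, halfpi], continuous (fun x => f x * (phi^`(1))%classic x)}.
  by move=> x; apply: cvgM; [exact: cf|exact: cphi].
have c2 : {within `[- halfpi, halfpi], continuous (fun x => f' x * phi x)}.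
  by move=> x; apply: cvgM; [exact: cf'|exact: (cphi 0)].
have := @FTC_oo R (fun x => f x * phi x)
  (fun x => f' x * phi x + f x * (phi^`(1))%classic x) _ _ le.
have H x : x \in `[- halfpi, halfpi] -> has_derivative (fun x => f x * phi x) x
    (f' x * phi x + f x * (phi^`(1))%classic x).
  by move=> /df fx; exact: has_derivativeM fx (smooth_has_derivative 0 x sphi).
have c3 : {within `[- halfpi, halfpi],
    continuous (fun x => f' x * phi x + f x * (phi^`(1))%classic x)}.
  by move=> x; apply: cvgD; [exact: c2|exact: c1].
move=> /(_ H c3).
have [nl nr] := halfpi_notin.
have [-> _] := test_function_boundary tphi nl.
have [-> _] := test_function_boundary tphi nr.
rewrite RintegralD//; [|exact: integrable_within_continuous..].
by rewrite !mulr0 subrr addrC => /eqP; rewrite addr_eq0 => /eqP.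
Qed.

Lemma parts2_test f f' f'' phi : test_function phi ->
  (forall x, x \in `[- halfpi, halfpi] -> has_derivative f x (f' x)) ->
  (forall x, x \in `[- halfpi, halfpi] -> has_derivative f' x (f'' x)) ->
  {within `[- halfpi, halfpi], continuous f''} ->
  \int[mu]_(x in Omega) (f x * (phi^`(2))%classic x) =
  \int[mu]_(x in Omega) (f'' x * phi x).
Proof.
move=> tphi df df' cf''; have sphi := test_function_smooth tphi.
have le : - halfpi <= halfpi by have := halfpi_gt0; lra.
have cphi n : {within `[- halfpi, halfpi], continuous (phi^`(n))%classic}.
  by apply: continuous_subspaceT; exact: smooth_continuous.
have cf := has_derivative_within df.
have c1 : {within `[- halfpi, halfpi], continuous (fun x => f x * (phi^`(2))%classic x)}.
  by move=> x; apply: cvgM; [exact: cf|exact: cphi].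
have c2 : {within `[- halfpi, halfpi], continuous (fun x => f'' x * phi x)}.
  by move=> x; apply: cvgM; [exact: cf''|exact: (cphi 0)].
have := @FTC_oo R (fun x => f x * (phi^`(1))%classic x - f' x * phi x)
  (fun x => f x * (phi^`(2))%classic x - f'' x * phi x) _ _ le.
have H x : x \in `[- halfpi, halfpi] ->
    has_derivative (fun x => f x * (phi^`(1))%classic x - f' x * phi x) x
    (f x * (phi^`(2))%classic x - f'' x * phi x).
  move=> xab; have d0 : has_derivative phi x ((phi^`(1))%classic x).
    exact: (smooth_has_derivative 0).
  apply: (has_derivative_eq (has_derivativeB
    (has_derivativeM (df _ xab) (smooth_has_derivative 1 x sphi))
    (has_derivativeM (df' _ xab) d0))).
  by ring.
have c3 : {within `[- halfpi, halfpi],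
    continuous (fun x => f x * (phi^`(2))%classic x - f'' x * phi x)}.
  by move=> x; apply: cvgB; [exact: c1|exact: c2].
move=> /(_ H c3).
have [nl nr] := halfpi_notin.
have [-> ->] := test_function_boundary tphi nl.
have [-> ->] := test_function_boundary tphi nr.
rewrite RintegralB//; [|exact: integrable_within_continuous..].
by rewrite !mulr0 subrr => /eqP; rewrite subr_eq0 => /eqP.
Qed.

Lemma continuous_eq0_closed g a b : a < b -> continuous g ->
  (forall x, x \in `]a, b[ -> g x = 0) -> forall x, x \in `[a, b] -> g x = 0.
Proof.
move=> ab cg g0 x; rewrite in_itv/= => /andP[ax xb].
apply/eqP/negPn/negP => gx0.
have /cvgrPdist_lt/(_ `|g x|) := cg x.
rewrite normr_gt0 => /(_ gx0)/nbhs_ballP[d/= d0 Hd].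
(* Moving [x] towards the midpoint by the fraction [t] enters the open interval and covers a
   distance less than [d]. *)
pose m := (a + b) / 2; pose t := d / (`|m - x| + 1 + d).
have D0 : 0 < `|m - x| + 1 + d by have := normr_ge0 (m - x); lra.
have t0 : 0 < t by rewrite divr_gt0.
have t1 : t < 1 by rewrite ltr_pdivrMr// mul1r; have := normr_ge0 (m - x); lra.
have tm : t * `|m - x| < d.
  rewrite mulrAC ltr_pdivrMr// ltr_pM2l//; lra.
have yab : x + t * (m - x) \in `]a, b[.
  by rewrite in_itv/=; apply/andP; split; rewrite /m; nra.
have /Hd /= : ball x d (x + t * (m - x)).
  by rewrite /ball/= opprD addNKr normrN normrM gtr0_norm.
by rewrite (g0 _ yab) subr0 ltxx.
Qed.

End WeakToClassical.

(** * The du Bois-Reymond lemma for second derivatives *)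

Section DuBoisReymond.
Context {R : realType}.
Implicit Types (f g h phi : R -> R) (a b c e r s x y : R).
Local Notation mu := (@lebesgue_measure R).
Local Notation halfpi := (pi / 2 : R).

Lemma subr_le_radius s e r x : `|s| + e <= r -> x <= - r -> x - s <= - e.
Proof. by have := ler_norm (- s); rewrite normrN; lra. Qed.

Lemma subr_ge_radius s e r x : `|s| + e <= r -> r <= x -> e <= x - s.
Proof. by have := ler_norm s; lra. Qed.

(** The translated bump acts as c times an approximate Dirac mass at s; the error is the oscillation
    of h on the support, times the mass. *)
Lemma bump_mean h (rho P1 : R -> R) c e (eta : R) s : continuous h -> continuous rho ->
  (forall x, 0 <= rho x) -> (forall x, has_derivative P1 x (rho x)) ->
  (forall x, x <= - e -> rho x = 0 /\ P1 x = 0) ->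
  (forall x, e <= x -> rho x = 0 /\ P1 x = c) ->
  `|s| + e < halfpi -> (forall y, `|y - s| < e -> `|h y - h s| <= eta) ->
  `|\int[mu]_(x in Omega) (h x * rho (x - s)) - h s * c| <= eta * c.
Proof.
move=> ch crho rho0 dP1 Pl Pr sp Hs.
have dsub x : has_derivative (fun y => y - s) x 1.
  apply: (has_derivative_eq (has_derivativeB (has_derivative_id x) (has_derivative_cst x s))).
  by rewrite subr0.
have crs : continuous (fun x => rho (x - s)).
  by move=> x; apply: (continuous_comp (f := fun x => x - s) (g := rho));
    [apply: cvgB; [exact: cvg_id|exact: cvg_cst]|exact: crho].
have iOm f : continuous f -> mu.-integrable (@Omega R) (EFin \o f).
  by move=> cf; apply: integrable_within_continuous; exact: continuous_subspaceT.
have ci k : continuous (fun x => k * rho (x - s)).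
  by move=> x; apply: cvgM; [exact: cvg_cst|exact: crs].
have chr : continuous (fun x => h x * rho (x - s)).
  by move=> x; apply: cvgM; [exact: ch|exact: crs].
have intr k : \int[mu]_(x in Omega) (k * rho (x - s)) = k * c.
  rewrite (@FTC_oo R (fun x => k * P1 (x - s)) (fun x => k * rho (x - s))).
  - have [_ ->] := Pl _ (subr_le_radius (ltW sp) (lexx _)).
    have [_ ->] := Pr _ (subr_ge_radius (ltW sp) (lexx _)).
    by rewrite mulr0 subr0.
  - by rewrite ge0_cp// ltW// halfpi_gt0.
  - move=> x _; apply: has_derivativeZ.
    by apply: (has_derivative_eq (has_derivative_comp (dP1 _) (dsub x))); rewrite mulr1.
  - exact: continuous_subspaceT.
have rho_out x : e <= `|x - s| -> rho (x - s) = 0.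
  move=> xs; have [x0|x0] := lerP 0 (x - s).
    by have [] := Pr (x - s); rewrite // -(ger0_norm x0).
  by have [] := Pl (x - s); rewrite // lerNr -(ltr0_norm x0).
(* One nonnegative integrand serves for both inequalities, with k = 1 and k = -1. *)
have bnd k : (forall y, `|y - s| < e -> 0 <= k * (h y - h s) + eta) ->
    0 <= k * (\int[mu]_(x in Omega) (h x * rho (x - s)) - h s * c) + eta * c.
  move=> Hk.
  have -> : k * (\int[mu]_(x in Omega) (h x * rho (x - s)) - h s * c) + eta * c =
      \int[mu]_(x in Omega) ((k * (h x - h s) + eta) * rho (x - s)).
    have -> : (fun x => (k * (h x - h s) + eta) * rho (x - s)) =
        (fun x => k * (h x * rho (x - s)) + (eta - k * h s) * rho (x - s)).
      by apply/funext => x; ring.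
    rewrite RintegralD//; last 2 first.
    - by apply: iOm => x; apply: cvgM; [exact: cvg_cst|exact: chr].
    - exact: iOm.
    rewrite RintegralZl//; last exact: iOm.
    by rewrite intr; ring.
  apply: (@Rintegral_ge0 _ _ _ mu) => x _.
  have [xs|xs] := ltrP `|x - s| e; first by rewrite mulr_ge0// Hk.
  by rewrite rho_out// mulr0.
have B1 := bnd 1; have B2 := bnd (-1).
have H1 y : `|y - s| < e -> 0 <= 1 * (h y - h s) + eta.
  by move=> /Hs; rewrite ler_norml => /andP[? _]; lra.
have H2 y : `|y - s| < e -> 0 <= -1 * (h y - h s) + eta.
  by move=> /Hs; rewrite ler_norml => /andP[_ ?]; lra.
rewrite ler_norml; apply/andP; split; first by have := B1 H1; lra.
by have := B2 H2; lra.
Qed.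

(* [w0, w1, w2] is a second difference: it annihilates affine functions, hence
   the corresponding combination of bump potentials has compact support. *)
Lemma dubois_reymond_points h x0 x1 x2 : continuous h ->
  (forall phi, test_function phi ->
     \int[mu]_(x in Omega) (h x * (phi^`(2))%classic x) = 0) ->
  `|x0| < halfpi -> `|x1| < halfpi -> `|x2| < halfpi ->
  (x2 - x1) * h x0 - (x2 - x0) * h x1 + (x1 - x0) * h x2 = 0.
Proof.
move=> ch Hh X0 X1 X2.
pose w0 := x2 - x1; pose w1 := - (x2 - x0); pose w2 := x1 - x0.
pose W := `|w0| + `|w1| + `|w2|.
have W0 : 0 <= W by rewrite /W !addr_ge0.
rewrite -mulNr -/w0 -/w1 -/w2; set S := _ + _.
apply/eqP/negPn/negP => S0.
(* The total error will be at most [eta * W * c], which is strictly less than [|S| * c] thanks to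
   the + 1; this also covers W = 0. *)
pose eta := `|S| / (W + 1).
have eta0 : 0 < eta by rewrite divr_gt0 ?normr_gt0// ltr_wpDl.
have near_h x : `|x| < halfpi -> exists2 d, 0 < d & forall e, e <= d ->
    `|x| + e < halfpi /\ forall y, `|y - x| < e -> `|h y - h x| <= eta.
  move=> xp; have /cvgrPdist_lt/(_ eta eta0)/nbhs_ballP[d/= d0 Hd] := ch x.
  exists (Num.min d ((halfpi - `|x|) / 2)).
    by rewrite lt_min d0/= divr_gt0// subr_gt0.
  move=> e; rewrite le_min => /andP[ed ex]; split; first lra.
  move=> y yx; rewrite distrC; apply/ltW/Hd; rewrite /ball/= distrC.
  exact: lt_le_trans ed.
have [d0 d00 Hd0] := near_h _ X0; have [d1 d10 Hd1] := near_h _ X1.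
have [d2 d20 Hd2] := near_h _ X2.
pose e := Num.min d0 (Num.min d1 d2).
have e0 : 0 < e by rewrite !lt_min d00 d10.
have [|E0 N0] := Hd0 e; first by rewrite ge_min lexx.
have [|E1 N1] := Hd1 e; first by rewrite !ge_min lexx orbT.
have [|E2 N2] := Hd2 e; first by rewrite !ge_min lexx !orbT.
have [rho [P1 [P2 [c [d [c0 rho0 dP [Pl Pr] [srho crho]]]]]]] := bump_exists e0.
pose phi x := w0 * P2 (x - x0) + w1 * P2 (x - x1) + w2 * P2 (x - x2).
pose phi1 x := w0 * P1 (x - x0) + w1 * P1 (x - x1) + w2 * P1 (x - x2).
pose phi2 x := w0 * rho (x - x0) + w1 * rho (x - x1) + w2 * rho (x - x2).
have shift F f' s x : (forall y, has_derivative F y (f' y)) ->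
    has_derivative (fun y => F (y - s)) x (f' (x - s)).
  move=> dF; have H : has_derivative (fun y => y - s) x 1.
    apply: (has_derivative_eq (has_derivativeB (has_derivative_id x) (has_derivative_cst x s))).
    by rewrite subr0.
  by apply: (has_derivative_eq (has_derivative_comp (dF _) H)); rewrite mulr1.
have dphi x : has_derivative phi x (phi1 x).
  by apply: has_derivativeD; [apply: has_derivativeD|]; apply: has_derivativeZ;
    apply: shift => y; case: (dP y).
have dphi1 x : has_derivative phi1 x (phi2 x).
  by apply: has_derivativeD; [apply: has_derivativeD|]; apply: has_derivativeZ;
    apply: shift => y; case: (dP y).
pose r := Num.max (`|x0| + e) (Num.max (`|x1| + e) (`|x2| + e)).
have rpi : r < halfpi by rewrite !gt_max E0 E1 E2.
have r0 : `|x0| + e <= r by rewrite le_max lexx.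
have r1 : `|x1| + e <= r by rewrite !le_max lexx orbT.
have r2 : `|x2| + e <= r by rewrite !le_max lexx !orbT.
have supp : [set x | phi x != 0] `<=` `[- r, r].
  move=> x /=; apply: contraR; rewrite in_itv/= negb_and -!ltNge => /orP[xr|xr].
    rewrite /phi.
    have [_ _ ->] := Pl _ (subr_le_radius r0 (ltW xr)).
    have [_ _ ->] := Pl _ (subr_le_radius r1 (ltW xr)).
    have [_ _ ->] := Pl _ (subr_le_radius r2 (ltW xr)).
    by rewrite !mulr0 !addr0.
  rewrite /phi.
  have [_ _ ->] := Pr _ (subr_ge_radius r0 (ltW xr)).
  have [_ _ ->] := Pr _ (subr_ge_radius r1 (ltW xr)).
  have [_ _ ->] := Pr _ (subr_ge_radius r2 (ltW xr)).
  by apply/eqP; rewrite /w0 /w1 /w2; ring.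
have clsupp : closure [set x | phi x != 0] `<=` `[- r, r].
  by rewrite [X in _ `<=` X](closure_id _).1; [exact: closure_subset|exact: itv_closed].
have tphi : test_function phi.
  split.
  - have : smooth phi.
      apply: (smooth_antiderivative dphi); apply: (smooth_antiderivative dphi1).
      exact: srho.
    by move=> sphi; exact: sphi.
  - apply: (subclosed_compact _ (segment_compact (a := - r) (b := r))) => //.
    exact: closed_closure.
  - apply: (subset_trans clsupp) => x /=; rewrite /Omega/= !in_itv/= => /andP[xr rx].
    by rewrite (le_lt_trans rx rpi) (lt_le_trans _ xr)// ltrN2.
have phi2E : (phi^`(2))%classic = phi2.
  by rewrite derive1Sn (has_derivativeE dphi) derive1n1 (has_derivativeE dphi1).
pose I s := \int[mu]_(x in Omega) (h x * rho (x - s)).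
have crs s : continuous (fun x => rho (x - s)).
  by move=> x; apply: (continuous_comp (f := fun x => x - s) (g := rho));
    [apply: cvgB; [exact: cvg_id|exact: cvg_cst]|exact: crho].
have iOm f : continuous f -> mu.-integrable (@Omega R) (EFin \o f).
  by move=> cf; apply: integrable_within_continuous; exact: continuous_subspaceT.
have chr s k : continuous (fun x => (h x + k) * rho (x - s)).
  move=> x; apply: cvgM; last exact: crs.
  by apply: cvgD; [exact: ch|exact: cvg_cst].
have IE s : `|s| + e < halfpi -> (forall y, `|y - s| < e -> `|h y - h s| <= eta) ->
    `|I s - h s * c| <= eta * c.
  move=> sp Hs; apply: (bump_mean ch crho rho0 (fun x => (dP x).1) _ _ sp Hs).
  - by move=> x /Pl[].
  - by move=> x /Pr[].
have := Hh _ tphi; rewrite phi2E.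
have -> : \int[mu]_(x in Omega) (h x * phi2 x) = w0 * I x0 + w1 * I x1 + w2 * I x2.
  have -> : (fun x => h x * phi2 x) = (fun x => w0 * ((h x + 0) * rho (x - x0)) +
     w1 * ((h x + 0) * rho (x - x1)) + w2 * ((h x + 0) * rho (x - x2))).
    by apply/funext => x; rewrite /phi2; ring.
  have ci w s : continuous (fun x => w * ((h x + 0) * rho (x - s))).
    by move=> x; apply: cvgM; [exact: cvg_cst|exact: chr].
  rewrite RintegralD//; [|by apply: iOm => x; apply: cvgD; exact: ci|exact: iOm].
  rewrite RintegralD//; [|exact: iOm..].
  rewrite !RintegralZl//; [|exact: iOm..].
  have II s : \int[mu]_(x in Omega) ((h x + 0) * rho (x - s)) = I s.
    by apply: eq_Rintegral => x _; rewrite addr0.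
  by rewrite !II.
have := IE _ E0 N0; have := IE _ E1 N1; have := IE _ E2 N2.
set A := I x0; set B := I x1; set C := I x2 => HC HB HA HS.
have : `|S| * c <= eta * W * c.
  have -> : `|S| * c = `|w0 * (A - h x0 * c) + w1 * (B - h x1 * c) + w2 * (C - h x2 * c)|.
    rewrite -[X in _ * X](gtr0_norm c0) -normrM -normrN; congr `|_|.
    by rewrite /S -[LHS]addr0 -HS; ring.
  apply: (le_trans (ler_normD _ _)); apply: (le_trans (lerD (ler_normD _ _) (lexx _))).
  rewrite !normrM /W.
  have := ler_wpM2l (normr_ge0 w0) HA; have := ler_wpM2l (normr_ge0 w1) HB.
  have := ler_wpM2l (normr_ge0 w2) HC; lra.
rewrite ler_pM2r// /eta leNgt => /negP; apply.
rewrite mulrAC ltr_pdivrMr ?ltr_wpDl// ltr_pM2l ?normr_gt0//; lra.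
Qed.

(** With the outer nodes fixed at - 1/2 and 1/2, which lie in the interval because pi / 2 >= 1, the
    vanishing second difference determines h by affine interpolation between these two values. The
    end points follow by continuity. *)
Lemma dubois_reymond h : continuous h ->
  (forall phi, test_function phi ->
     \int[mu]_(x in Omega) (h x * (phi^`(2))%classic x) = 0) ->
  exists A B, forall x, x \in `[- halfpi, halfpi] -> h x = B * x + A.
Proof.
move=> ch Hh; have p1 := pihalf_ge1 R.
pose B := h (1 / 2) - h (- (1 / 2)); pose A := (h (1 / 2) + h (- (1 / 2))) / 2.
exists A, B => x xab; apply/eqP; rewrite -subr_eq0; apply/eqP.
apply: (continuous_eq0_closed (g := fun x => h x - (B * x + A)) _ _ _ xab); first lra.
  move=> y; apply: cvgB; first exact: ch.
  by apply: cvgD; [apply: cvgM; [exact: cvg_cst|exact: cvg_id]|exact: cvg_cst].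
move=> y; rewrite in_itv/= -ltr_norml => yb.
have := @dubois_reymond_points h (- (1 / 2)) y (1 / 2) ch Hh.
have l1 : `|- (1 / 2) : R| < halfpi by rewrite normrN ger0_norm; lra.
have l2 : `|1 / 2 : R| < halfpi by rewrite ger0_norm; lra.
by move=> /(_ l1 yb l2); rewrite /A /B; lra.
Qed.

End DuBoisReymond.

(** * Real square-integrable functions *)

Section RealL2.
Context {R : realType}.
Implicit Types (f g h : R -> R) (a b c e x y : R).
Local Notation mu := (@lebesgue_measure R).
Local Notation halfpi := (pi / 2 : R).
Local Notation mfun f := (@measurable_fun _ _ (measurableTypeR R) (measurableTypeR R) Omega f).
Local Notation integrable f := (mu.-integrable (@Omega R) (EFin \o f)).

Definition sqint g : Prop := mfun g /\ integrable (fun x => g x ^+ 2).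

Definition ip f g : R := \int[mu]_(x in Omega) (f x * g x).

Lemma Lfun2P g : (g \_ (@Omega R) : R -> R) \in Lfun mu 2%:E <-> sqint g.
Proof.
split=> [H|[mg ig]].
  split.
    move: (H); rewrite inE => /andP[]; rewrite inE/= => mg _.
    by apply/(measurable_restrictT _ _).2 => //; exact: measurable_Omega.
  have := Lfun2_integrable_sqr H => ig.
  have X := @integrable_mkcond _ _ _ mu _ (EFin \o (fun x => g x ^+ 2)) measurable_Omega.
  apply: X.2.
  apply: (eq_integrable _ _ _ _ ig) => // x _ /=.
  by rewrite /patch; case: ifP => //; rewrite expr0n.
have mg' : measurable_fun [set: measurableTypeR R] (g \_ Omega : measurableTypeR R -> measurableTypeR R).
  by apply/(measurable_restrictT _ _).1 => //; exact: measurable_Omega.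
rewrite inE; apply/andP; split; rewrite inE//=.
rewrite /finite_norm unlock poweR_lty//.
have X := @integrable_mkcond _ _ _ mu _ (EFin \o (fun x => g x ^+ 2)) measurable_Omega.
have /integrableP[_] := X.1 ig.
apply: le_lt_trans; apply: ge0_le_integral => //=.
- apply/measurable_EFinP.
    apply/(@measurableT_comp _ _ _ _ _ _ (fun x : R => x `^ 2)%R) => //.
    exact/measurableT_comp.
- exact: (measurable_int mu (integrable_abse (X.1 ig))).
- move=> x _; rewrite /patch; case: ifP => _; rewrite lee_fin.
    by rewrite normrX powR_mulrn.
  by rewrite !normr0 powR0// pnatr_eq0.
Qed.


Lemma integrableDR f g : integrable f -> integrable g ->
  integrable (fun x => f x + g x).
Proof. by move=> fi gi; exact: (integrableD measurable_Omega fi gi). Qed.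

Lemma integrableZR c f : integrable f -> integrable (fun x => c * f x).
Proof. by move=> fi; exact: (integrableZl measurable_Omega c fi). Qed.

Lemma sqint_mul f g : sqint f -> sqint g -> integrable (fun x => f x * g x).
Proof.
move=> [mf fi] [mg gi].
apply: (@le_integrable _ _ _ mu _ measurable_Omega _
  (EFin \o (fun x => f x ^+ 2 + g x ^+ 2))).
- by apply/measurable_EFinP; exact: measurable_funM.
- move=> x _ /=; rewrite lee_fin [leRHS]ger0_norm ?addr_ge0 ?sqr_ge0//.
  rewrite normrM -[leRHS]/(f x ^+ 2 + g x ^+ 2).
  rewrite -(real_normK (num_real (f x))) -(real_normK (num_real (g x))).
  have := sqr_ge0 (`|f x| - `|g x|).
  have := mulr_ge0 (normr_ge0 (f x)) (normr_ge0 (g x)); lra.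
- exact: integrableDR.
Qed.

Lemma sqintZ c f : sqint f -> sqint (fun x => c * f x).
Proof.
move=> [mf fi]; split.
  by apply: measurable_funM => //; exact: measurable_cst.
rewrite (_ : (fun x => _) = (fun x => c ^+ 2 * f x ^+ 2)); last first.
  by apply/funext => x; rewrite exprMn.
exact: integrableZR.
Qed.

Lemma sqintD f g : sqint f -> sqint g -> sqint (fun x => f x + g x).
Proof.
move=> sf sg; have fg := sqint_mul sf sg; move: sf sg => [mf fi] [mg gi]; split.
  exact: measurable_funD.
rewrite (_ : (fun x => _) = (fun x => f x ^+ 2 + (2 * (f x * g x) + g x ^+ 2))); last first.
  by apply/funext => x; ring.
by apply: integrableDR => //; apply: integrableDR => //; exact: integrableZR.
Qed.

Lemma sqintB f g : sqint f -> sqint g -> sqint (fun x => f x - g x).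
Proof.
move=> sf /(sqintZ (-1)) /(sqintD sf).
by under [X in sqint X -> _]eq_fun do rewrite mulN1r.
Qed.

Lemma finite_Omega : (mu (@Omega R) < +oo)%E.
Proof. by rewrite /Omega lebesgue_measure_itv/=; case: ifP => _; rewrite ltry. Qed.

Lemma integrable_bounded f c : mfun f -> (forall x, Omega x -> `|f x| <= c) ->
  integrable f.
Proof.
move=> mf fc; apply: (measurable_bounded_integrable measurable_Omega finite_Omega mf).
by exists c; split; [exact: num_real|move=> y cy x /fc/le_trans; apply; exact: ltW].
Qed.

Lemma sqint_bounded f c : mfun f -> (forall x, Omega x -> `|f x| <= c) -> sqint f.
Proof.
move=> mf fc; split=> //; apply: (@integrable_bounded _ (c ^+ 2)).
  exact: measurable_funX.
move=> x /fc fx; rewrite normrX; apply: lerXn2r => //; rewrite nnegrE//.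
exact: le_trans fx.
Qed.

Lemma sqint_within f : {within `[- halfpi, halfpi], continuous f} -> sqint f.
Proof.
move=> cf; have mf : mfun f.
  apply: (@measurable_funS _ _ _ _ `[- halfpi, halfpi]%classic) => //.
    by rewrite /Omega; exact: subset_itv_oo_cc.
  exact: subspace_continuous_measurable_fun.
split=> //; apply: integrable_within_continuous => x.
rewrite (_ : (fun x => _) = (fun x => f x * f x)).
  by apply: cvgM; exact: cf.
by apply/funext => y; rewrite expr2.
Qed.

Lemma sqint_continuous f : continuous f -> sqint f.
Proof. by move=> cf; apply: sqint_within; exact: continuous_subspaceT. Qed.

Lemma ipC f g : ip f g = ip g f.
Proof. by rewrite /ip; apply: eq_Rintegral => x _; rewrite mulrC. Qed.

Lemma ipDl f g h : sqint f -> sqint g -> sqint h ->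
  ip (fun x => f x + g x) h = ip f h + ip g h.
Proof.
move=> sf sg sh; rewrite /ip; under eq_Rintegral do rewrite mulrDl.
by rewrite RintegralD//; exact: sqint_mul.
Qed.

Lemma ipZl c f h : sqint f -> sqint h -> ip (fun x => c * f x) h = c * ip f h.
Proof.
move=> sf sh; rewrite /ip; under eq_Rintegral do rewrite -mulrA.
by rewrite RintegralZl//; exact: sqint_mul.
Qed.

Lemma ipBl f g h : sqint f -> sqint g -> sqint h ->
  ip (fun x => f x - g x) h = ip f h - ip g h.
Proof.
move=> sf sg sh; rewrite /ip; under eq_Rintegral do rewrite mulrBl.
by rewrite RintegralB//; exact: sqint_mul.
Qed.

Lemma ip_ge0 f : 0 <= ip f f.
Proof. by apply: (@Rintegral_ge0 _ _ _ mu) => x _; rewrite -expr2 sqr_ge0. Qed.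

(** Expand the square and use that the square of f - g is nonnegative. It replaces the triangle
    inequality while working with squared norms only. *)
Lemma ipDD_le f g : sqint f -> sqint g ->
  ip (fun x => f x + g x) (fun x => f x + g x) <= 2 * ip f f + 2 * ip g g.
Proof.
move=> sf sg; have sD := sqintD sf sg; have sB := sqintB sf sg.
have -> : ip (fun x => f x + g x) (fun x => f x + g x) = ip f f + 2 * ip f g + ip g g.
  rewrite ipDl// (ipC f (fun x => f x + g x)) (ipC g (fun x => f x + g x)).
  by rewrite !ipDl// (ipC g f); ring.
have := ip_ge0 (fun x => f x - g x).
have -> : ip (fun x => f x - g x) (fun x => f x - g x) = ip f f - 2 * ip f g + ip g g.
  rewrite ipBl// (ipC f (fun x => f x - g x)) (ipC g (fun x => f x - g x)).
  by rewrite !ipBl// (ipC g f); ring.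
lra.
Qed.

Lemma Rintegral_cvg (u : (R -> R)^nat) f g :
  (forall n, mfun (u n)) -> (forall n x, Omega x -> `|u n x| <= g x) ->
  integrable g -> (forall x, Omega x -> u n x @[n --> \oo] --> f x) ->
  \int[mu]_(x in Omega) u n x @[n --> \oo] --> \int[mu]_(x in Omega) f x.
Proof.
move=> mu_ ug ig uf.
have mf : mfun f by exact: (measurable_fun_cvg mu_).
have Hu n : @measurable_fun _ _ (measurableTypeR R) _ Omega (EFin \o u n).
  by apply/measurable_EFinP; exact: mu_.
have Hf : @measurable_fun _ _ (measurableTypeR R) _ Omega (EFin \o f).
  by apply/measurable_EFinP; exact: mf.
have cu : {ae mu, forall x, Omega x -> (EFin \o u n) x @[n --> \oo] --> (EFin \o f) x}.
  by apply: aeW => x Ox; apply: cvg_EFin; [exact: nearW|exact: uf].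
have bu : {ae mu, forall x n, Omega x -> (`|(EFin \o u n) x| <= (EFin \o g) x)%E}.
  by apply: aeW => x n Ox; rewrite /= lee_fin; exact: ug.
have [fi _ cf] := dominated_convergence measurable_Omega Hu Hf cu ig bu.
apply: fine_cvg; rewrite fineK; first exact: cf.
exact: integrable_fin_num.
Qed.

Lemma Rintegral_ae_eq f g : mfun f -> mfun g -> ae_eq mu Omega f g ->
  \int[mu]_(x in Omega) f x = \int[mu]_(x in Omega) g x.
Proof.
move=> mf mg fg; rewrite /Rintegral; congr fine.
apply: ae_eq_integral => //; [exact/measurable_EFinP|exact/measurable_EFinP|].
by apply: filterS fg => x H /H ->.
Qed.

End RealL2.

(** * Eigenfunctions *)

Local Open Scope complex_scope.

Section Kernel.
Context {R : realType}.
Implicit Types (f u : R -> R[i]) (g phi : R -> R) (a k A B x : R) (l : R[i]).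
Local Notation mu := (@lebesgue_measure R).
Local Notation halfpi := (pi / 2 : R).
Local Notation mfun f := (@measurable_fun _ _ (measurableTypeR R) (measurableTypeR R) Omega f).

Local Notation re f := (fun x => complex.Re (f x)).
Local Notation im f := (fun x => complex.Im (f x)).

Lemma L2P f : L2 f <-> sqint (re f) /\ sqint (im f).
Proof. by split=> -[/Lfun2P ? /Lfun2P ?]. Qed.

Lemma continuous_maxr (g h : R -> R) : continuous g -> continuous h ->
  continuous (fun x => Num.max (g x) (h x)).
Proof.
move=> cg ch x; exact: (@continuous_max _ _ g h x (cg x) (ch x)).
Qed.

Lemma continuous_minr (g h : R -> R) : continuous g -> continuous h ->
  continuous (fun x => Num.min (g x) (h x)).
Proof.
move=> cg ch x; exact: (@continuous_min _ _ g h x (cg x) (ch x)).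
Qed.

(** Extends by constants a function known to be continuous on the closed interval only, since
    [continuous_antiderivative] and [dubois_reymond] ask for continuity on the line. *)
Lemma continuous_clamp g a b : a <= b -> {within `[a, b], continuous g} ->
  continuous (fun x => g (Num.max a (Num.min x b))).
Proof.
move=> ab /subspace_continuousP cg x.
have inab y : Num.max a (Num.min y b) \in `[a, b].
  by rewrite in_itv/= le_max lexx/= ge_max ab ge_min lexx orbT.
have ccl : continuous (fun y : R => Num.max a (Num.min y b)).
  apply: continuous_maxr; first exact: cst_continuous.
  by apply: continuous_minr; [move=> y; exact: cvg_id|exact: cst_continuous].
apply: (cvg_trans _ (cg _ (inab x))).
apply: (@cvg_comp _ _ _ (fun y : R => Num.max a (Num.min y b)) g _ (within [set` `[a, b]] (nbhs (Num.max a (Num.min x b))))) => //.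
move=> S SS.
have H : \forall y \near x, (Num.max a (Num.min y b) \in `[a, b]) ->
  S (Num.max a (Num.min y b)) by exact: (ccl x _ SS).
suff : \forall y \near x, S (Num.max a (Num.min y b)) by [].
by apply: filterS H => y; apply; exact: inab.
Qed.

Lemma kerH_weak a l f phi : kerH a l f -> test_function phi ->
  \int[mu]_(x in Omega) (complex.Re (f x) * (phi^`(2))%classic x) =
    \int[mu]_(x in Omega)
      (- (complex.Re l * complex.Re (f x) - complex.Im l * complex.Im (f x)) * phi x) /\
  \int[mu]_(x in Omega) (complex.Im (f x) * (phi^`(2))%classic x) =
    \int[mu]_(x in Omega)
      (- (complex.Re l * complex.Im (f x) + complex.Im l * complex.Re (f x)) * phi x).
Proof.
move=> [_ _ wd] /wd; rewrite expr2 mulrNN !mul1r /cintegral => -[E1 E2].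
split.
- transitivity (\int[mu]_(x in Omega) complex.Re (f x * ((phi^`(2))%classic x)%:C)).
    apply: eq_Rintegral => x _; case: (f x) => p q /=; ring.
  rewrite E1; apply: eq_Rintegral => x _; case: (f x) => p q; case: l {wd E1 E2} => l1 l2 /=; ring.
- transitivity (\int[mu]_(x in Omega) complex.Im (f x * ((phi^`(2))%classic x)%:C)).
    apply: eq_Rintegral => x _; case: (f x) => p q /=; ring.
  rewrite E2; apply: eq_Rintegral => x _; case: (f x) => p q; case: l {wd E1 E2} => l1 l2 /=; ring.
Qed.

(* Elliptic regularity by hand: subtracting a second antiderivative of the right
   hand side leaves a function with vanishing weak second derivative. *)
Lemma weak_solution_regular (U V : R -> R) : continuous U -> continuous V ->
  (forall phi, test_function phi ->
    \int[mu]_(x in Omega) (U x * (phi^`(2))%classic x) =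
    \int[mu]_(x in Omega) (V x * phi x)) ->
  exists P dP, forall x, x \in `[- halfpi, halfpi] ->
    [/\ has_derivative P x (dP x), has_derivative dP x (V x) & P x = U x].
Proof.
move=> cU cV weak.
have [G1 dG1] := continuous_antiderivative cV.
have cG1 : continuous G1 by move=> x; exact: has_derivative_continuous (dG1 x).
have [G2 dG2] := continuous_antiderivative cG1.
have cG2 : continuous G2 by move=> x; exact: has_derivative_continuous (dG2 x).
have [||A [B UG]] := @dubois_reymond R (fun x => U x - G2 x).
- by move=> x; apply: cvgB; [exact: cU|exact: cG2].
- move=> phi tphi; have sphi := test_function_smooth tphi.
  have sq g : continuous g -> sqint g by exact: sqint_continuous.
  under eq_Rintegral do rewrite mulrBl.
  rewrite RintegralB//; last 2 first.
  - by apply: sqint_mul; apply: sq => //; exact: smooth_continuous.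
  - by apply: sqint_mul; apply: sq => //; exact: smooth_continuous.
  rewrite weak// (@parts2_test R G2 G1 V phi) ?subrr//.
  exact: continuous_subspaceT.
exists (fun x => G2 x + (B * x + A)), (fun x => G1 x + B) => x xab; split.
- exact: has_derivativeD (dG2 x) (has_derivative_affine x B A).
- apply: (has_derivative_eq (has_derivativeD (dG1 x) (has_derivative_cst x B))).
  exact: addr0.
- by rewrite -UG//; ring.
Qed.

(** The weak equation concerns [f], the boundary conditions concern its continuous representative.
    The clamped representative agrees with [f] almost everywhere, so it satisfies both, and the
    regular solutions [P] and [Q] coincide with its two parts on the whole closed interval. *)
Lemma kerH_classical a l f : -1 < a -> a < 1 -> kerH a l f ->
  exists P dP Q dQ, [/\
    helmholtz (complex.Re l) (complex.Im l) P dP Q dQ (- halfpi) halfpi,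
    P (- halfpi) = P (halfpi * a) /\ P (halfpi * a) = P halfpi,
    Q (- halfpi) = Q (halfpi * a) /\ Q (halfpi * a) = Q halfpi &
    eq_L2 f (fun x => P x +i* Q x)].
Proof.
move=> aN1 a1 kf; have [[[L2f _] [u [cr ci fu] [bc1 bc2]]] _ _] := kf.
have p0 := halfpi_gt0 (R := R).
have pp : - halfpi <= halfpi by rewrite ge0_cp// ltW.
pose cl x := Num.max (- halfpi) (Num.min x halfpi).
have clE x : x \in `[- halfpi, halfpi] -> cl x = x.
  rewrite in_itv/= => /andP[x1 x2].
  by rewrite /cl min_l// max_r.
pose U x := complex.Re (u (cl x)); pose V x := complex.Im (u (cl x)).
have cU : continuous U by exact: (continuous_clamp pp cr).
have cV : continuous V by exact: (continuous_clamp pp ci).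
have fUV : eq_L2 f (fun x => U x +i* V x).
  apply: filterS fu => x H Ox; rewrite (H Ox) /U /V clE; first by case: (u x).
  exact: subset_itv_oo_cc.
have [sr si] := (L2P f).1 L2f.
pose l1 := complex.Re l; pose l2 := complex.Im l.
pose gU x := - (l1 * U x - l2 * V x); pose gV x := - (l1 * V x + l2 * U x).
have cgU : continuous gU.
  by move=> x; apply: cvgN; apply: cvgB; apply: cvgM;
    [exact: cvg_cst|exact: cU|exact: cvg_cst|exact: cV].
have cgV : continuous gV.
  by move=> x; apply: cvgN; apply: cvgD; apply: cvgM;
    [exact: cvg_cst|exact: cV|exact: cvg_cst|exact: cU].
have mc g : continuous g -> mfun g by move=> /sqint_continuous[].
have mphi phi n : test_function phi -> mfun (phi^`(n))%classic.
  by move=> /test_function_smooth/(@smooth_continuous R phi n)/mc.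
have weakU phi : test_function phi ->
    \int[mu]_(x in Omega) (U x * (phi^`(2))%classic x) =
    \int[mu]_(x in Omega) (gU x * phi x).
  move=> tphi; have [E _] := kerH_weak kf tphi.
  transitivity (\int[mu]_(x in Omega) (complex.Re (f x) * (phi^`(2))%classic x)).
    apply: Rintegral_ae_eq.
    - by apply: measurable_funM; [exact: mc|exact: mphi].
    - by apply: measurable_funM; [exact: sr.1|exact: mphi].
    - by apply: filterS fUV => x H /H ->.
  rewrite E; apply: Rintegral_ae_eq.
  - apply: measurable_funM; last exact: (mphi _ 0).
    apply: measurableT_comp => //.
    by apply: measurable_funB; apply: measurable_funM => //; [exact: sr.1|exact: si.1].
  - by apply: measurable_funM; [exact: mc|exact: (mphi _ 0)].
  - by apply: filterS fUV => x H /H ->.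
have weakV phi : test_function phi ->
    \int[mu]_(x in Omega) (V x * (phi^`(2))%classic x) =
    \int[mu]_(x in Omega) (gV x * phi x).
  move=> tphi; have [_ E] := kerH_weak kf tphi.
  transitivity (\int[mu]_(x in Omega) (complex.Im (f x) * (phi^`(2))%classic x)).
    apply: Rintegral_ae_eq.
    - by apply: measurable_funM; [exact: mc|exact: mphi].
    - by apply: measurable_funM; [exact: si.1|exact: mphi].
    - by apply: filterS fUV => x H /H ->.
  rewrite E; apply: Rintegral_ae_eq.
  - apply: measurable_funM; last exact: (mphi _ 0).
    apply: measurableT_comp => //.
    by apply: measurable_funD; apply: measurable_funM => //; [exact: si.1|exact: sr.1].
  - by apply: measurable_funM; [exact: mc|exact: (mphi _ 0)].
  - by apply: filterS fUV => x H /H ->.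
have [P [dP HP]] := weak_solution_regular cU cgU weakU.
have [Q [dQ HQ]] := weak_solution_regular cV cgV weakV.
exists P, dP, Q, dQ.
have inb : (- halfpi \in `[- halfpi, halfpi]) * (halfpi \in `[- halfpi, halfpi]) *
   (halfpi * a \in `[- halfpi, halfpi]).
  by do 2?split; rewrite in_itv/= ?lexx ?pp//; apply/andP; split; nra.
have PE x (xb : x \in `[- halfpi, halfpi]) : P x = U x by have [] := HP _ xb.
have QE x (xb : x \in `[- halfpi, halfpi]) : Q x = V x by have [] := HQ _ xb.
split.
- move=> x xb; have [H1 H2 _] := HP _ xb; have [H3 H4 _] := HQ _ xb.
  by split => //; rewrite PE// QE.
- by rewrite !PE ?inb// /U !clE ?inb// bc1 bc2.
- by rewrite !QE ?inb// /V !clE ?inb// bc1 bc2.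
- apply: filterS fUV => x H Ox; rewrite (H Ox) PE ?QE//;
  exact: subset_itv_oo_cc.
Qed.

Definition trig k A B x : R := A * cos (k * x) + B * sin (k * x).

Definition trig_bc a k A B : Prop :=
  trig k A B (- halfpi) = trig k A B (halfpi * a) /\
  trig k A B (halfpi * a) = trig k A B halfpi.

(* For k = 0 the sine coefficient is invisible, and is normalised to 0. *)
Lemma kerH_explicit a l f : -1 < a -> a < 1 -> kerH a l f ->
  eq_L2 f (fun=> 0) \/
  exists k A B A' B', [/\ 0 <= k, l = (k ^+ 2)%:C, k = 0 -> B = 0 /\ B' = 0,
    trig_bc a k A B /\ trig_bc a k A' B' &
    eq_L2 f (fun x => trig k A B x +i* trig k A' B' x)].
Proof.
move=> aN1 a1 kf.
have [P [dP [Q [dQ [H [P1 P2] [Q1 Q2] fPQ]]]]] := kerH_classical aN1 a1 kf.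
have p0 := halfpi_gt0 (R := R).
have cN : - halfpi < halfpi * a by nra.
have c1 : halfpi * a < halfpi by nra.
have inb : (- halfpi \in `[- halfpi, halfpi]) * (halfpi \in `[- halfpi, halfpi]) *
   (halfpi * a \in `[- halfpi, halfpi]).
  by do 2?split; rewrite in_itv/=; apply/andP; split; nra.
have [Z|[l20 l10]] := helmholtz_real cN c1 H P1 P2 Q1 Q2.
  left; apply: filterS fPQ => x e Ox; rewrite (e Ox).
  by have [-> ->] := Z x (subset_itv_oo_cc Ox).
right; pose k := Num.sqrt (complex.Re l).
have kE : k ^+ 2 = complex.Re l by rewrite sqr_sqrtr.
have HP x : x \in `[- halfpi, halfpi] -> has_derivative dP x (- (k ^+ 2 * P x)).
  by move=> /H[_ + _ _] => h; apply: (has_derivative_eq h); rewrite l20 kE; ring.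
have HQ x : x \in `[- halfpi, halfpi] -> has_derivative dQ x (- (k ^+ 2 * Q x)).
  by move=> /H[_ _ _ h]; apply: (has_derivative_eq h); rewrite l20 kE; ring.
have HP0 x : x \in `[- halfpi, halfpi] -> has_derivative P x (dP x) by move=> /H[].
have HQ0 x : x \in `[- halfpi, halfpi] -> has_derivative Q x (dQ x) by move=> /H[].
have [EP EP0] := helmholtz_explicit p0 HP0 HP.
have [EQ EQ0] := helmholtz_explicit p0 HQ0 HQ.
have lE : l = (k ^+ 2)%:C by rewrite kE; case: l l20 {kf H l10 k kE HP HQ EP EP0 EQ EQ0} => ? ? /= ->.
have [k0|k0] := eqVneq k 0.
- have [A [B {}EP]] := EP0 k0; have [A' [B' {}EQ]] := EQ0 k0.
  have B0 : B = 0 by move: P1; rewrite P2 !EP ?inb//; nra.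
  have B'0 : B' = 0 by move: Q1; rewrite Q2 !EQ ?inb//; nra.
  have tE (C : R) x : trig k C 0 x = C by rewrite /trig k0 mul0r cos0; ring.
  exists k, A, 0, A', 0; split=> //; first exact: sqrtr_ge0.
    by rewrite /trig_bc !tE.
  apply: filterS fPQ => x e Ox; have xb := subset_itv_oo_cc Ox.
  by rewrite (e Ox) EP// EQ// B0 B'0 !mul0r !addr0 !tE.
- have [A [B {}EP]] := EP k0; have [A' [B' {}EQ]] := EQ k0.
  exists k, A, B, A', B'; split=> //.
  + exact: sqrtr_ge0.
  + by move=> k0'; rewrite k0' eqxx in k0.
  + by rewrite /trig_bc /trig -!EP ?inb// -!EQ ?inb.
  apply: filterS fPQ => x e Ox; have xb := subset_itv_oo_cc Ox.
  by rewrite (e Ox) EP// EQ.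
Qed.

End Kernel.

(** * Trigonometric functions in the kernel *)

Section TrigEigenfunctions.
Context {R : realType}.
Implicit Types (f u : R -> R[i]) (g phi : R -> R) (a k A B x : R) (l : R[i]).
Local Notation mu := (@lebesgue_measure R).

Lemma has_derivative_trig k A B x :
  has_derivative (trig k A B) x (trig k (k * B) (- (k * A)) x).
Proof.
have -> : trig k A B = fun y => A * cos (k * y + 0) + B * sin (k * y + 0).
  by apply/funext => y; rewrite addr0.
apply: (has_derivative_eq (has_derivativeD (has_derivativeZ A (has_derivative_cos x k 0))
  (has_derivativeZ B (has_derivative_sin x k 0)))).
by rewrite addr0 /trig; ring.
Qed.

Lemma continuous_trig k A B : continuous (trig k A B).
Proof. by move=> x; exact: has_derivative_continuous (has_derivative_trig k A B x). Qed.

Lemma cintegral_real g : cintegral (fun x => (g x)%:C) = (\int[mu]_(x in Omega) g x)%:C.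
Proof. by rewrite /cintegral /= Rintegral_cst// mul0r. Qed.

Lemma weak_derivative_real n (g h : R -> R) :
  (forall phi, test_function phi ->
    \int[mu]_(x in Omega) (g x * (phi^`(n))%classic x) =
    (-1) ^+ n * \int[mu]_(x in Omega) (h x * phi x)) ->
  weak_derivative n (fun x => (g x)%:C) (fun x => (h x)%:C).
Proof.
move=> H phi tphi.
have E (p q : R -> R) : (fun x => (p x)%:C * (q x)%:C) = (fun x => (p x * q x)%:C).
  by apply/funext => x; rewrite rmorphM.
by rewrite !E !cintegral_real H// rmorphM rmorphXn rmorphN1.
Qed.

Lemma L2_real g : sqint g -> L2 (fun x => (g x)%:C).
Proof.
by move=> sg; apply/L2P; split=> //=; apply: sqint_continuous; exact: cst_continuous.
Qed.

Lemma kerH_trig a k A B : trig_bc a k A B ->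
  kerH a (k ^+ 2)%:C (fun x => (trig k A B x)%:C).
Proof.
move=> [bc1 bc2].
have L2t C D : L2 (fun x => (trig k C D x)%:C).
  by apply: L2_real; apply: sqint_continuous; exact: continuous_trig.
pose T2 := trig k (k * - (k * A)) (- (k * (k * B))).
have T2E x : T2 x = - (k ^+ 2 * trig k A B x) by rewrite /T2 /trig; ring.
have W2 : weak_derivative 2 (fun x => (trig k A B x)%:C) (fun x => (T2 x)%:C).
  apply: weak_derivative_real => phi tphi; rewrite expr2 mulrNN !mul1r.
  apply: (@parts2_test R _ (trig k (k * B) (- (k * A)))) => // [x _|x _|].
  - exact: has_derivative_trig.
  - exact: has_derivative_trig.
  - by apply: continuous_subspaceT; exact: continuous_trig.
have W2' : (fun x => - ((k ^+ 2)%:C * (trig k A B x)%:C)) = (fun x => (T2 x)%:C).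
  apply/funext => x; apply/eqP; rewrite T2E eq_complex /=.
  by apply/andP; split; apply/eqP; ring.
split.
- split.
  + split; first exact: L2t.
    case=> [|[|[|n]]] // _.
    * exists (fun x => (trig k A B x)%:C) => //.
      by apply: weak_derivative_real => phi _; rewrite expr0 mul1r.
    * exists (fun x => (trig k (k * B) (- (k * A)) x)%:C) => //.
      apply: weak_derivative_real => phi tphi; rewrite expr1 mulN1r.
      apply: parts1_test => //.
      - by move=> x _; exact: has_derivative_trig.
      - by apply: continuous_subspaceT; exact: continuous_trig.
    * by exists (fun x => (T2 x)%:C); [exact: L2t|exact: W2].
  + exists (fun x => (trig k A B x)%:C); last by rewrite bc1 bc2.
    split.
    * by apply: continuous_subspaceT; exact: continuous_trig.
    * by apply: continuous_subspaceT; exact: cst_continuous.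
    * exact: aeW.
- have -> : (fun x => (k ^+ 2)%:C * (trig k A B x)%:C) =
      (fun x => (trig k (k ^+ 2 * A) (k ^+ 2 * B) x)%:C).
    by apply/funext => x; rewrite -rmorphM /trig; congr (_%:C); ring.
  exact: L2t.
- by rewrite W2'.
Qed.

End TrigEigenfunctions.

(** * Eigenfunctions of the adjoint *)

Section Dual.
Context {R : realType}.
Implicit Types (f u : R -> R[i]) (g phi : R -> R) (a b c k A B x : R) (l : R[i])
  (psi : nat -> R -> R[i]).
Local Notation mu := (@lebesgue_measure R).
Local Notation halfpi := (pi / 2 : R).
Local Notation mfun f := (@measurable_fun _ _ (measurableTypeR R) (measurableTypeR R) Omega f).
Local Notation re f := (fun x => complex.Re (f x)).
Local Notation im f := (fun x => complex.Im (f x)).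

Definition glue c (g h : R -> R) x := if x < c then g x else h x.

Lemma sqint_glue c (g h : R -> R) : sqint g -> sqint h -> sqint (glue c g h).
Proof.
move=> [mg gi] [mh hi].
have mlt : @measurable_fun _ _ (measurableTypeR R) _ Omega (fun x : R => x < c).
  apply: (measurable_funS (E := setT)) => //.
  by apply: measurable_fun_ltr => //; exact: measurable_id.
have mG : mfun (glue c g h).
  apply: measurable_fun_if => //.
  - by apply: measurable_funS mg => // x [].
  - by apply: measurable_funS mh => // x [].
split=> //; apply: (@le_integrable _ _ _ mu _ measurable_Omega _
  (EFin \o (fun x => g x ^+ 2 + h x ^+ 2))).
- by apply/measurable_EFinP; exact: measurable_funX.
- move=> x _ /=; rewrite lee_fin !ger0_norm ?addr_ge0 ?sqr_ge0// /glue.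
  by case: ifP => _; rewrite ?lerDl ?lerDr sqr_ge0.
- exact: integrableDR.
Qed.

Lemma ip_glue c (W g h : R -> R) : - halfpi < c -> c < halfpi ->
  continuous W -> continuous g -> continuous h ->
  ip W (glue c g h) = \int[mu]_(x in `]- halfpi, c[) (W x * g x) +
                      \int[mu]_(x in `]c, halfpi[) (W x * h x).
Proof.
move=> c1 c2 cW cg ch.
have iO : mu.-integrable (@Omega R) (EFin \o (fun x => W x * glue c g h x)).
  apply: sqint_mul; first exact: sqint_continuous.
  by apply: sqint_glue; exact: sqint_continuous.
have := @Rintegral_itvB R (fun x => W x * glue c g h x) (BRight (- halfpi))
  (BLeft halfpi) c iO.
rewrite !bnd_simp => /(_ (ltW c1) c2).
rewrite -[X in X - _]/(ip W (glue c g h)) => /eqP; rewrite subr_eq => /eqP ->.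
rewrite addrC -Rintegral_itv_bndo_bndc; last first.
  by apply: integrableS iO => //; rewrite /Omega; apply: subset_itvl; rewrite bnd_simp ltW.
congr (_ + _); apply: eq_Rintegral => x; rewrite inE/= in_itv/= /glue.
- by move=> /andP[_ ->].
- by move=> /andP[cx _]; rewrite ltNge (ltW cx).
Qed.

(** The orthogonality by which an adjoint eigenfunction for the eigenvalue [m] enters the proof.
    Testing real trigonometric functions suffices: by [kerH_explicit] the real and imaginary parts
    of a nonzero eigenfunction have this form. *)
Definition dual a m phi : Prop := sqint phi /\ forall k A B,
  trig_bc a k A B -> k ^+ 2 != m -> ip (trig k A B) phi = 0.

(* Eigenfunctions of the adjoint: continuous at the interior point, zero at the
   ends, and with total jump of the derivative equal to zero. *)
Lemma dual_glue a m (g g' h h' : R -> R) : -1 < a -> a < 1 ->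
  (forall x, has_derivative g x (g' x)) ->
  (forall x, has_derivative g' x (- (m * g x))) ->
  (forall x, has_derivative h x (h' x)) ->
  (forall x, has_derivative h' x (- (m * h x))) ->
  g (- halfpi) = 0 -> h halfpi = 0 -> g (halfpi * a) = h (halfpi * a) ->
  g' (- halfpi) - g' (halfpi * a) + h' (halfpi * a) - h' halfpi = 0 ->
  dual a m (glue (halfpi * a) g h).
Proof.
move=> aN1 a1 dg dg' dh dh' g0 h0 gh jump.
have cg : continuous g by move=> x; exact: has_derivative_continuous (dg x).
have ch : continuous h by move=> x; exact: has_derivative_continuous (dh x).
have p0 := halfpi_gt0 (R := R).
have cN : - halfpi < halfpi * a by nra.
have c1 : halfpi * a < halfpi by nra.
split=> [|k A B [bc1 bc2] km].
  by apply: sqint_glue; exact: sqint_continuous.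
pose W := trig k A B; pose W' := trig k (k * B) (- (k * A)).
have cW : continuous W by exact: continuous_trig.
have dW x : has_derivative W x (W' x) by exact: has_derivative_trig.
have dW' x : has_derivative W' x (- (k ^+ 2 * W x)).
  apply: (has_derivative_eq (has_derivative_trig k (k * B) (- (k * A)) x)).
  by rewrite /W /trig; ring.
have green (p p' : R -> R) s t : s <= t -> continuous p ->
    (forall x, has_derivative p x (p' x)) ->
    (forall x, has_derivative p' x (- (m * p x))) ->
    (m - k ^+ 2) * \int[mu]_(x in `]s, t[) (W x * p x) =
      (p t * W' t - p' t * W t) - (p s * W' s - p' s * W s).
  move=> st cp dp dp'.
  have cWp : {within `[s, t], continuous (fun x => W x * p x)}.
    by apply: continuous_subspaceT => x; apply: cvgM; [exact: cW|exact: cp].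
  rewrite -RintegralZl//; last exact: integrable_within_continuous.
  rewrite (@FTC_oo R (fun x => p x * W' x - p' x * W x))//.
  - move=> x _; apply: (has_derivative_eq (has_derivativeB
      (has_derivativeM (dp x) (dW' x)) (has_derivativeM (dp' x) (dW x)))).
    by ring.
  - apply: continuous_subspaceT => x; apply: cvgM; first exact: cvg_cst.
    by apply: cvgM; [exact: cW|exact: cp].
(* Summing Green's formula over both sides, the terms with W' cancel by the Dirichlet and continuity
   conditions. W has one value at all three points, so the rest is that value times the total
   jump. *)
have : (m - k ^+ 2) * ip W (glue (halfpi * a) g h) = 0.
  rewrite (ip_glue cN c1 cW cg ch) mulrDr (green _ g' _ _ (ltW cN))//.
  rewrite (green _ h' _ _ (ltW c1))// g0 h0 gh.
  have e1 : W (halfpi * a) = W (- halfpi) by rewrite /W bc1.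
  have e2 : W halfpi = W (- halfpi) by rewrite /W bc1 bc2.
  rewrite e1 e2; transitivity (W (- halfpi) *
    (g' (- halfpi) - g' (halfpi * a) + h' (halfpi * a) - h' halfpi)); first ring.
  by rewrite jump mulr0.
move=> /eqP; rewrite mulf_eq0 subr_eq0 => /orP[/eqP mk|/eqP //].
by rewrite mk eqxx in km.
Qed.

(* In terms of these phases the boundary conditions factor, see [trig_bcP]. *)
Definition phaseL a k : R := k * (halfpi * (1 + a)) / 2.
Definition phaseR a k : R := k * (halfpi * (1 - a)) / 2.

Lemma phaseD a k : k * halfpi = phaseL a k + phaseR a k.
Proof. by rewrite /phaseL /phaseR; lra. Qed.

Lemma phaseB a k : k * (halfpi * a) = phaseL a k - phaseR a k.
Proof. by rewrite /phaseL /phaseR; lra. Qed.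

(** For the phases u and v, the arguments k x at the three points are - (u + v), u - v and u + v.
    Equality at the ends leaves 2 B sin (u + v); equality at the last two points leaves 2 sin v (A
    sin u - B cos u). *)
Lemma trig_bcP a k A B : trig_bc a k A B <->
  B * sin (phaseL a k + phaseR a k) = 0 /\
  sin (phaseR a k) * (A * sin (phaseL a k) - B * cos (phaseL a k)) = 0.
Proof.
rewrite /trig_bc /trig mulrN (phaseD a) phaseB cosN sinN.
rewrite cosB sinB cosD sinD.
set s := sin (phaseL a k); set t := cos (phaseL a k).
set s' := sin (phaseR a k); set t' := cos (phaseR a k).
by split=> -[H1 H2]; split; nra.
Qed.

(** The shifts make each piece vanish at its end. At the interior point the arguments are 2 u and -
    2 v, so continuity reads al sin 2u + be sin 2v = 0 and zero total jump reads al (1 - cos 2u) =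
    be (1 - cos 2v). *)
Lemma dual_sin a k (al be : R) : -1 < a -> a < 1 ->
  al * (sin (phaseL a k) * cos (phaseL a k)) +
    be * (sin (phaseR a k) * cos (phaseR a k)) = 0 ->
  al * sin (phaseL a k) ^+ 2 = be * sin (phaseR a k) ^+ 2 ->
  dual a (k ^+ 2) (glue (halfpi * a) (fun x => al * sin (k * x + k * halfpi))
                                     (fun x => be * sin (k * x + - (k * halfpi)))).
Proof.
move=> aN1 a1 E1 E2.
have dsin (r c : R) x : has_derivative (fun x => r * sin (k * x + c)) x
    (r * (k * cos (k * x + c))).
  exact: has_derivativeZ (has_derivative_sin _ _ _).
have dcos (r c : R) x : has_derivative (fun x => r * (k * cos (k * x + c))) x
    (- (k ^+ 2 * (r * sin (k * x + c)))).
  apply: (has_derivative_eq (has_derivativeZ _ (has_derivativeZ _ (has_derivative_cos _ _ _)))).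
  by ring.
have eL : k * (halfpi * a) + k * halfpi = phaseL a k + phaseL a k.
  by rewrite phaseB (phaseD a); lra.
have eR : k * (halfpi * a) + - (k * halfpi) = - (phaseR a k + phaseR a k).
  by rewrite phaseB (phaseD a); lra.
apply: (dual_glue aN1 a1 (dsin al _) (dcos al _) (dsin be _) (dcos be _)).
- by rewrite mulrN addNr sin0 mulr0.
- by rewrite subrr sin0 mulr0.
- by rewrite eL eR sinN !sinD; lra.
- rewrite eL eR mulrN addNr subrr cos0 cosN !cosD -!expr2.
  have := cos2Dsin2 (phaseL a k); have := cos2Dsin2 (phaseR a k).
  set cL := cos (phaseL a k) ^+ 2; set cR := cos (phaseR a k) ^+ 2.
  move=> /(canRL (addrK _)) -> /(canRL (addrK _)) ->.
  transitivity (2 * k * (al * sin (phaseL a k) ^+ 2 - be * sin (phaseR a k) ^+ 2)).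
    by ring.
  by rewrite E2 subrr mulr0.
Qed.

(** For the eigenvalue 0 the derivative is constant on each side, so the total jump vanishes by
    itself. Each slope is, up to sign, the length of the other subinterval; both pieces then reach
    the product of the lengths. *)
Lemma dual_tent a : -1 < a -> a < 1 ->
  dual a 0 (glue (halfpi * a)
    (fun x => halfpi * (1 - a) * x + halfpi * (1 - a) * halfpi)
    (fun x => - (halfpi * (1 + a)) * x + halfpi * (1 + a) * halfpi)).
Proof.
move=> aN1 a1.
have daff (p q : R) x : has_derivative (fun x => p * x + q) x p.
  exact: has_derivative_affine.
have dcst (p q : R) x : has_derivative (fun=> p) x (- (0 * (p * x + q))).
  by apply: (has_derivative_eq (has_derivative_cst x p)); rewrite mul0r oppr0.
apply: (dual_glue aN1 a1 (daff _ _) (dcst _ _) (daff _ _) (dcst _ _)); ring.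
Qed.

Lemma Rintegral_continuous_eq0 g s t : s < t -> continuous g ->
  (forall x, 0 <= g x) -> \int[mu]_(x in `]s, t[) g x = 0 ->
  forall x, x \in `]s, t[ -> g x = 0.
Proof.
move=> st cg g0; have [G dG] := continuous_antiderivative cg.
rewrite (@FTC_oo R G g _ _ (ltW st) (fun x _ => dG x)); last exact: continuous_subspaceT.
move=> /eqP; rewrite subr_eq0 => /eqP E.
exact: (derive_ge0_eq0 (fun x _ => dG x) (fun x _ => g0 x) (esym E)).
Qed.

Lemma ip_glue_gt0 a (g h : R -> R) : -1 < a -> a < 1 ->
  continuous g -> continuous h ->
  (exists2 x, x \in `]- halfpi, halfpi * a[ & g x != 0) \/
  (exists2 x, x \in `]halfpi * a, halfpi[ & h x != 0) ->
  0 < ip (glue (halfpi * a) g h) (glue (halfpi * a) g h).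
Proof.
move=> aN1 a1 cg ch nz.
have p0 := halfpi_gt0 (R := R).
have cN : - halfpi < halfpi * a by nra.
have c1 : halfpi * a < halfpi by nra.
have cgg : continuous (fun x => g x * g x) by move=> x; apply: cvgM; exact: cg.
have chh : continuous (fun x => h x * h x) by move=> x; apply: cvgM; exact: ch.
have -> : ip (glue (halfpi * a) g h) (glue (halfpi * a) g h) =
    ip (fun=> 1) (glue (halfpi * a) (fun x => g x * g x) (fun x => h x * h x)).
  by apply: eq_Rintegral => x _; rewrite mul1r /glue; case: ifP.
rewrite (ip_glue cN c1)//; last exact: cst_continuous.
under eq_Rintegral do rewrite mul1r.
under [X in _ + X]eq_Rintegral do rewrite mul1r.
have gg0 x : 0 <= g x * g x by rewrite -expr2 sqr_ge0.
have hh0 x : 0 <= h x * h x by rewrite -expr2 sqr_ge0.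
have I1 : 0 <= \int[mu]_(x in `]- halfpi, (halfpi * a)[) (g x * g x).
  by apply: (@Rintegral_ge0 _ _ _ mu).
have I2 : 0 <= \int[mu]_(x in `](halfpi * a), halfpi[) (h x * h x).
  by apply: (@Rintegral_ge0 _ _ _ mu).
rewrite lt_neqAle addr_ge0// andbT eq_sym paddr_eq0//; apply/negP => /andP[/eqP Z1 /eqP Z2].
have := Rintegral_continuous_eq0 cN cgg gg0 Z1.
have := Rintegral_continuous_eq0 c1 chh hh0 Z2.
case: nz => -[x xI gx].
- by move=> _ /(_ x xI)/eqP; rewrite mulf_eq0 orbb (negPf gx).
- by move=> /(_ x xI)/eqP + _; rewrite mulf_eq0 orbb (negPf gx).
Qed.

Lemma sin_affine_neq0 (r k d s t : R) : r != 0 -> k != 0 -> s < t ->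
  exists2 x, x \in `]s, t[ & r * sin (k * x + d) != 0.
Proof.
move=> r0 k0 st.
have [//|H] := pselect (exists2 x, x \in `]s, t[ & r * sin (k * x + d) != 0).
pose m := (s + t) / 2.
have mI : m \in `]s, t[ by rewrite in_itv/= /m; apply/andP; split; lra.
have Z x : x \in `]s, t[ -> sin (k * x + d) = 0.
  move=> xI; apply/eqP/negPn/negP => nz; apply: H; exists x => //.
  by rewrite mulf_neq0.
have D : has_derivative (fun x => sin (k * x + d)) m 0.
  apply: (near_eq_has_derivative (f := fun=> 0)); last exact: has_derivative_cst.
  by near=> y; rewrite Z//; near: y; exact: near_in_itvoo.
have := has_derivative_unique (has_derivative_sin m k d) D.
move=> /eqP; rewrite mulf_eq0 (negPf k0)/= => /eqP cm.
have := cos2Dsin2 (k * m + d); rewrite cm Z// => /eqP.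
by rewrite expr0n addr0 eq_sym oner_eq0.
Unshelve. all: by end_near. Qed.

Lemma ip_ae_eq g h phi : sqint g -> sqint h -> sqint phi ->
  ae_eq mu Omega g h -> ip g phi = ip h phi.
Proof.
move=> [mg _] [mh _] [mphi _] gh; apply: Rintegral_ae_eq.
- exact: measurable_funM.
- exact: measurable_funM.
- by apply: filterS gh => x H /H ->.
Qed.

Definition orth phi f : Prop := ip (re f) phi = 0 /\ ip (im f) phi = 0.

Lemma ip0 phi : ip (fun=> 0) phi = 0.
Proof.
rewrite /ip; under eq_Rintegral do rewrite mul0r.
by rewrite Rintegral_cst// mul0r.
Qed.

Lemma eq_L2_orth phi f u : sqint phi -> L2 f -> L2 u -> eq_L2 f u ->
  orth phi u -> orth phi f.
Proof.
move=> sphi /L2P[fr fi] /L2P[ur ui] fu [or oi]; split.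
- by rewrite -or; apply: ip_ae_eq => //; apply: filterS fu => x H /H ->.
- by rewrite -oi; apply: ip_ae_eq => //; apply: filterS fu => x H /H ->.
Qed.

Lemma kerH_L2 a l f : kerH a l f -> L2 f.
Proof. by case=> -[[]]. Qed.

Lemma L2_trig k A B A' B' : L2 (fun x => trig k A B x +i* trig k A' B' x).
Proof. by apply/L2P; split; apply: sqint_continuous; exact: continuous_trig. Qed.

Lemma L2_0 : L2 (fun=> 0 : R[i]).
Proof. by apply/L2P; split; apply: sqint_continuous; exact: cst_continuous. Qed.

Lemma kerH_orth_trig a l f phi : -1 < a -> a < 1 -> sqint phi ->
  (forall k A B, trig_bc a k A B -> l = (k ^+ 2)%:C -> ip (trig k A B) phi = 0) ->
  kerH a l f -> orth phi f.
Proof.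
move=> aN1 a1 sphi ophi kf; have L2f := kerH_L2 kf.
have [f0|[k [A [B [A' [B' [_ lk _ [bc bc'] fE]]]]]]] := kerH_explicit aN1 a1 kf.
  by apply: eq_L2_orth f0 _ => //; [exact: L2_0|split; exact: ip0].
apply: eq_L2_orth fE _ => //; first exact: L2_trig.
by split; apply: ophi.
Qed.

Lemma kerH_orth a m l f phi : -1 < a -> a < 1 -> dual a m phi ->
  kerH a l f -> l <> m%:C -> orth phi f.
Proof.
move=> aN1 a1 [sphi dphi] kf lm; apply: (kerH_orth_trig aN1 a1 sphi _ kf).
by move=> k A B bc lk; apply: dphi => //; apply/eqP => km; apply: lm; rewrite lk km.
Qed.

Lemma L2norm_ge0 f : 0 <= L2norm f.
Proof. exact: sqrtr_ge0. Qed.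

Lemma L2norm_sqr f : L2 f -> L2norm f ^+ 2 = ip (re f) (re f) + ip (im f) (im f).
Proof.
move=> /L2P[sr si]; rewrite sqr_sqrtr; last first.
  by apply: (@Rintegral_ge0 _ _ _ mu) => x _; rewrite sqr_ge0.
rewrite /ip -RintegralD//; [|exact: sqint_mul..].
apply: eq_Rintegral => x _; case: (f x) => p q /=.
by rewrite sqr_sqrtr ?addr_ge0 ?sqr_ge0// -!expr2.
Qed.

Lemma lincombS (J : pred nat) (psi : nat -> R -> R[i]) n alpha x :
  lincomb J psi n.+1 alpha x =
  lincomb J psi n alpha x + (if J n then alpha n * psi n x else 0).
Proof. by rewrite /lincomb big_mkcond big_ord_recr -big_mkcond. Qed.

Lemma L2Z (z : R[i]) f : L2 f -> L2 (fun x => z * f x).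
Proof.
move=> /L2P[sr si]; apply/L2P; split.
- rewrite (_ : (fun x => _) = fun x => complex.Re z * complex.Re (f x) -
      complex.Im z * complex.Im (f x)); first by apply: sqintB; exact: sqintZ.
  by apply/funext => x; case: z (f x) => ? ? [].
- rewrite (_ : (fun x => _) = fun x => complex.Re z * complex.Im (f x) +
      complex.Im z * complex.Re (f x)); first by apply: sqintD; exact: sqintZ.
  by apply/funext => x; case: z (f x) => ? ? [].
Qed.

Lemma L2D f u : L2 f -> L2 u -> L2 (fun x => f x + u x).
Proof.
move=> /L2P[sr si] /L2P[sr' si']; apply/L2P; split.
- rewrite (_ : (fun x => _) = fun x => complex.Re (f x) + complex.Re (u x)).
    exact: sqintD.
  by apply/funext => x; case: (f x) (u x) => ? ? [].
- rewrite (_ : (fun x => _) = fun x => complex.Im (f x) + complex.Im (u x)).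
    exact: sqintD.
  by apply/funext => x; case: (f x) (u x) => ? ? [].
Qed.

Lemma orthZ phi (z : R[i]) f : sqint phi -> L2 f -> orth phi f ->
  orth phi (fun x => z * f x).
Proof.
move=> sphi /L2P[sr si] [or oi]; split.
- rewrite (_ : (fun x => _) = fun x => complex.Re z * complex.Re (f x) -
      complex.Im z * complex.Im (f x)).
    by rewrite ipBl ?ipZl ?or ?oi ?mulr0 ?subrr//; exact: sqintZ.
  by apply/funext => x; case: z (f x) => ? ? [].
- rewrite (_ : (fun x => _) = fun x => complex.Re z * complex.Im (f x) +
      complex.Im z * complex.Re (f x)).
    by rewrite ipDl ?ipZl ?or ?oi ?mulr0 ?addr0//; exact: sqintZ.
  by apply/funext => x; case: z (f x) => ? ? [].
Qed.

Lemma orthD phi f u : sqint phi -> L2 f -> L2 u -> orth phi f -> orth phi u ->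
  orth phi (fun x => f x + u x).
Proof.
move=> sphi /L2P[sr si] /L2P[sr' si'] [or oi] [or' oi']; split.
- rewrite (_ : (fun x => _) = fun x => complex.Re (f x) + complex.Re (u x)).
    by rewrite ipDl// or or' addr0.
  by apply/funext => x; case: (f x) (u x) => ? ? [].
- rewrite (_ : (fun x => _) = fun x => complex.Im (f x) + complex.Im (u x)).
    by rewrite ipDl// oi oi' addr0.
  by apply/funext => x; case: (f x) (u x) => ? ? [].
Qed.

Lemma lincomb_L2 (J : pred nat) psi n alpha :
  (forall j, J j -> L2 (psi j)) -> L2 (lincomb J psi n alpha).
Proof.
move=> Lpsi; elim: n => [|n IH].
  rewrite (_ : lincomb J psi 0 alpha = fun=> 0); first exact: L2_0.
  by apply/funext => x; rewrite /lincomb big_ord0.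
rewrite (_ : lincomb J psi n.+1 alpha = fun x => lincomb J psi n alpha x +
    (if J n then alpha n * psi n x else 0)); last first.
  by apply/funext => x; rewrite lincombS.
have Ls : L2 (fun x => if J n then alpha n * psi n x else 0).
  by case Jn: (J n); [apply: L2Z; exact: Lpsi|exact: L2_0].
exact: L2D IH Ls.
Qed.

Lemma lincomb_orth phi (J : pred nat) psi n alpha : sqint phi ->
  (forall j, J j -> L2 (psi j)) -> (forall j, J j -> orth phi (psi j)) ->
  orth phi (lincomb J psi n alpha).
Proof.
move=> sphi Lpsi opsi; elim: n => [|n IH].
  rewrite (_ : lincomb J psi 0 alpha = fun=> 0); first by split; exact: ip0.
  by apply/funext => x; rewrite /lincomb big_ord0.
rewrite (_ : lincomb J psi n.+1 alpha = fun x => lincomb J psi n alpha x +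
    (if J n then alpha n * psi n x else 0)); last first.
  by apply/funext => x; rewrite lincombS.
have Ls : L2 (fun x => if J n then alpha n * psi n x else 0).
  by case Jn: (J n); [apply: L2Z; exact: Lpsi|exact: L2_0].
have os : orth phi (fun x => if J n then alpha n * psi n x else 0).
  by case Jn: (J n); [apply: orthZ; [|exact: Lpsi|exact: opsi]|split; exact: ip0].
exact: orthD (lincomb_L2 n alpha Lpsi) Ls IH os.
Qed.

(** By Pythagoras the distance from [phi] to any combination is at least the norm of [phi], so [phi]
    itself cannot be approximated. *)
Lemma not_complete_orth phi (J : pred nat) psi : sqint phi -> 0 < ip phi phi ->
  (forall j, J j -> L2 (psi j)) -> (forall j, J j -> orth phi (psi j)) ->
  ~ complete_family J psi.
Proof.
move=> sphi phi0 Lpsi opsi compl.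
have Lphi := L2_real sphi.
have e0 : 0 < Num.sqrt (ip phi phi) by rewrite sqrtr_gt0.
have [n [alpha]] := compl _ Lphi _ e0.
have LS := lincomb_L2 n alpha Lpsi.
have [oS _] := lincomb_orth n alpha sphi Lpsi opsi.
move: LS oS; set S := lincomb J psi n alpha => LS oS.
have [sr si] := (L2P _).1 LS.
pose d x := (phi x)%:C - S x.
have dr : re d = fun x => phi x - complex.Re (S x).
  by apply/funext => x; rewrite /d; case: (S x).
have Ld : L2 d.
  have := L2D Lphi (L2Z (-1) LS); congr L2.
  by apply/funext => x; rewrite mulN1r.
rewrite -/d -[_ < _]negbK -leNgt; apply/negP/negPn.
rewrite -(ler_pXn2r (n := 2)) ?nnegrE ?sqrtr_ge0 ?L2norm_ge0//.
rewrite sqr_sqrtr ?(ltW phi0)// L2norm_sqr// dr.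
rewrite ipBl//; last exact: sqintB.
rewrite (ipC phi) (ipC (re S)) !ipBl// oS (ipC phi (re S)) oS.
by have := ip_ge0 (im d); have := ip_ge0 (re S); lra.
Qed.

End Dual.

(** * Density arguments *)

Section Bernstein.
Context {R : realType}.
Implicit Types (F G : nat -> R) (g : R -> R) (z c e : R) (n k : nat).

(* Expectation of F under the binomial law of parameters n and z. *)
Fixpoint bern n F z : R :=
  if n is m.+1 then (1 - z) * bern m F z + z * bern m (fun k => F k.+1) z else F 0.

Lemma bern_lin n F G c d z :
  bern n (fun k => c * F k + d * G k) z = c * bern n F z + d * bern n G z.
Proof. by elim: n F G => [//|n IH] F G /=; rewrite !IH; ring. Qed.

Lemma bern_cst n c z : bern n (fun=> c) z = c.
Proof. by elim: n => [//|n IH] /=; rewrite !IH; ring. Qed.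

Lemma bern_le n F G z : 0 <= z -> z <= 1 -> (forall k, F k <= G k) ->
  bern n F z <= bern n G z.
Proof.
move=> z0 z1; elim: n F G => [|n IH] F G FG /=; first exact: FG.
by apply: lerD; apply: ler_wpM2l; rewrite ?subr_ge0//; exact: IH.
Qed.

Lemma bern_abs_le n F z c : 0 <= z -> z <= 1 -> (forall k, `|F k| <= c) ->
  `|bern n F z| <= c.
Proof.
move=> z0 z1 Fc; rewrite ler_norml -{1}(bern_cst n (- c) z) -{2}(bern_cst n c z).
by apply/andP; split; apply: bern_le => // k; have := Fc k; rewrite ler_norml => /andP[].
Qed.

(** The centre [c] is left free because the induction shifts it by one; c = n z gives the binomial
    variance. *)
Lemma bern_variance n z c :
  bern n (fun k => (k%:R - c) ^+ 2) z = n%:R * (z * (1 - z)) + (n%:R * z - c) ^+ 2.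
Proof.
elim: n c => [|n IH] c /=; first by ring.
rewrite IH; have -> : (fun k => (k.+1%:R - c) ^+ 2) = (fun k => (k%:R - (c - 1)) ^+ 2).
  by apply/funext => k; rewrite -natr1; congr (_ ^+ 2); ring.
by rewrite IH -natr1; ring.
Qed.

Lemma bern_at0 n F : bern n F 0 = F 0.
Proof. by elim: n F => [//|n IH] F /=; rewrite IH subr0 mul1r mul0r addr0. Qed.

Lemma bern_at1 n F : bern n F 1 = F n.
Proof. by elim: n F => [//|n IH] F /=; rewrite !IH subrr mul0r add0r mul1r. Qed.

(** Chebyshev's argument: |g y - g z| <= e / 2 + K (y - z) ^ 2, by continuity near z and by
    boundedness elsewhere, and the mean of the quadratic term is the variance over n ^ 2. Continuity
    is assumed at z alone, because [g] will involve [acos]. *)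
Lemma bern_cvg g z c : 0 <= z -> z <= 1 -> (forall x, `|g x| <= c) ->
  {for z, continuous g} ->
  bern n (fun k => g (k%:R / n%:R)) z @[n --> \oo] --> g z.
Proof.
move=> z0 z1 gc cg; apply/cvgrPdist_lt => e e0.
have c0 : 0 <= c by exact: le_trans (gc 0).
have e2 : 0 < e / 2 by rewrite divr_gt0.
have /cvgrPdist_lt/(_ _ e2)/nbhs_ballP[d/= d0 Hd] := cg.
pose K := 2 * c / d ^+ 2.
have K0 : 0 <= K by rewrite /K divr_ge0 ?sqr_ge0// mulr_ge0.
have gK y : `|g y - g z| <= e / 2 + K * (y - z) ^+ 2.
  have [yz|yz] := ltrP `|y - z| d.
    have : `|g z - g y| < e / 2 by apply: Hd; rewrite /ball/= distrC.
    rewrite distrC => /ltW/le_trans; apply.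
    by rewrite lerDl mulr_ge0// sqr_ge0.
  have h : `|g y - g z| <= 2 * c.
    by apply: (le_trans (ler_normB _ _)); have := gc y; have := gc z; lra.
  apply: (le_trans h); rewrite -[leLHS]add0r; apply: lerD; first exact: ltW.
  rewrite /K mulrAC ler_pdivlMr ?exprn_gt0//; apply: ler_wpM2l; first exact: mulr_ge0.
  rewrite -[leRHS]real_normK ?num_real//; apply: lerXn2r => //; rewrite nnegrE//.
  exact: ltW.
near=> n.
have n0 : 0 < n%:R :> R by rewrite ltr0n; near: n; exact: nbhs_infty_gt.
have nK : K / n%:R < e / 2.
  rewrite ltr_pdivrMr// mulrC -ltr_pdivrMr//; near: n.
  exact: nbhs_infty_gtr.
have VB : bern n (fun k => e / 2 * 1 + K * (k%:R / n%:R - z) ^+ 2) z < e.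
  rewrite (bern_lin n (fun=> 1) (fun k => (k%:R / n%:R - z) ^+ 2)) bern_cst.
  have -> : (fun k : nat => (k%:R / n%:R - z) ^+ 2) =
      (fun k : nat => n%:R ^- 2 * (k%:R - n%:R * z) ^+ 2 + 0 * 0).
    apply/funext => k; rewrite mul0r addr0 -exprVn -exprMn; congr (_ ^+ 2).
    by rewrite mulrBr mulKf ?gt_eqF// mulrC.
  rewrite (bern_lin n (fun k => (k%:R - n%:R * z) ^+ 2) (fun=> 0)).
  rewrite bern_variance subrr expr0n addr0 mul0r addr0 mulr1 expr2.
  have -> : K * ((n%:R * n%:R)^-1 * (n%:R * (z * (1 - z)))) = K / n%:R * (z * (1 - z)).
    by field; rewrite gt_eqF.
  have zz : z * (1 - z) <= 1 by nra.
  have := ler_wpM2l (divr_ge0 K0 (ltW n0)) zz; rewrite mulr1; lra.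
rewrite -[X in `|X - _|](bern_cst n (g z) z).
apply: le_lt_trans VB.
have E : bern n (fun=> g z) z - bern n (fun k => g (k%:R / n%:R)) z =
   bern n (fun k => 1 * g z + -1 * g (k%:R / n%:R)) z.
  by rewrite (bern_lin n (fun=> g z)) mul1r mulN1r.
have E' : - (bern n (fun=> g z) z - bern n (fun k => g (k%:R / n%:R)) z) =
   bern n (fun k => -1 * g z + 1 * g (k%:R / n%:R)) z.
  by rewrite (bern_lin n (fun=> g z)) mul1r mulN1r opprB addrC.
rewrite ler_norml; apply/andP; split; [rewrite lerNl E'|rewrite E];
  by apply: bern_le => // k; have := gK (k%:R / n%:R); rewrite ler_norml => /andP[]; lra.
Unshelve. all: by end_near. Qed.

End Bernstein.

(** * Closed subspaces and functions of an angle *)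

Section ClosedSubspace.
Context {R : realType}.
Implicit Types (f g u th : R -> R) (x c e r : R) (n j : nat).
Local Notation mu := (@lebesgue_measure R).
Local Notation mfun f := (@measurable_fun _ _ (measurableTypeR R) (measurableTypeR R) Omega f).

Record closed_subspace (M : set (R -> R)) : Prop := ClosedSubspace {
  closed0 : M (fun=> 0);
  closed_sqint : forall f, M f -> sqint f;
  closed_lin : forall c f g, M f -> M g -> M (fun x => c * f x + g x);
  closed_lim : forall f, sqint f -> (forall e, 0 < e ->
    exists2 g, M g & ip (fun x => f x - g x) (fun x => f x - g x) < e) -> M f }.

Context (M : set (R -> R)) (cM : closed_subspace M).

Lemma closed_eq f g : M f -> (forall x, Omega x -> f x = g x) -> M g.
Proof.
move=> Mf fg; have sf := closed_sqint cM Mf.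
have mg : mfun g.
  by apply: (eq_measurable_fun f) sf.1 => x /set_mem/fg.
have sg : sqint g.
  split=> //; apply: (eq_integrable _ _ _ _ sf.2) => // x /set_mem/fg fgx.
  by rewrite /= fgx.
apply: (closed_lim cM) => // e e0; exists f => //.
rewrite (_ : ip _ _ = 0)//; rewrite /ip (_ : Rintegral _ _ _ = \int[mu]_(x in Omega) (0 : R)).
  by rewrite Rintegral_cst// mul0r.
by apply: eq_Rintegral => x /set_mem/fg ->; rewrite subrr mul0r.
Qed.

Lemma closedZ c f : M f -> M (fun x => c * f x).
Proof.
by move=> Mf; apply: closed_eq (closed_lin cM c Mf (closed0 cM)) _ => x _; rewrite addr0.
Qed.

Lemma closedD f g : M f -> M g -> M (fun x => f x + g x).
Proof.
by move=> Mf Mg; apply: closed_eq (closed_lin cM 1 Mf Mg) _ => x _; rewrite mul1r.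
Qed.

Lemma closedB f g : M f -> M g -> M (fun x => f x - g x).
Proof.
move=> Mf Mg; apply: closed_eq (closedD Mf (closedZ (-1) Mg)) _ => x _.
by rewrite mulN1r.
Qed.

Lemma closed_dominated (w : nat -> R -> R) f g : (forall n, M (w n)) -> sqint g ->
  (forall n x, Omega x -> `|w n x| <= g x) ->
  (forall x, Omega x -> w n x @[n --> \oo] --> f x) -> M f.
Proof.
move=> Mw [mg gi] wg wf.
have mw n : mfun (w n) by have [] := closed_sqint cM (Mw n).
have mf : mfun f by exact: (measurable_fun_cvg mw).
have fg x : Omega x -> `|f x| <= g x.
  move=> Ox; have cabs : `|w n x| @[n --> \oo] --> `|f x| by apply: cvg_norm; exact: wf.
  by apply: (cvgr_to_le cabs); apply: nearW => n; exact: wg.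
have sf : sqint f.
  split=> //; apply: (@le_integrable _ _ _ mu _ measurable_Omega _ (EFin \o (fun x => g x ^+ 2))) => //.
    by apply/measurable_EFinP; exact: measurable_funX.
  move=> x Ox /=; rewrite lee_fin !normrX; apply: lerXn2r; rewrite ?nnegrE//.
  by rewrite (le_trans (fg x Ox))// ler_norm.
apply: (closed_lim cM) => // e e0.
have : \int[mu]_(x in Omega) ((f x - w n x) * (f x - w n x)) @[n --> \oo]
    --> \int[mu]_(x in Omega) (0 : R).
  apply: (@Rintegral_cvg R _ _ (fun x => 4 * g x ^+ 2)).
  - move=> n; have mfw : mfun (fun x => f x - w n x) by exact: (measurable_funB mf (mw n)).
    exact: (measurable_funM mfw mfw).
  - move=> n x Ox; have h1 := fg x Ox; have h2 := wg n x Ox.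
    rewrite -expr2 normrX; apply: (@le_trans _ _ ((2 * g x) ^+ 2)); last by rewrite exprMn -natrX.
    apply: lerXn2r; rewrite ?nnegrE//.
      by rewrite mulr_ge0// (le_trans _ h1).
    by apply: (le_trans (ler_normB _ _)); lra.
  - exact: integrableZR.
  - move=> x Ox; have c1 : f x - w n x @[n --> \oo] --> 0.
      by rewrite -(subrr (f x)); apply: cvgB; [exact: cvg_cst|exact: wf].
    by rewrite -[X in _ --> X](mulr0 0); exact: cvgM.
rewrite Rintegral_cst// mul0r => /cvgrPdist_lt/(_ e e0) [n _ Hn].
exists (w n) => //; have := Hn n (leqnn n); rewrite /= sub0r normrN.
exact/le_lt_trans/ler_norm.
Qed.

(* Multiplication by [(1 - cos th) / 2] preserves this property, so Bernstein
   polynomials in it, hence continuous functions of [acos (cos th) = |th|], may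
   multiply [u]. *)
Definition cos_stable th u : Prop := forall j, M (fun x => u x * cos (j%:R * th x)).

Lemma cos_stable_step th u : cos_stable th u ->
  cos_stable th (fun x => u x * ((1 - cos (th x)) / 2)).
Proof.
move=> H j.
case: j => [|j].
  apply: closed_eq (closedB (closedZ (1 / 2) (H 0)) (closedZ (1 / 2) (H 1))) _ => x _.
  have -> : 0%:R * th x = 0 by rewrite mul0r.
  have -> : 1%:R * th x = th x by rewrite mul1r.
  by rewrite cos0; field.
apply: closed_eq (closedB (closedZ (1 / 2) (H j.+1))
  (closedZ (1 / 4) (closedD (H j.+2) (H j)))) _ => x _.
have -> : j.+2%:R * th x = j.+1%:R * th x + th x by rewrite -[j.+2%:R]natr1; ring.
have -> : j%:R * th x = j.+1%:R * th x - th x by rewrite -[j.+1%:R]natr1; ring.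
by rewrite cosD cosB; field.
Qed.

Lemma cos_stable_bern th n F u : cos_stable th u ->
  M (fun x => u x * bern n F ((1 - cos (th x)) / 2)).
Proof.
elim: n F u => [|n IH] F u H /=.
  by apply: closed_eq (closedZ (F 0) (H 0)) _ => x _; rewrite mul0r cos0; ring.
have H' := cos_stable_step H.
apply: closed_eq (closedD (IH F u H)
  (closedB (IH (fun k => F k.+1) _ H') (IH F _ H'))) _ => x _.
by ring.
Qed.

Lemma cos_closed_bounded th u h c : sqint u -> (forall x, Omega x -> `|th x| <= pi) ->
  cos_stable th u -> continuous h -> (forall r, `|h r| <= c) ->
  M (fun x => u x * h `|th x|).
Proof.
move=> su thpi H ch hc.
have c0 : 0 <= c by exact: le_trans (hc 0).
pose g z := h (acos (1 - 2 * z)).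
pose w n x := u x * bern n (fun k => g (k%:R / n%:R)) ((1 - cos (th x)) / 2).
have zx x : 0 <= (1 - cos (th x)) / 2 <= 1.
  by have := cos_le1 (th x); have := cos_geN1 (th x); lra.
apply: (@closed_dominated w _ (fun x => c * `|u x|)).
- by move=> n; exact: (cos_stable_bern n (fun k => g (k%:R / n%:R)) H).
- apply: sqintZ; split; first exact: measurableT_comp su.1.
  rewrite (_ : (fun x => _) = fun x => u x ^+ 2); first exact: su.2.
  by apply/funext => x; rewrite real_normK ?num_real.
- move=> n x Ox; rewrite /w normrM mulrC; apply: ler_wpM2r => //.
  by have /andP[z0 z1] := zx x; apply: bern_abs_le => // k; exact: hc.
- move=> x Ox; apply: cvgM; first exact: cvg_cst.
  have gz : g ((1 - cos (th x)) / 2) = h `|th x|.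
    rewrite /g; congr h.
    have -> : 1 - 2 * ((1 - cos (th x)) / 2) = cos `|th x|.
      by case: (ger0P (th x)) => _; rewrite ?cosN; field.
    by rewrite cosK// in_itv/= normr_ge0 thpi.
  rewrite -gz; have /andP[z0 z1] := zx x.
  move: z0 z1; set z := (1 - cos (th x)) / 2 => z0 z1.
  (* Continuity of [acos] is used inside ]-1, 1[ only; at z = 0 and z = 1 the Bernstein polynomials
     take the value of [g] exactly. *)
  have [ze|zn0] := eqVneq z 0.
    rewrite ze; under eq_fun do rewrite bern_at0 mul0r.
    exact: cvg_cst.
  have [ze|zn1] := eqVneq z 1.
    rewrite ze; apply: (@cvg_trans _ (g 1 @[_ --> \oo])); last exact: cvg_cst.
    apply: near_eq_cvg; near=> n; rewrite bern_at1 divff// pnatr_eq0 -lt0n.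
    by near: n; exact: nbhs_infty_gt.
  apply: (@bern_cvg R g z c) => // [t|]; first exact: hc.
  have z0' : 0 < z by rewrite lt_neqAle eq_sym zn0.
  have z1' : z < 1 by rewrite lt_neqAle zn1.
  have c1 : {for z, continuous (fun t : R => 1 - 2 * t)}.
    by apply: cvgB; [exact: cvg_cst|apply: cvgM; [exact: cvg_cst|exact: cvg_id]].
  have c2 : {for 1 - 2 * z, continuous (@acos R)}.
    by apply: continuous_acos; apply/andP; split; lra.
  have c3 : {for z, continuous (fun t : R => acos (1 - 2 * t))}.
    exact: (continuous_comp c1 c2).
  exact: (continuous_comp c3 (ch (acos (1 - 2 * z)))).
Unshelve. all: by end_near. Qed.

(** Products sin th cos (j th) are differences of sines, so u sin th falls under the cosine case.
    The bound on th is strict so that sin |th| vanishes only where th does. *)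
Lemma sin_closed_bounded th u h c : sqint u -> (forall x, Omega x -> `|th x| < pi) ->
  mfun th -> (forall j, M (fun x => u x * sin (j%:R * th x))) ->
  continuous h -> (forall r, `|h r| <= c) ->
  M (fun x => u x * (Num.sg (th x) * h `|th x|)).
Proof.
move=> su thpi mth H ch hc.
have c0 : 0 <= c by exact: le_trans (hc 0).
have H' : cos_stable th (fun x => u x * sin (th x)).
  case=> [|j].
    by apply: closed_eq (H 1) _ => x _; rewrite mul1r mul0r cos0 mulr1.
  apply: closed_eq (closedZ (1 / 2) (closedB (H j.+2) (H j))) _ => x _.
  have -> : j.+2%:R * th x = j.+1%:R * th x + th x by rewrite -[j.+2%:R]natr1; ring.
  have -> : j%:R * th x = j.+1%:R * th x - th x by rewrite -[j.+1%:R]natr1; ring.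
  by rewrite sinD sinB; field.
have sus : sqint (fun x => u x * sin (th x)).
  by apply: (closed_sqint cM); apply: closed_eq (H 1) _ => x _; rewrite mul1r.
(* [h |th| sgn th = sin th * (h |th| / sin |th|)], with the quotient regularised
   near the zeros of [sin]. *)
pose d n r := Num.max `|sin r| n.+1%:R^-1.
have d0 n r : 0 < d n r by rewrite lt_max invr_gt0 ltr0n orbT.
pose k n r := h r / d n r.
have ck n : continuous (k n).
  move=> r; apply: cvgM; first exact: ch.
  apply: cvgV; first by rewrite gt_eqF.
  have cd : continuous (d n).
    apply: (@continuous_maxr _ (fun r => `|sin r|) (fun=> n.+1%:R^-1)).
      by move=> y; apply: cvg_norm; exact: continuous_sin.
    exact: cst_continuous.
  exact: cd.
have kc n r : `|k n r| <= c * n.+1%:R.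
  have dn : (d n r)^-1 <= n.+1%:R.
    by rewrite invf_ple ?posrE ?ltr0n// le_max lexx orbT.
  rewrite /k normrM normfV (gtr0_norm (d0 n r)); apply: ler_pM (hc r) dn => //.
  by rewrite invr_ge0 ltW.
pose w n x := u x * sin (th x) * k n `|th x|.
apply: (@closed_dominated w _ (fun x => c * `|u x|)).
- move=> n; apply: (@cos_closed_bounded th (fun x => u x * sin (th x)) (k n) _ sus _ H' (ck n) (kc n)).
  by move=> x Ox; apply: ltW; exact: thpi.
- apply: sqintZ; split; first exact: measurableT_comp su.1.
  rewrite (_ : (fun x => _) = fun x => u x ^+ 2); first exact: su.2.
  by apply/funext => x; rewrite real_normK ?num_real.
- move=> n x Ox; rewrite /w /k -mulrA normrM mulrC; apply: ler_wpM2r => //.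
  rewrite mulrCA normrM -[leRHS]mulr1; apply: ler_pM (hc _) _ => //.
  rewrite normrM normfV (gtr0_norm (d0 _ _)) ler_pdivrMr// mul1r /d.
  rewrite le_max; apply/orP; left.
  by case: (ger0P (th x)) => // _; rewrite sinN normrN.
- move=> x Ox; have := thpi x Ox.
  rewrite /w; have [-> _|th0 thx] := eqVneq (th x) 0.
    rewrite sgr0 mul0r mulr0; under eq_fun do rewrite sin0 mulr0 mul0r.
    exact: cvg_cst.
  have sp : 0 < sin `|th x| by rewrite sin_gt0_pi// normr_gt0 th0.
  apply: (@cvg_trans _ (u x * (Num.sg (th x) * h `|th x|) @[_ --> \oo])); last exact: cvg_cst.
  apply: near_eq_cvg; near=> n.
  rewrite /k; have -> : d n `|th x| = sin `|th x|.
    rewrite /d (gtr0_norm sp) max_l// invf_ple ?posrE ?ltr0n//.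
    apply: ltW; near: n; have : \forall n \near \oo, (sin `|th x|)^-1 < n%:R.
      exact: nbhs_infty_gtr.
    by apply: filterS => n /lt_trans; apply; rewrite ltr_nat.
  rewrite -mulrA; congr (_ * _).
  have -> : sin (th x) = Num.sg (th x) * sin `|th x|.
    by have [t0|t0|t0] := sgrP (th x);
      rewrite ?t0 ?sin0 ?mul0r ?mul1r ?mulN1r ?sinN ?opprK.
  by rewrite -mulrA; congr (_ * _); rewrite mulrCA divff ?mulr1// gt_eqF.
Unshelve. all: by end_near. Qed.

End ClosedSubspace.

(** * From two cosine systems to all square-integrable functions *)

Section Density.
Context {R : realType}.
Implicit Types (f g u th F : R -> R) (x c e r : R) (n j : nat).
Local Notation mu := (@lebesgue_measure R).
Local Notation halfpi := (pi / 2 : R).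
Local Notation mfun f := (@measurable_fun _ _ (measurableTypeR R) (measurableTypeR R) Omega f).
Context (M : set (R -> R)) (cM : closed_subspace M).

Lemma abs_halfpi x : Omega x -> `|x| < halfpi.
Proof. by rewrite /Omega/= in_itv/= ltr_norml. Qed.

Lemma cos_norm x k : cos (k * `|x|) = cos (k * x) :> R.
Proof. by case: (ger0P x) => // _; rewrite mulrN cosN. Qed.

(* [cutoff d n] increases to the indicator of ]-oo, d[. *)
Definition cutoff d n r : R := Num.max 0 (Num.min 1 (n%:R * (d - r))).

Lemma continuous_cutoff d n : continuous (cutoff d n).
Proof.
apply: (@continuous_maxr _ (fun=> 0) (fun r => Num.min 1 (n%:R * (d - r)))).
  exact: cst_continuous.
apply: (@continuous_minr _ (fun=> 1) (fun r => n%:R * (d - r))).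
  exact: cst_continuous.
move=> r; apply: cvgM; first exact: cvg_cst.
by apply: cvgB; [exact: cvg_cst|exact: cvg_id].
Qed.

Lemma cutoff_le1 d n r : `|cutoff d n r| <= 1.
Proof.
rewrite ger0_norm; first by rewrite ge_max ler01 ge_min lexx.
by rewrite le_max lexx.
Qed.

Lemma cutoff_cvg d r : cutoff d n r @[n --> \oo] --> (if r < d then 1 else 0 : R).
Proof.
case: ifPn => rd.
  apply: (@cvg_trans _ ((1 : R) @[_ --> \oo])); last exact: cvg_cst.
  apply: near_eq_cvg; near=> n.
  rewrite /cutoff min_l ?max_r//.
  rewrite -ler_pdivrMr ?subr_gt0// div1r ltW//; near: n.
  exact: nbhs_infty_gtr.
apply: (@cvg_trans _ ((0 : R) @[_ --> \oo])); last exact: cvg_cst.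
apply: near_eq_cvg; near=> n.
rewrite /cutoff max_l// ge_min; apply/orP; right.
by rewrite mulr_ge0_le0// subr_le0 leNgt.
Unshelve. all: by end_near. Qed.

(** The lengths are abstract, ordered by size only, so that both signs of [a] are covered. The
    condition on sines says that no positive multiple of l1 / l2 is an integer. *)
Lemma even_closed (l1 l2 : R) F c : 0 < l2 -> l2 <= l1 -> l1 + l2 = pi ->
  (forall j, (0 < j)%N -> sin (j%:R * (pi * l1 / l2)) != 0) ->
  (forall j, M (fun x => cos (j%:R * (2 * pi / l1 * x)))) ->
  (forall j, M (fun x => cos (j%:R * (2 * pi / l2 * x)))) ->
  continuous F -> (forall r, `|F r| <= c) -> M (fun x => F `|x|).
Proof.
move=> l20 l21 l12 irr M1 M2 cF Fc.
have l10 : 0 < l1 by exact: lt_le_trans l21.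
have p0 : 0 < pi :> R by exact: pi_gt0.
have c0 : 0 <= c by exact: le_trans (Fc 0).
pose s := l1 / 2; pose v x := `| `|x| - s|.
pose k1 := 2 * pi / l1; pose k2 := 2 * pi / l2.
have k10 : 0 < k1 by rewrite divr_gt0// mulr_gt0.
have k20 : 0 < k2 by rewrite divr_gt0// mulr_gt0.
have k1s : k1 * s = pi by rewrite /k1 /s; field; rewrite gt_eqF.
have k2d : k2 * (l2 / 2) = pi by rewrite /k2; field; rewrite gt_eqF.
have xb x : Omega x -> `|x| < s + l2 / 2.
  by move=> /abs_halfpi; rewrite /s; lra.
have s1 : sqint (fun=> 1 : R) by apply: sqint_continuous; exact: cst_continuous.
(* Shifting the angle by k1 s = pi changes cos (j k1 x) only by the sign (-1) ^ j. *)
have Mv h : continuous h -> (exists d, forall r, `|h r| <= d) -> M (fun x => h (v x)).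
  move=> ch [d hd].
  pose th x := k1 * (`|x| - s).
  have thv x : `|th x| / k1 = v x.
    by rewrite /th normrM (gtr0_norm k10) mulrC mulKf// gt_eqF.
  have := @cos_closed_bounded R M cM th (fun=> 1) (fun r => h (r / k1)) d s1.
  have H1 x : Omega x -> `|th x| <= pi.
    move=> Ox; rewrite /th normrM (gtr0_norm k10) -k1s ler_pM2l//.
    by rewrite ler_norml; have := normr_ge0 x; have := xb x Ox; rewrite /s; lra.
  have H2 : cos_stable M th (fun=> 1).
    move=> j; apply: (closed_eq cM (closedZ cM ((-1) ^+ j) (M1 j))) => x _.
    rewrite mul1r -[cos (j%:R * (_ * x))]/(cos (j%:R * (k1 * x))).
    rewrite [j%:R * (k1 * x)]mulrA -cos_norm.
    have -> : j%:R * k1 * `|x| = j%:R * th x + pi *+ j.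
      by rewrite /th -mulr_natr -k1s; ring.
    by rewrite (alternatingn (@cosDpi R)) mulrA -expr2 sqrr_sign mul1r.
  have H3 : continuous (fun r => h (r / k1)).
    move=> r; apply: (continuous_comp (f := fun r => r / k1) (g := h)); last exact: ch.
    by apply: cvgM; [exact: cvg_id|exact: cvg_cst].
  move=> /(_ H1 H2 H3 (fun r => hd _)) H.
  by apply: (closed_eq cM H) => x _; rewrite mul1r thv.
pose u x : R := if v x < l2 / 2 then 1 else 0.
have Mu h : continuous h -> (exists d, forall r, `|h r| <= d) ->
    M (fun x => u x * h (v x)).
  move=> ch [d hd].
  apply: (@closed_dominated R M cM (fun n x => cutoff (l2 / 2) n (v x) * h (v x)) _ (fun=> d)).
  - move=> n; apply: (Mv (fun r => cutoff (l2 / 2) n r * h r)).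
      by move=> r; apply: cvgM; [exact: continuous_cutoff|exact: ch].
    exists d => r; rewrite normrM -[d]mul1r.
    by apply: ler_pM => //; exact: cutoff_le1.
  - by apply: sqint_continuous; exact: cst_continuous.
  - move=> n x _; rewrite normrM -[d]mul1r.
    by apply: ler_pM => //; exact: cutoff_le1.
  - by move=> x _; apply: cvgM; [exact: cutoff_cvg|exact: cvg_cst].
have Mu' h : continuous h -> (exists d, forall r, `|h r| <= d) ->
    M (fun x => (1 - u x) * h (v x)).
  move=> ch bh; apply: (closed_eq cM (closedB cM (Mv h ch bh) (Mu h ch bh))) => x _.
  by rewrite mulrBl mul1r.
have ccos k d : continuous (fun r : R => cos (k * (d - r))).
  move=> r; apply: (continuous_comp (f := fun r => k * (d - r)) (g := @cos R)).
    by apply: cvgM; [exact: cvg_cst|apply: cvgB; [exact: cvg_cst|exact: cvg_id]].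
  exact: continuous_cos.
have bcos k d : exists e, forall r : R, `|cos (k * (d - r))| <= e.
  by exists 1 => r; rewrite ler_norml cos_geN1 cos_le1.
(* Since s + l2 / 2 = pi / 2, a point outside the cutoff can only have |x| <= s - l2 / 2; there
   [v x] determines |x|. *)
have vout x : Omega x -> u x = 0 -> s - v x = `|x|.
  move=> Ox; rewrite /u; case: ifPn => [_ /eqP|]; first by rewrite oner_eq0.
  rewrite -leNgt /v => + _; have := xb x Ox.
  by case: (ger0P (`|x| - s)) => ?; lra.
have u01 x : u x = 1 \/ u x = 0 by rewrite /u; case: ifP; [left|right].
(* From the second cosine family remove its part outside the cutoff, which is a function of [v]. *)
have Mucos j : M (fun x => u x * cos (j%:R * (k2 * `|x|))).
  apply: (closed_eq cM (closedB cM (M2 j)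
    (Mu' (fun r => cos (j%:R * k2 * (s - r))) (ccos _ _) (bcos _ _)))) => x Ox.
  have E : cos (j%:R * (k2 * `|x|)) = cos (j%:R * (k2 * x)) by rewrite !mulrA cos_norm.
  rewrite -/k2 E; have [->|u0] := u01 x; first by rewrite subrr mul0r subr0 mul1r.
  have E2 : cos (j%:R * k2 * (s - v x)) = cos (j%:R * (k2 * x)).
    by rewrite vout// cos_norm mulrA.
  by rewrite E2 u0 subr0 mul1r mul0r subrr.
pose th x := u x * (k2 * (`|x| - s)).
have thv x : u x = 1 -> `|th x| = k2 * v x.
  by rewrite /th => ->; rewrite mul1r normrM gtr0_norm.
have thpi x : Omega x -> `|th x| < pi.
  move=> Ox; have [u1|u0] := u01 x.
    rewrite thv// -k2d ltr_pM2l//; move: u1; rewrite /u.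
    by case: ifP => // _ /eqP; rewrite eq_sym oner_eq0.
  by rewrite /th u0 mul0r normr0.
have su : sqint u.
  have h1 : continuous (fun _ : R => 1 : R) by exact: cst_continuous.
  have b1 : exists d, forall r : R, `|(fun _ : R => 1 : R) r| <= d by exists 1 => r; rewrite normr1.
  apply: (closed_sqint cM); apply: (closed_eq cM (Mu (fun=> 1) h1 b1)) => x _.
  by rewrite mulr1.
have cabs : continuous (fun x : R => k2 * (`|x| - s)).
  move=> x; apply: cvgM; first exact: cvg_cst.
  by apply: cvgB; [apply: cvg_norm; exact: cvg_id|exact: cvg_cst].
have mth : mfun th by exact: (measurable_funM su.1 (sqint_continuous cabs).1).
(* In the addition formula for cos (m th + m k2 s) the cosine of m th is a function of [v], and the
   coefficient sin (m k2 s) of the sine is nonzero by hypothesis. *)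
have Msin j : M (fun x => u x * sin (j%:R * th x)).
  case: j => [|j].
    apply: (closed_eq cM (closed0 cM)) => x _; by rewrite mul0r sin0 mulr0.
  set m := j.+1%:R : R.
  have nz : sin (m * (k2 * s)) != 0.
    have -> : k2 * s = pi * l1 / l2 by rewrite /k2 /s; field; rewrite gt_eqF.
    exact: irr.
  apply: (closed_eq cM (closedZ cM (- (sin (m * (k2 * s)))^-1) (closedB cM (Mucos j.+1)
    (closedZ cM (cos (m * (k2 * s)))
    (Mu (fun r => cos (m * k2 * (0 - r))) (ccos _ _) (bcos _ _)))))) => x Ox.
  rewrite -/m; have [u1|u0] := u01 x; last by rewrite u0; ring.
  rewrite /th u1 !mul1r.
  have -> : cos (m * k2 * (0 - v x)) = cos (m * (k2 * (`|x| - s))).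
    rewrite sub0r mulrN cosN /v cos_norm; congr cos; ring.
  have -> : m * (k2 * `|x|) = m * (k2 * (`|x| - s)) + m * (k2 * s) by ring.
  by rewrite cosD; field.
have bF (q : R -> R) : exists d, forall r, `|F (q r)| <= d by exists c.
(* Even and odd parts of [F] about s; the odd one is a function of the angle [th], hence the
   division by [k2]. *)
pose h1 r := (F (s + r) + F (s - r)) / 2.
pose h2 r := (F (s + r / k2) - F (s - r / k2)) / 2.
have cF1 k : continuous (fun r => F (s + r * k)).
  move=> r; apply: (continuous_comp (f := fun r => s + r * k) (g := F)); last exact: cF.
  by apply: cvgD; [exact: cvg_cst|apply: cvgM; [exact: cvg_id|exact: cvg_cst]].
have cF2 k : continuous (fun r => F (s - r * k)).
  move=> r; apply: (continuous_comp (f := fun r => s - r * k) (g := F)); last exact: cF.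
  by apply: cvgB; [exact: cvg_cst|apply: cvgM; [exact: cvg_id|exact: cvg_cst]].
have ch1 : continuous h1.
  rewrite (_ : h1 = fun r => (F (s + r * 1) + F (s - r * 1)) / 2); last first.
    by apply/funext => r; rewrite mulr1.
  move=> r; apply: cvgM; last exact: cvg_cst.
  by apply: cvgD; [exact: (cF1 1)|exact: (cF2 1)].
have ch2 : continuous h2.
  move=> r; apply: cvgM; last exact: cvg_cst.
  by apply: cvgB; [exact: (cF1 k2^-1)|exact: (cF2 k2^-1)].
have half_le (a b : R) : `|a| <= c -> `|b| <= c -> `|(a + b) / 2| <= c /\ `|(a - b) / 2| <= c.
  by rewrite !ler_norml => /andP[? ?] /andP[? ?]; split; lra.
have b1 r : `|h1 r| <= c by have [] := half_le _ _ (Fc (s + r)) (Fc (s - r)).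
have b2 r : `|h2 r| <= c by have [] := half_le _ _ (Fc (s + r / k2)) (Fc (s - r / k2)).
have c3 : continuous (fun r => F (s - r)).
  rewrite (_ : (fun r => _) = fun r => F (s - r * 1)); first exact: cF2.
  by apply/funext => r; rewrite mulr1.
have S := sin_closed_bounded cM su thpi mth Msin ch2 b2.
apply: (closed_eq cM (closedD cM (Mu' (fun r => F (s - r)) c3 (bF _))
  (closedD cM (Mu h1 ch1 (ex_intro _ c b1)) S))) => x Ox.
have [u1|u0] := u01 x; last by rewrite u0 subr0 !mul0r !addr0 mul1r vout.
rewrite u1 subrr mul0r add0r !mul1r thv// /h2 [k2 * v x]mulrC mulfK ?gt_eqF//.
rewrite /th u1 mul1r sgrM (gtr0_sg k20) mul1r /h1 /v.
have E : F `|x| = F (s + (`|x| - s)) by congr F; ring.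
rewrite E; move: (`|x| - s) => w; have [t0|t0|t0] := sgrP w.
- by rewrite t0 ?normr0 mul0r !addr0 subr0; field.
- by rewrite ?gtr0_norm// mul1r; field.
- by rewrite ?ltr0_norm// mulN1r opprK; field.
Qed.

(** The even part of [F] is given. The odd part is sgn x times a function of |2 x|, and the angle 2
    x stays within ]- pi, pi[ on the interval. *)
Lemma full_closed : (forall F c, continuous F -> (forall r, `|F r| <= c) ->
    M (fun x => F `|x|)) ->
  (forall j, M (fun x => sin (j%:R * (2 * x)))) ->
  forall F c, continuous F -> (forall r, `|F r| <= c) -> M F.
Proof.
move=> Meven Msin F c cF Fc.
have c0 : 0 <= c by exact: le_trans (Fc 0).
have s1 : sqint (fun=> 1 : R) by apply: sqint_continuous; exact: cst_continuous.
have thpi x : Omega x -> `|2 * x| < pi.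
  by move=> /abs_halfpi xb; rewrite normrM (ger0_norm (ler0n R 2)); lra.
have cth : continuous (fun x : R => 2 * x).
  by move=> x; apply: cvgM; [exact: cvg_cst|exact: cvg_id].
have half_le (a b : R) : `|a| <= c -> `|b| <= c -> `|(a + b) / 2| <= c /\ `|(a - b) / 2| <= c.
  by rewrite !ler_norml => /andP[? ?] /andP[? ?]; split; lra.
have cF1 k : continuous (fun r => F (r * k)).
  move=> r; apply: (continuous_comp (f := fun r => r * k) (g := F)); last exact: cF.
  by apply: cvgM; [exact: cvg_id|exact: cvg_cst].
pose h1 r := (F (r * 1) + F (r * -1)) / 2.
pose h2 r := (F (r * 2^-1) - F (r * - 2^-1)) / 2.
have ch1 : continuous h1.
  by move=> r; apply: cvgM; [apply: cvgD; exact: cF1|exact: cvg_cst].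
have ch2 : continuous h2.
  by move=> r; apply: cvgM; [apply: cvgB; exact: cF1|exact: cvg_cst].
have b1 r : `|h1 r| <= c by have [] := half_le _ _ (Fc (r * 1)) (Fc (r * -1)).
have b2 r : `|h2 r| <= c by have [] := half_le _ _ (Fc (r * 2^-1)) (Fc (r * - 2^-1)).
have Ms j : M (fun x => 1 * sin (j%:R * (2 * x))).
  by apply: (closed_eq cM (Msin j)) => x _; rewrite mul1r.
have S := sin_closed_bounded cM s1 thpi (sqint_continuous cth).1 Ms ch2 b2.
apply: (closed_eq cM (closedD cM (Meven h1 c ch1 b1) S)) => x Ox.
rewrite /h1 /h2 mul1r normrM (ger0_norm (ler0n R 2)) sgrM (gtr0_sg (ltr0Sn R 1)) mul1r.
rewrite !mulrN1 !mulrN mulr1 mulrAC divff ?mul1r ?pnatr_eq0//.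
have [t0|t0|t0] := sgrP x.
- by rewrite t0 ?normr0 oppr0; field.
- by rewrite ?gtr0_norm// mul1r; field.
- by rewrite ?ltr0_norm// opprK mulN1r; field.
Qed.

(** For f bounded by c, approximate in L^1 by continuous functions and clamp them to [- c, c]:
    clamping does not increase the error, and the squared L^2 error is at most 2 c times the L^1
    error. Unbounded f are truncated and reached by dominated convergence. *)
Lemma dense_closed : (forall F c, continuous F -> (forall r, `|F r| <= c) -> M F) ->
  forall f, sqint f -> M f.
Proof.
move=> Mc; have Mb f c : mfun f -> (forall x, Omega x -> `|f x| <= c) -> M f.
  move=> mf fc; have sf := sqint_bounded mf fc.
  have c0 : 0 <= c.
    by apply: (le_trans (normr_ge0 (f 0))); apply: fc; rewrite /Omega/= in_itv/=;
      have := halfpi_gt0 (R := R); move=> ?; apply/andP; split; lra.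
  apply: (closed_lim cM) => // e e0.
  have fi := integrable_bounded mf fc.
  have [g [cg gi gf]] := approximation_continuous_integrable measurable_Omega
    (finite_Omega (R := R)) fi.
  have e1 : 0 < e / (2 * c + 1) by rewrite divr_gt0// ltr_wpDl// mulr_ge0.
  have /fine_fcvg/cvgrPdist_lt/(_ _ e1) [n _ /(_ n (leqnn n))] := gf.
  rewrite /= sub0r normrN => gn.
  pose g' x := Num.max (- c) (Num.min (g n x) c).
  have cg' : continuous g'.
    apply: (@continuous_maxr _ (fun=> - c) (fun x => Num.min (g n x) c)).
      exact: cst_continuous.
    by apply: (@continuous_minr _ (g n) (fun=> c)) => //; exact: cst_continuous.
  have g'c x : `|g' x| <= c.
    rewrite ler_norml /g' le_max lexx/= ge_max ge_min lexx orbT andbT.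
    by rewrite ge0_cp.
  exists g'; first exact: (Mc g' c).
  have sg' := sqint_continuous cg'.
  have fgi : mu.-integrable (@Omega R) (EFin \o (fun x => `|f x - g n x|)).
    have := integrable_abse (integrableDR fi (integrableZR (-1) (gi n))).
    apply: eq_integrable => // x _ /=.
    by rewrite mulN1r.
  apply: (@le_lt_trans _ _ (\int[mu]_(x in Omega) (2 * c * `|f x - g n x|))).
    apply: (@le_Rintegral _ _ _ mu) => //.
    - by apply: sqint_mul; exact: sqintB.
    - exact: integrableZR.
    - move=> x Ox; rewrite -[leLHS]ger0_norm -?expr2 ?sqr_ge0// normrX expr2.
      have fx := fc x Ox; have gx := g'c x.
      apply: ler_pM => //; first by apply: (le_trans (ler_normB _ _)); lra.
      move: fx; rewrite /g' ler_norml => /andP[fx1 fx2].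
      have [h1|h1] := leP (g n x) c.
        have [h2|h2] := leP (- c) (g n x); first by [].
        by rewrite !ger0_norm; lra.
      rewrite max_r; last by lra.
      by rewrite -[in leLHS]normrN -[in leRHS]normrN !opprB !ger0_norm; lra.
  rewrite RintegralZl//.
  have gn' : \int[mu]_(x in Omega) `|f x - g n x| < e / (2 * c + 1).
    by apply: le_lt_trans gn; exact: ler_norm.
  have I0 : 0 <= \int[mu]_(x in Omega) `|f x - g n x| by apply: (@Rintegral_ge0 _ _ _ mu).
  have c1 : 0 < 2 * c + 1 by rewrite ltr_wpDl// mulr_ge0.
  move: gn'; rewrite ltr_pdivlMr//; apply: le_lt_trans.
  by rewrite mulrC; apply: ler_wpM2l; rewrite ?lerDl.
move=> f sf.
pose w n x := Num.max (- n%:R) (Num.min (f x) n%:R).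
have wle n x : `|w n x| <= n%:R.
  rewrite ler_norml /w le_max lexx/= ge_max ge_min lexx orbT andbT.
  by rewrite ge0_cp.
have mw n : mfun (w n).
  apply: measurable_maxr; first exact: measurable_cst.
  by apply: measurable_minr; [exact: sf.1|exact: measurable_cst].
apply: (@closed_dominated R M cM w f (fun x => `|f x|)).
- by move=> n; apply: (Mb _ n%:R) => // x _; exact: wle.
- split; first exact: measurableT_comp sf.1.
  rewrite (_ : (fun x => _) = fun x => f x ^+ 2); first exact: sf.2.
  by apply/funext => x; rewrite real_normK ?num_real.
- move=> n x _; rewrite /w.
  have n0 : 0 <= n%:R :> R by [].
  have [h1|h1] := leP (f x) n%:R; last by rewrite max_r ?ger0_norm; lra.
  have [h2|h2] := leP (- n%:R) (f x); first by [].
  by rewrite normrN ger0_norm// ler0_norm; lra.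
- move=> x _; apply: (@cvg_trans _ (f x @[_ --> \oo])); last exact: cvg_cst.
  apply: near_eq_cvg; near=> n.
  have : `|f x| < n%:R by near: n; exact: nbhs_infty_gtr.
  by rewrite /w ltr_norml => /andP[h1 h2]; rewrite min_l ?max_r// ltW.
Unshelve. all: by end_near. Qed.

End Density.

(** * Approximation by finite linear combinations of the family *)

Section Approximation.
Context {R : realType}.
Implicit Types (f u : R -> R[i]) (g h : R -> R) (e : R) (z : R[i]) (J : pred nat)
  (alpha beta : nat -> R[i]).
Local Notation mu := (@lebesgue_measure R).
Local Notation re f := (fun x => complex.Re (f x)).
Local Notation im f := (fun x => complex.Im (f x)).

Lemma L2B f u : L2 f -> L2 u -> L2 (fun x => f x - u x).
Proof.
move=> Lf /(L2Z (-1))/(L2D Lf); congr L2.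
by apply/funext => x; rewrite mulN1r.
Qed.

Lemma L2norm_sqrD f u : L2 f -> L2 u ->
  L2norm (fun x => f x + u x) ^+ 2 <= 2 * L2norm f ^+ 2 + 2 * L2norm u ^+ 2.
Proof.
move=> Lf Lu; rewrite !L2norm_sqr//; last exact: L2D.
have [[fr fi] [ur ui]] := (iffLR (L2P _) Lf, iffLR (L2P _) Lu).
have -> : re (fun x => f x + u x) = fun x => complex.Re (f x) + complex.Re (u x).
  by apply/funext => x; case: (f x) (u x) => ? ? [].
have -> : im (fun x => f x + u x) = fun x => complex.Im (f x) + complex.Im (u x).
  by apply/funext => x; case: (f x) (u x) => ? ? [].
have := ipDD_le fr ur; have := ipDD_le fi ui; lra.
Qed.

Lemma L2norm_sqrZ z f : L2 f ->
  L2norm (fun x => z * f x) ^+ 2 =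
  (complex.Re z ^+ 2 + complex.Im z ^+ 2) * L2norm f ^+ 2.
Proof.
move=> Lf; have [sr si] := (L2P _).1 Lf.
have sqr_norm (h : R -> R[i]) : L2norm h ^+ 2 = \int[mu]_(x in Omega)
    (complex.Re (h x) ^+ 2 + complex.Im (h x) ^+ 2).
  rewrite sqr_sqrtr; last first.
    by apply: (@Rintegral_ge0 _ _ _ mu) => x _; rewrite sqr_ge0.
  apply: eq_Rintegral => x _; case: (h x) => p q /=.
  by rewrite sqr_sqrtr ?addr_ge0 ?sqr_ge0.
rewrite !sqr_norm -RintegralZl//; last by apply: integrableDR; [exact: sr.2|exact: si.2].
by apply: eq_Rintegral => x _; case: z (f x) => p q [a b] /=; ring.
Qed.

Lemma L2norm_ae0 f : L2 f -> eq_L2 f (fun=> 0) -> L2norm f = 0.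
Proof.
move=> Lf f0; have [sr si] := (L2P _).1 Lf.
have s0 : sqint (fun=> 0 : R) by apply: sqint_continuous; exact: cst_continuous.
apply/eqP; rewrite -sqrf_eq0 L2norm_sqr//.
have -> : ip (re f) (re f) = ip (fun=> 0) (re f).
  by apply: ip_ae_eq => //; apply: filterS f0 => x H /H ->.
have -> : ip (im f) (im f) = ip (fun=> 0) (im f).
  by apply: ip_ae_eq => //; apply: filterS f0 => x H /H ->.
by rewrite !ip0 addr0.
Qed.

(** Padding with zeros brings combinations of different lengths to a common length, so that they can
    be added. *)
Definition truncate n alpha : nat -> R[i] := fun j => if (j < n)%N then alpha j else 0.

Lemma lincomb_truncate J (psi : nat -> R -> R[i]) n m alpha : (n <= m)%N ->
  lincomb J psi m (truncate n alpha) = lincomb J psi n alpha.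
Proof.
move=> nm; apply/funext => x; rewrite /lincomb.
rewrite [RHS](big_ord_widen_cond m J (fun j => alpha j * psi j x))//.
rewrite [RHS]big_mkcondr; apply: eq_bigr => j _; rewrite /truncate.
by case: ifP => //; rewrite mul0r.
Qed.

Lemma lincombD J (psi : nat -> R -> R[i]) n alpha beta x :
  lincomb J psi n (fun j => alpha j + beta j) x =
  lincomb J psi n alpha x + lincomb J psi n beta x.
Proof. by rewrite /lincomb -big_split; apply: eq_bigr => j _; rewrite mulrDl. Qed.

Lemma lincombZ J (psi : nat -> R -> R[i]) n z alpha x :
  lincomb J psi n (fun j => z * alpha j) x = z * lincomb J psi n alpha x.
Proof. by rewrite /lincomb big_distrr; apply: eq_bigr => j _ /=; rewrite mulrA. Qed.

Context (psi : nat -> R -> R[i]) (Lpsi : forall j, L2 (psi j)).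

Definition approx f : Prop := forall e, 0 < e -> exists n alpha,
  L2norm (fun x => f x - lincomb xpredT psi n alpha x) < e.

Lemma approxP f : L2 f -> approx f <-> forall e, 0 < e -> exists n alpha,
  L2norm (fun x => f x - lincomb xpredT psi n alpha x) ^+ 2 < e.
Proof.
move=> Lf; split=> H e e0.
  have s0 : 0 < Num.sqrt e by rewrite sqrtr_gt0.
  have [n [alpha Hn]] := H _ s0; exists n, alpha.
  rewrite -[X in _ < X]sqr_sqrtr ?ltW//.
  by apply: ltrXn2r; rewrite ?nnegrE ?L2norm_ge0.
have s0 : 0 < e ^+ 2 by rewrite exprn_gt0.
have [n [alpha Hn]] := H _ s0; exists n, alpha.
by rewrite -(ltr_pXn2r (n := 2)) ?nnegrE ?L2norm_ge0 ?ltW.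
Qed.

Lemma approx_linear z f u : L2 f -> L2 u -> approx f -> approx u ->
  approx (fun x => z * f x + u x).
Proof.
move=> Lf Lu /(approxP Lf) af /(approxP Lu) au.
have Lzf := L2Z z Lf; apply/approxP; first exact: L2D.
move=> e e0; pose d := complex.Re z ^+ 2 + complex.Im z ^+ 2 + 1.
have d0 : 0 < d by rewrite ltr_wpDl// addr_ge0 ?sqr_ge0.
have e1 : 0 < e / 4 / d by rewrite !divr_gt0.
have e2 : 0 < e / 4 by rewrite divr_gt0.
have [n [alpha Hn]] := af _ e1; have [m [beta Hm]] := au _ e2.
exists (maxn n m), (fun j => z * truncate n alpha j + truncate m beta j).
set F := fun x => f x - lincomb xpredT psi n alpha x in Hn.
set U := fun x => u x - lincomb xpredT psi m beta x in Hm.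
have LF : L2 F by apply: L2B => //; exact: lincomb_L2.
have LU : L2 U by apply: L2B => //; exact: lincomb_L2.
have -> : (fun x => z * f x + u x - lincomb xpredT psi (maxn n m)
    (fun j => z * truncate n alpha j + truncate m beta j) x) =
    fun x => z * F x + U x.
  apply/funext => x; rewrite lincombD lincombZ !lincomb_truncate ?leq_maxl ?leq_maxr//.
  by rewrite /F /U; ring.
apply: le_lt_trans (L2norm_sqrD (L2Z z LF) LU) _.
rewrite L2norm_sqrZ//.
have h : (complex.Re z ^+ 2 + complex.Im z ^+ 2) * L2norm F ^+ 2 <= e / 4.
  apply: (@le_trans _ _ (d * L2norm F ^+ 2)).
    by apply: ler_wpM2r; rewrite ?sqr_ge0// /d lerDl.
  by rewrite mulrC -ler_pdivlMr// ltW.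
lra.
Qed.

Lemma approx_limit f : L2 f -> (forall e, 0 < e -> exists u,
    [/\ L2 u, approx u & L2norm (fun x => f x - u x) ^+ 2 < e]) -> approx f.
Proof.
move=> Lf H; apply/approxP => // e e0; have e2 : 0 < e / 4 by rewrite divr_gt0.
have [u [Lu /(approxP Lu)/(_ _ e2)[n [alpha Hn]] fu]] := H _ e2.
exists n, alpha; set U := fun x => u x - _ in Hn.
have LU : L2 U by apply: L2B => //; exact: lincomb_L2.
have -> : (fun x => f x - lincomb xpredT psi n alpha x) = fun x => (f x - u x) + U x.
  by apply/funext => x; rewrite /U; ring.
by apply: le_lt_trans (L2norm_sqrD (L2B Lf Lu) LU) _; lra.
Qed.

Lemma approx_lincomb J n alpha f : L2 f -> eq_L2 f (lincomb J psi n alpha) -> approx f.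
Proof.
move=> Lf fE e e0; exists n, (fun j => if J j then alpha j else 0).
have LE : lincomb xpredT psi n (fun j => if J j then alpha j else 0) = lincomb J psi n alpha.
  apply/funext => x; rewrite /lincomb [RHS]big_mkcond; apply: eq_bigr => j _.
  by case: ifP => //; rewrite mul0r.
rewrite LE L2norm_ae0//; first by apply: L2B => //; exact: lincomb_L2.
by apply: filterS fE => x H /H ->; rewrite subrr.
Qed.

Definition approx_real g : Prop := sqint g /\ approx (fun x => (g x)%:C).

Lemma approx_real_closed : closed_subspace approx_real.
Proof.
have s0 : sqint (fun=> 0 : R) by apply: sqint_continuous; exact: cst_continuous.
have a0 : approx (fun=> 0).
  apply: (@approx_lincomb xpredT 0 (fun=> 0)); first exact: L2_0.
  by apply: aeW => x _; rewrite /lincomb big_ord0.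
split=> [|g []//|c g h [sg ag] [sh ah]|g sg H].
- by split.
- split; first by apply: sqintD => //; exact: sqintZ.
  have -> : (fun x => (c * g x + h x)%:C) = fun x => c%:C * (g x)%:C + (h x)%:C.
    by apply/funext => x; rewrite rmorphD rmorphM.
  by apply: approx_linear => //; exact: L2_real.
- split=> //; apply: approx_limit; first exact: L2_real.
  move=> e /H [h [sh ah] gh]; exists (fun x => (h x)%:C); split=> //.
    exact: L2_real.
  have -> : (fun x => (g x)%:C - (h x)%:C) = fun x => (g x - h x)%:C.
    by apply/funext => x; rewrite rmorphB.
  rewrite L2norm_sqr; last by apply: L2_real; exact: sqintB.
  by rewrite [X in _ + X](ip0 (fun=> 0)) addr0.
Qed.

Lemma approx_complete : (forall g, sqint g -> approx_real g) ->
  complete_family xpredT psi.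
Proof.
move=> H f Lf; have [sr si] := (L2P _).1 Lf.
have [_ ar] := H _ sr; have [_ ai] := H _ si.
have := approx_linear 'i%C (L2_real si) (L2_real sr) ai ar.
rewrite (_ : (fun x => _) = f)//; apply/funext => x.
by case: (f x) => p q; apply/eqP; rewrite eq_complex/=; apply/andP; split; apply/eqP; ring.
Qed.

End Approximation.

(** * Irrational parameter: minimality and completeness *)

Section IrrationalSpectrum.
Context {R : realType}.
Implicit Types (f u : R -> R[i]) (a k t x : R) (l z : R[i]) (psi : nat -> R -> R[i])
  (alpha : nat -> R[i]).
Local Notation halfpi := (pi / 2 : R).

Lemma interior_point a : -1 < a -> a < 1 ->
  - halfpi < halfpi * a /\ halfpi * a < halfpi.
Proof. by have := halfpi_gt0 (R := R); split; nra. Qed.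

Lemma sin_natpi n : sin (n%:R * pi) = 0 :> R.
Proof.
by rewrite -[n%:R * pi]add0r mulr_natl (alternatingn (@sinDpi R)) sin0 mulr0.
Qed.

Lemma sin_eq0_nat t : 0 <= t -> sin t = 0 -> exists n : nat, t = n%:R * pi.
Proof.
move=> t0 st; have p0 : 0 < pi :> R by exact: pi_gt0.
pose n := Num.truncn (t / pi); exists n.
have /truncn_itv/andP[n1 n2] : 0 <= t / pi by rewrite divr_ge0// ltW.
pose r := t - n%:R * pi.
have r0 : 0 <= r by rewrite subr_ge0 -ler_pdivlMr.
have r1 : r < pi.
  by rewrite ltrBlDr -[X in X + _]mul1r -mulrDl addrC natr1 -ltr_pdivrMr.
have tE : t = r + pi *+ n by rewrite -[pi *+ n]mulr_natl subrK.
have : sin r = 0.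
  apply/eqP; move: st; rewrite tE (alternatingn (@sinDpi R)) => /eqP.
  by rewrite mulf_eq0 signr_eq0.
apply: contra_eq => rn; rewrite gt_eqF// sin_gt0_pi// r1 andbT.
rewrite lt_neqAle r0 andbT eq_sym; apply: contra_neq rn => r00.
by apply/eqP; rewrite -subr_eq0 -/r r00.
Qed.

(* [sin (phaseL a k) = sin (phaseR a k) = 0] makes (1 + a) / (1 - a) rational. *)
Lemma rational_ratio a (m n : nat) : a < 1 -> (0 < n + m)%N ->
  n%:R * (1 + a) = m%:R * (1 - a) -> rational a.
Proof.
move=> a1 nm E; apply/rationalP; exists ((m%:Z - n%:Z)%R), (n + m)%N.
have nm0 : (n + m)%:R != 0 :> R by rewrite pnatr_eq0 -lt0n.
apply: (mulIf nm0); rewrite divfK// natrD rmorphB/=.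
by move: E; rewrite -!pmulrn; lra.
Qed.

Lemma phase_not_both0 a k : -1 < a -> a < 1 -> irrational a -> 0 < k ->
  sin (phaseL a k) = 0 -> sin (phaseR a k) <> 0.
Proof.
move=> aN1 a1 irr k0 sL sR; have p0 : 0 < pi :> R by exact: pi_gt0.
have h0 := halfpi_gt0 (R := R).
have L0 : 0 < phaseL a k by rewrite /phaseL !(mulr_gt0, divr_gt0)//; lra.
have R0 : 0 < phaseR a k by rewrite /phaseR !(mulr_gt0, divr_gt0)//; lra.
have [m mE] := sin_eq0_nat (ltW L0) sL; have [n nE] := sin_eq0_nat (ltW R0) sR.
apply: irr; apply: (@rational_ratio a m n) => //.
  rewrite addn_gt0; apply/orP; left; rewrite lt0n; apply/eqP => n0.
  by move: R0; rewrite nE n0 mul0r ltxx.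
have kp : k * halfpi != 0 by rewrite mulf_neq0 ?gt_eqF.
apply: (mulfI kp).
have eL : k * halfpi * (1 + a) = 2 * (m%:R * pi) by rewrite -mE /phaseL; field.
have eR : k * halfpi * (1 - a) = 2 * (n%:R * pi) by rewrite -nE /phaseR; field.
rewrite mulrCA eL [RHS]mulrCA eR; ring.
Qed.

(** Up to sign, the determinant of the linear system for (A, B) in [trig_bcP]. *)
Definition dispersion a k : R :=
  sin (phaseL a k) * sin (phaseR a k) * sin (phaseL a k + phaseR a k).

Lemma dispersion_eq0 a k A B : trig_bc a k A B -> (A != 0) || (B != 0) ->
  dispersion a k = 0.
Proof.
move=> /trig_bcP[E1 E2] AB; rewrite /dispersion.
have [->|s0] := eqVneq (sin (phaseL a k + phaseR a k)) 0; first by rewrite mulr0.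
move/eqP: E1; rewrite mulf_eq0 (negPf s0) orbF => /eqP B0.
move: AB E2; rewrite B0 eqxx orbF mul0r subr0 => A0 /eqP.
by rewrite mulrCA mulf_eq0 (negPf A0)/= mulrC => /eqP ->; rewrite mul0r.
Qed.

(** For k > 0, if sin (u + v) is nonzero then B = 0. Otherwise sin v is nonzero, for else sin u
    would vanish too, and the second condition makes (A, B) parallel to (cos u, sin u). *)
Lemma trig_line a k : -1 < a -> a < 1 -> irrational a -> 0 <= k ->
  exists al be, forall A B, trig_bc a k A B -> (k = 0 -> B = 0) ->
    exists t, A = t * al /\ B = t * be.
Proof.
move=> aN1 a1 irr; rewrite le_eqVlt => /predU1P[<-|k0].
  by exists 1, 0 => A B _ /(_ erefl) ->; exists A; rewrite mulr1 mulr0.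
have [s0|s0] := eqVneq (sin (phaseL a k + phaseR a k)) 0; last first.
  exists 1, 0 => A B /trig_bcP[/eqP + _] _; rewrite mulf_eq0 (negPf s0) orbF => /eqP ->.
  by exists A; rewrite mulr1 mulr0.
have sR : sin (phaseR a k) != 0.
  apply/eqP => sR; apply: (phase_not_both0 aN1 a1 irr k0 _ sR).
  move: s0; rewrite sinD sR mulr0 addr0 => /eqP; rewrite mulf_eq0 => /orP[/eqP //|/eqP c0].
  have := cos2Dsin2 (phaseR a k); rewrite sR c0 expr0n addr0 => /eqP.
  by rewrite eq_sym oner_eq0.
exists (cos (phaseL a k)), (sin (phaseL a k)) => A B /trig_bcP[_ /eqP] + _.
rewrite mulf_eq0 (negPf sR) subr_eq0 => /= /eqP E.
exists (A * cos (phaseL a k) + B * sin (phaseL a k)).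
have := cos2Dsin2 (phaseL a k); move: E.
set s := sin _; set c := cos _ => E cs.
split.
- rewrite -[LHS]mulr1 -cs; transitivity (A * c ^+ 2 + A * s * s); first by ring.
  by rewrite E; ring.
- rewrite -[LHS]mulr1 -cs; transitivity (B * c * c + B * s ^+ 2); first by ring.
  by rewrite -E; ring.
Qed.

Lemma kerH_line a l : -1 < a -> a < 1 -> irrational a ->
  exists2 e : R -> R, continuous e & forall f, kerH a l f ->
    exists z, eq_L2 f (fun x => z * (e x)%:C).
Proof.
move=> aN1 a1 irr.
have [[k k0 lk]|nk] := pselect (exists2 k, 0 <= k & l = (k ^+ 2)%:C); last first.
  exists (fun=> 0); first exact: cst_continuous.
  move=> f kf; exists 0; have [f0|] := kerH_explicit aN1 a1 kf.
    by apply: filterS f0 => x H /H ->; rewrite mul0r.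
  by move=> [k [A [B [A' [B' [k0 lk _ _ _]]]]]]; case: nk; exists k.
have [al [be line]] := trig_line aN1 a1 irr k0.
exists (trig k al be); first exact: continuous_trig.
move=> f kf; have [f0|] := kerH_explicit aN1 a1 kf.
  by exists 0; apply: filterS f0 => x H /H ->; rewrite mul0r.
move=> [k' [A [B [A' [B' [k'0 lk' kB [bc bc'] fE]]]]]].
have kk : k' = k.
  have : k' ^+ 2 = k ^+ 2 by move: lk'; rewrite lk => -[].
  by move/eqP; rewrite eqrXn2// => /eqP.
rewrite kk in kB bc bc' fE.
have [t [At Bt]] := line _ _ bc (fun h => (kB h).1).
have [t' [A't B't]] := line _ _ bc' (fun h => (kB h).2).
exists (t +i* t'); apply: filterS fE => x H /H ->.
by apply/eqP; rewrite eq_complex/= /trig At Bt A't B't; apply/andP; split; apply/eqP; ring.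
Qed.

Lemma lincomb_pair (J : pred nat) psi n i j (c d : R[i]) x : i != j ->
  (i < n)%N -> (j < n)%N -> J i -> J j ->
  lincomb J psi n (fun m => if m == i then c else if m == j then d else 0) x =
  c * psi i x + d * psi j x.
Proof.
move=> ij ni nj Ji Jj; rewrite /lincomb.
rewrite (bigD1 (Ordinal ni))//= eqxx; congr (_ + _).
rewrite (bigD1 (Ordinal nj))//=; last first.
  by rewrite Jj/=; apply: contra ij => /eqP[->].
rewrite eqxx eq_sym (negPf ij) big1 ?addr0// => m /andP[/andP[_ mi] mj].
have /negPf -> : (m : nat) != i by apply: contra mi => /eqP mi; apply/eqP/val_inj.
have /negPf -> : (m : nat) != j by apply: contra mj => /eqP mj; apply/eqP/val_inj.
by rewrite mul0r.
Qed.

Lemma lincomb_single (J : pred nat) psi i (c : R[i]) x : J i ->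
  lincomb J psi i.+1 (fun m => if m == i then c else 0) x = c * psi i x.
Proof.
move=> Ji; rewrite /lincomb (bigD1 (Ordinal (ltnSn i)))//= eqxx big1 ?addr0// => m.
move=> /andP[_ mi].
have /negPf -> : (m : nat) != i by apply: contra mi => /eqP mi; apply/eqP/val_inj.
by rewrite mul0r.
Qed.

Section Family.
Context (a : R) (aN1 : -1 < a) (a1 : a < 1) (psi : nat -> R -> R[i])
  (lam : nat -> R[i]) (eig : forall j, eigenvalueH a (lam j))
  (basis : forall l, eigenvalueH a l -> Defs.basis_of (kerH a l) (fun j => lam j == l) psi).

Lemma family_kerH j : kerH a (lam j) (psi j).
Proof. by have [H _ _] := basis (eig j); exact: H. Qed.

Lemma family_L2 j : L2 (psi j).
Proof. exact: kerH_L2 (family_kerH j). Qed.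

Lemma family_neq0 j : ~ eq_L2 (psi j) (fun=> 0).
Proof.
move=> j0; have [_ indep _] := basis (eig j).
have := indep j.+1 (fun m => if m == j then 1 else 0).
have H : eq_L2 (lincomb (fun i => lam i == lam j) psi j.+1
    (fun m => if m == j then 1 else 0)) (fun=> 0).
  by apply: filterS j0 => x H Ox; rewrite lincomb_single// (H Ox) mulr0.
by move=> /(_ H j (ltnSn j) (eqxx _))/eqP; rewrite eqxx oner_eq0.
Qed.

Context (irr : irrational a).

(** Two terms in one eigenspace would be multiples zi e and zj e of one function, and zj psi_i - zi
    psi_j = 0 contradicts their independence. *)
Lemma family_injective i j : lam i = lam j -> i = j.
Proof.
move=> lij; apply/eqP/negPn/negP => ij.
have [e _ line] := kerH_line (lam j) aN1 a1 irr.
have [zj Ej] := line _ (family_kerH j).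
have ki : kerH a (lam j) (psi i) by rewrite -lij; exact: family_kerH.
have [zi Ei] := line _ ki.
have [_ indep _] := basis (eig j).
have := indep (maxn i j).+1 (fun m => if m == i then zj else if m == j then - zi else 0).
have H : eq_L2 (lincomb (fun m => lam m == lam j) psi (maxn i j).+1
    (fun m => if m == i then zj else if m == j then - zi else 0)) (fun=> 0).
  have Fi : Filter (almost_everywhere (@lebesgue_measure R)) by exact: ae_filter_ringOfSetsType.
  apply: filterS2 Ei Ej => x Hi Hj Ox.
  rewrite lincomb_pair ?ltnS ?leq_maxl ?leq_maxr ?lij//.
  by rewrite (Hi Ox) (Hj Ox); ring.
move=> /(_ H) Z; have := Z i; rewrite ltnS leq_maxl lij !eqxx => /(_ isT isT) zj0.
apply: (@family_neq0 j); apply: filterS Ej => x Hj Ox.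
by rewrite (Hj Ox) zj0 mul0r.
Qed.

Lemma family_minimal j : ~ complete_family (fun i => i != j) psi.
Proof.
have [f0|] := kerH_explicit aN1 a1 (family_kerH j); first by case: (family_neq0 f0).
move=> [k [A [B [A' [B' [k0 lk kB [bc bc'] fE]]]]]].
have orthJ phi m : dual a m phi -> m = k ^+ 2 ->
    forall i, i != j -> orth phi (psi i).
  move=> dphi mk i ij; apply: (kerH_orth aN1 a1 dphi (family_kerH i)).
  by rewrite mk -lk => /family_injective/eqP; rewrite (negPf ij).
have Lp i : i != j -> L2 (psi i) by move=> _; exact: family_L2.
have h0 := halfpi_gt0 (R := R).
have [cN c1] := interior_point aN1 a1.
have caff (p q : R) : continuous (fun x : R => p * x + q).
  by move=> x; exact: has_derivative_continuous (has_derivative_affine x p q).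
have csin (p q d : R) : continuous (fun x : R => p * sin (q * x + d)).
  by move=> x; exact: has_derivative_continuous
    (has_derivativeZ p (has_derivative_sin x q d)).
have [k00|kn0] := eqVneq k 0.
  have dt := dual_tent aN1 a1.
  have E : 0 = k ^+ 2 by rewrite k00 expr0n.
  apply: (not_complete_orth dt.1 _ Lp (orthJ _ _ dt E)).
  apply: (ip_glue_gt0 aN1 a1 (caff _ _) (caff _ _)); left.
  exists ((- halfpi + halfpi * a) / 2); first by rewrite in_itv/= !midf_lt.
  have -> : halfpi * (1 - a) * ((- halfpi + halfpi * a) / 2) + halfpi * (1 - a) * halfpi =
    halfpi * (1 - a) * (halfpi * (1 + a) / 2) by field.
  have aN : 0 < 1 - a by rewrite subr_gt0.
  have aP : 0 < 1 + a by rewrite -ltrBlDl sub0r.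
  by rewrite gt_eqF// !(mulr_gt0, divr_gt0)// ?pi_gt0.
have k0' : 0 < k by rewrite lt_neqAle eq_sym kn0.
have D0 : dispersion a k = 0.
  have [AB|] := boolP ((A != 0) || (B != 0)); first exact: dispersion_eq0 bc AB.
  rewrite negb_or !negbK => /andP[/eqP A0 /eqP B0].
  have [AB'|] := boolP ((A' != 0) || (B' != 0)); first exact: dispersion_eq0 bc' AB'.
  rewrite negb_or !negbK => /andP[/eqP A'0 /eqP B'0].
  case: (@family_neq0 j); apply: filterS fE => x H /H ->.
  by rewrite A0 B0 A'0 B'0 /trig !mul0r addr0.
(* With these weights the first condition of [dual_sin] is [dispersion a k = 0]. *)
pose al := sin (phaseR a k) ^+ 2; pose be := sin (phaseL a k) ^+ 2.
have E1 : al * (sin (phaseL a k) * cos (phaseL a k)) +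
    be * (sin (phaseR a k) * cos (phaseR a k)) = 0.
  by rewrite -[RHS]D0 /dispersion sinD /al /be; ring.
have E2 : al * sin (phaseL a k) ^+ 2 = be * sin (phaseR a k) ^+ 2 by rewrite mulrC.
have ds := dual_sin aN1 a1 E1 E2.
apply: (not_complete_orth ds.1 _ Lp (orthJ _ _ ds erefl)).
apply: (ip_glue_gt0 aN1 a1 (csin _ _ _) (csin _ _ _)).
have [sL|sL] := eqVneq (sin (phaseL a k)) 0.
- left; apply: sin_affine_neq0 => //; rewrite /al sqrf_eq0.
  by apply/eqP; exact: (phase_not_both0 aN1 a1 irr k0' sL).
- by right; apply: sin_affine_neq0 => //; rewrite /be sqrf_eq0.
Qed.

End Family.

End IrrationalSpectrum.

(** * Special values of the phases *)

Section Phases.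
Context {R : realType} (a : R) (aN1 : -1 < a) (a1 : a < 1).
Local Notation halfpi := (pi / 2 : R).

Lemma lengthL_gt0 : 0 < halfpi * (1 + a).
Proof. by have p := aN1; rewrite mulr_gt0 ?halfpi_gt0//; lra. Qed.

Lemma lengthR_gt0 : 0 < halfpi * (1 - a).
Proof. by have p := a1; rewrite mulr_gt0 ?halfpi_gt0//; lra. Qed.

Lemma phaseL_int j : phaseL a (j%:R * (2 * pi / (halfpi * (1 + a)))) = j%:R * pi.
Proof.
rewrite /phaseL; have := pi_gt0 R; move: pi => p p0.
have /lt0r_neq0 Pa : 0 < 1 + a by have q := aN1; lra.
by field; rewrite Pa lt0r_neq0.
Qed.

Lemma phaseR_int j : phaseR a (j%:R * (2 * pi / (halfpi * (1 - a)))) = j%:R * pi.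
Proof.
rewrite /phaseR; have := pi_gt0 R; move: pi => p p0.
have /lt0r_neq0 Na : 0 < 1 - a by rewrite subr_gt0.
by field; rewrite Na lt0r_neq0.
Qed.

Lemma phaseD_even j : sin (phaseL a (2 * j%:R) + phaseR a (2 * j%:R)) = 0.
Proof. by rewrite -phaseD (_ : _ * halfpi = j%:R * pi) ?sin_natpi//; field. Qed.

Lemma sin_phaseL_even_neq0 j : irrational a -> (0 < j)%N -> sin (phaseL a (2 * j%:R)) != 0.
Proof.
move=> irr j0; apply/eqP => sL.
have k0 : 0 < 2 * j%:R :> R by rewrite mulr_gt0// ltr0n.
apply: (phase_not_both0 aN1 a1 irr k0 sL).
have := phaseD_even j; rewrite sinD sL mul0r add0r => /eqP.
rewrite mulf_eq0 => /orP[/eqP c0|/eqP //].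
have := cos2Dsin2 (phaseL a (2 * j%:R)); rewrite c0 sL expr0n addr0 => /eqP.
by rewrite eq_sym oner_eq0.
Qed.

(** The function is cos (2 j (x - s)) with s the midpoint of the right subinterval: period pi
    equates the values at the two ends, symmetry about s those at the interior point and the right
    end. *)
Lemma trig_bc_even j :
  trig_bc a (2 * j%:R) (cos (phaseL a (2 * j%:R))) (sin (phaseL a (2 * j%:R))).
Proof.
by apply/trig_bcP; rewrite phaseD_even mulr0 [cos _ * _]mulrC subrr mulr0.
Qed.

End Phases.

(** * Completeness of the eigenfunctions *)

Section Completeness.
Context {R : realType} (a : R) (aN1 : -1 < a) (a1 : a < 1) (psi : nat -> R -> R[i])
  (lam : nat -> R[i]) (eig : forall j, eigenvalueH a (lam j))
  (basis : forall l, eigenvalueH a l -> Defs.basis_of (kerH a l) (fun j => lam j == l) psi)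
  (irr : irrational a).
Local Notation halfpi := (pi / 2 : R).
Local Notation Lpsi := (family_L2 eig basis).

Lemma approx_real_trig k A B : trig_bc a k A B -> approx_real psi (trig k A B).
Proof.
move=> bc; have kt := kerH_trig bc.
split; first by apply: sqint_continuous; exact: continuous_trig.
have [t0|t0] := pselect (eq_L2 (fun x => (trig k A B x)%:C) (fun=> 0)).
  apply: (@approx_lincomb _ _ Lpsi xpredT 0 (fun=> 0)); first exact: kerH_L2 kt.
  by apply: filterS t0 => x H Ox; rewrite (H Ox) /lincomb big_ord0.
have ev : eigenvalueH a (k ^+ 2)%:C by exists (fun x => (trig k A B x)%:C).
have [_ _ /(_ _ kt)[n [alpha E]]] := basis ev.
exact: (approx_lincomb Lpsi (kerH_L2 kt) E).
Qed.

Lemma approx_real_cos k : sin (phaseL a k) = 0 \/ sin (phaseR a k) = 0 ->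
  approx_real psi (fun x => cos (k * x)).
Proof.
move=> s0; have -> : (fun x => cos (k * x)) = trig k 1 0.
  by apply/funext => x; rewrite /trig mul1r mul0r addr0.
apply: approx_real_trig; apply/trig_bcP; rewrite !mul0r mul1r subr0; split=> //.
by case: s0 => ->; rewrite ?mulr0 ?mul0r.
Qed.

Lemma family_even F c : continuous F -> (forall r, `|F r| <= c) ->
  approx_real psi (fun x => F `|x|).
Proof.
have p0 : 0 < pi :> R by exact: pi_gt0.
have h0 := halfpi_gt0 (R := R).
pose l1 := halfpi * (1 + a); pose l2 := halfpi * (1 - a).
have l10 : 0 < l1 := lengthL_gt0 aN1.
have l20 : 0 < l2 := lengthR_gt0 a1.
have l12 : l1 + l2 = pi by rewrite /l1 /l2; field.
have C1 j : approx_real psi (fun x => cos (j%:R * (2 * pi / l1 * x))).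
  have := @approx_real_cos (j%:R * (2 * pi / l1)); rewrite (phaseL_int aN1) sin_natpi.
  by move=> /(_ (or_introl erefl)); under eq_fun do rewrite -mulrA.
have C2 j : approx_real psi (fun x => cos (j%:R * (2 * pi / l2 * x))).
  have := @approx_real_cos (j%:R * (2 * pi / l2)); rewrite (phaseR_int a1) sin_natpi.
  by move=> /(_ (or_intror erefl)); under eq_fun do rewrite -mulrA.
have k0 j l : (0 < j)%N -> 0 < l -> 0 < j%:R * (2 * pi / l) :> R.
  by move=> j0 ll; rewrite mulr_gt0 ?ltr0n// divr_gt0// mulr_gt0.
(* [even_closed] takes the longer subinterval first; it is the left one when a >= 0. *)
move=> cF Fc; have [a0|a0] := leP 0 a.
- apply: (even_closed (approx_real_closed Lpsi) l20 _ l12 _ C1 C2 cF Fc).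
    by rewrite ler_pM2l ?halfpi_gt0// lerD2l; apply: (le_trans _ a0); rewrite oppr_le0.
  (* The sine in question is that of the left phase at k = 2 pi j / l2, where the right phase is j
     pi; both sines cannot vanish. *)
  move=> j j0; apply/eqP => s0.
  apply: (phase_not_both0 aN1 a1 irr (k0 _ _ j0 l20)); last by rewrite (phaseR_int a1) sin_natpi.
  by rewrite -s0 /phaseL; congr sin; rewrite -/l1; field; rewrite gt_eqF.
- rewrite addrC in l12.
  apply: (even_closed (approx_real_closed Lpsi) l10 _ l12 _ C2 C1 cF Fc).
    by rewrite ler_pM2l ?halfpi_gt0// lerD2l; apply: (le_trans (ltW a0)); rewrite oppr_ge0 ltW.
  move=> j j0; apply/eqP => s0.
  apply: (phase_not_both0 aN1 a1 irr (k0 _ _ j0 l10)); first by rewrite (phaseL_int aN1) sin_natpi.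
  by rewrite -s0 /phaseR; congr sin; rewrite -/l2; field; rewrite gt_eqF.
Qed.

Lemma family_complete : complete_family xpredT psi.
Proof.
have cM := approx_real_closed Lpsi.
apply: (approx_complete Lpsi); apply: (dense_closed cM); apply: (full_closed cM).
  exact: family_even.
case=> [|j].
  by have := closed0 cM; congr approx_real; apply/funext => x; rewrite mul0r sin0.
pose k : R := 2 * j.+1%:R; pose A := cos (phaseL a k); pose B := sin (phaseL a k).
have B0 : B != 0 by exact: sin_phaseL_even_neq0.
have ck : continuous (fun r : R => cos (k * r)).
  rewrite (_ : (fun r => _) = trig k 1 0); first exact: continuous_trig.
  by apply/funext => r; rewrite /trig mul1r mul0r addr0.
have Mc := family_even ck (fun r => cos_max (k * r)).
have Mt := approx_real_trig (trig_bc_even a j.+1).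
apply: (closed_eq cM (closedZ cM B^-1 (closedB cM Mt (closedZ cM A Mc)))) => x _.
rewrite cos_norm /trig -/k -/A -/B addrAC subrr add0r mulKf//.
by congr sin; rewrite /k; ring.
Qed.

End Completeness.

(** * Irrational parameter: failure of the basis property *)

Section TrigIntegrals.
Context {R : realType}.
Implicit Types (a k A B s t x e : R) (g : R -> R).
Local Notation mu := (@lebesgue_measure R).
Local Notation halfpi := (pi / 2 : R).

Lemma integral_trig k s t A B A' B' : s <= t -> k != 0 ->
  sin (k * s) = 0 -> sin (k * t) = 0 ->
  \int[mu]_(x in `]s, t[) (trig k A B x * trig k A' B' x) =
  (A * A' + B * B') * ((t - s) / 2).
Proof.
move=> st k0 ss st0.
(* The oscillating part of the primitive is written with a factor sin (k x), so it drops out at both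
   ends. *)
pose F x := (A * A' + B * B') / 2 * x + (2 * k)^-1 *
  (trig k 0 1 x * trig k (A * A' - B * B') (A * B' + A' * B) x).
have cF : continuous (fun x => trig k A B x * trig k A' B' x).
  by move=> x; apply: cvgM; exact: continuous_trig.
rewrite (@FTC_oo R F)//.
- by rewrite /F /trig ss st0; field.
- move=> x _.
  have dl : has_derivative (fun x => (A * A' + B * B') / 2 * x) x ((A * A' + B * B') / 2).
    apply: (has_derivative_eq (has_derivativeZ _ (has_derivative_id x))).
    by rewrite mulr1.
  apply: (has_derivative_eq (has_derivativeD dl (has_derivativeZ (2 * k)^-1
    (has_derivativeM (has_derivative_trig k 0 1 x)
      (has_derivative_trig k (A * A' - B * B') (A * B' + A' * B) x))))).
  have := cos2Dsin2 (k * x); rewrite /trig; move: (cos _) (sin _) => C S CS.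
  have -> : (A * A' + B * B') / 2 = (A * A' + B * B') / 2 * (C ^+ 2 + S ^+ 2).
    by rewrite CS mulr1.
  by field.
- exact: continuous_subspaceT.
Qed.

Lemma ip_sin_orth k k' : k ^+ 2 != k' ^+ 2 ->
  sin (k * halfpi) = 0 -> sin (k' * halfpi) = 0 -> ip (trig k 0 1) (trig k' 0 1) = 0.
Proof.
move=> kk sk sk'; have h0 := halfpi_gt0 (R := R).
have cF : continuous (fun x => trig k 0 1 x * trig k' 0 1 x).
  by move=> x; apply: cvgM; exact: continuous_trig.
have iF : mu.-integrable (@Omega R) (EFin \o (fun x => trig k 0 1 x * trig k' 0 1 x)).
  by apply: sqint_mul; apply: sqint_continuous; exact: continuous_trig.
have : (k ^+ 2 - k' ^+ 2) * ip (trig k 0 1) (trig k' 0 1) = 0.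
  rewrite /ip -RintegralZl//.
  rewrite (@FTC_oo R (fun x => trig k 0 1 x * trig k' k' 0 x - trig k k 0 x * trig k' 0 1 x)).
  - by rewrite /trig !mulrN !sinN sk sk'; ring.
  - by lra.
  - move=> x _; apply: (has_derivative_eq (has_derivativeB
      (has_derivativeM (has_derivative_trig k 0 1 x) (has_derivative_trig k' k' 0 x))
      (has_derivativeM (has_derivative_trig k k 0 x) (has_derivative_trig k' 0 1 x)))).
    by rewrite /trig; ring.
  - by apply: continuous_subspaceT => x; apply: cvgM; [exact: cvg_cst|exact: cF].
by move=> /eqP; rewrite mulf_eq0 subr_eq0 (negPf kk) => /eqP.
Qed.

Lemma ip_sqr_le f g : sqint f -> sqint g -> 0 < ip g g ->
  ip f g ^+ 2 <= ip f f * ip g g.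
Proof.
move=> sf sg g0; pose t := ip f g / ip g g.
have stg := sqintZ t sg; have sB := sqintB sf stg.
have := ip_ge0 (fun x => f x - t * g x).
rewrite ipBl// (ipC f) (ipC (fun x => t * g x)) !ipBl// !ipZl//.
rewrite (ipC f (fun x => t * g x)) (ipC g (fun x => t * g x)) !ipZl//.
rewrite (ipC g f).
have -> : ip f f - t * ip f g - (t * ip f g - t * (t * ip g g)) =
    (ip f f * ip g g - ip f g ^+ 2) / ip g g.
  by rewrite /t; field; rewrite gt_eqF.
by rewrite pmulr_lge0 ?invr_gt0// subr_ge0.
Qed.

(** Pigeonhole for the points (cos (i t), sin (i t)) in a grid of mesh at most e / 2 on the square
    [-1, 1]^2. Two points in one box differ little in both coordinates, and the sine of the
    difference of their angles is controlled by these differences. *)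
Lemma small_sin t e : 0 < e -> exists2 m, (0 < m)%N & `|sin (m%:R * t)| <= e.
Proof.
move=> e0; pose N := (Num.truncn (2 / e)).+1.
have Ne : 2 / e < N%:R by have := truncnS_gt (2 / e).
have N0 : 0 < N%:R :> R by rewrite ltr0n.
(* The extra box receives the value x = 1, for which the truncation is exactly 2 N. *)
pose box (x : R) : 'I_(2 * N).+1 := inord (Num.truncn (N%:R * (1 + x))).
have boxP x y : `|x| <= 1 -> `|y| <= 1 -> box x = box y -> `|x - y| <= e / 2.
  rewrite (ler_norml x) (ler_norml y) => /andP[x1 x2] /andP[y1 y2] /(congr1 (@nat_of_ord _)).
  have bd (z : R) : -1 <= z -> z <= 1 -> (Num.truncn (N%:R * (1 + z)) < (2 * N).+1)%N.
    move=> z1 z2; rewrite ltnS truncn_le_nat.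
    apply: (@le_lt_trans _ _ (2 * N)%:R); last by rewrite ltr_nat.
    rewrite natrM mulrC; apply: ler_wpM2r; [exact: ltW|lra].
  rewrite !inordK ?bd// => E.
  have /truncn_itv/andP[xl xu] : 0 <= N%:R * (1 + x) by rewrite mulr_ge0 ?(ltW N0)//; lra.
  have /truncn_itv/andP[yl yu] : 0 <= N%:R * (1 + y) by rewrite mulr_ge0 ?(ltW N0)//; lra.
  rewrite E -natr1 in xl xu; rewrite -natr1 in yu.
  have : N%:R * `|x - y| <= 1.
    rewrite -{1}(ger0_norm (ltW N0)) -normrM ler_norml; apply/andP; split; lra.
  rewrite mulrC -ler_pdivlMr// div1r => /le_trans; apply.
  by rewrite -[e / 2]invrK invf_div lef_pV2 ?posrE ?divr_gt0// ltW.
pose K := (#|{: 'I_(2 * N).+1 * 'I_(2 * N).+1}|).+1.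
pose F (i : 'I_K) := (box (cos (i%:R * t)), box (sin (i%:R * t))).
have : ~~ injectiveb F.
  by apply/negP => /injectiveP/leq_card; rewrite card_ord ltnn.
move=> /injectivePn[i0 [j0 + E]].
have wl (i j : 'I_K) : (i < j)%N -> F i = F j -> exists2 m, (0 < m)%N & `|sin (m%:R * t)| <= e.
  move=> ij /pair_equal_spec[/boxP Ec /boxP Es]; exists (j - i)%N.
    by rewrite subn_gt0.
  rewrite natrB ?(ltnW ij)// mulrBl sinB.
  have c1 x : `|cos x| <= 1 :> R by exact: cos_max.
  have s1 x : `|sin x| <= 1 :> R by exact: sin_max.
  have {}Ec := Ec (c1 _) (c1 _); have {}Es := Es (s1 _) (s1 _).
  move: Ec Es (c1 (j%:R * t)) (s1 (j%:R * t)).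
  set C := cos _; set C' := cos _; set S := sin _; set S' := sin _ => Ec Es Cj Sj.
  have -> : S' * C - C' * S = (C - C') * S' - (S - S') * C' by ring.
  apply: le_trans (ler_normB _ _) _; rewrite !normrM.
  have := ler_pM (normr_ge0 _) (normr_ge0 _) Ec Sj.
  by have := ler_pM (normr_ge0 _) (normr_ge0 _) Es Cj; lra.
by rewrite neq_ltn => /orP[ij|ij]; [exact: wl ij E|exact: wl ij (esym E)].
Qed.

(** Here the adjoint eigenfunction is smooth across the interior point, and cos (k x) agrees at the
    two ends. It is presented as [glue] of two copies of itself. *)
Lemma dual_sin_even a k : -1 < a -> a < 1 -> sin (k * halfpi) = 0 ->
  dual a (k ^+ 2) (trig k 0 1).
Proof.
move=> aN1 a1 sk.
have -> : trig k 0 1 = glue (halfpi * a) (trig k 0 1) (trig k 0 1).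
  by apply/funext => x; rewrite /glue; case: ifP.
have d1 x : has_derivative (trig k 0 1) x (trig k k 0 x).
  by apply: (has_derivative_eq (has_derivative_trig k 0 1 x)); rewrite /trig; ring.
have d2 x : has_derivative (trig k k 0) x (- (k ^+ 2 * trig k 0 1 x)).
  by apply: (has_derivative_eq (has_derivative_trig k k 0 x)); rewrite /trig; ring.
apply: (dual_glue aN1 a1 d1 d2 d1 d2) => //.
- by rewrite /trig mulrN sinN sk; ring.
- by rewrite /trig sk; ring.
- by rewrite /trig mulrN cosN; ring.
Qed.

End TrigIntegrals.

(** * A lacunary sine series *)

Section Lacunary.
Context {R : realType} (m : nat -> nat) (m_gt0 : forall i, (0 < m i)%N).
Local Notation halfpi := (pi / 2 : R).

Definition weight i : R := 2^-1 ^+ i.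

Definition lacunary n x := \sum_(i < n) weight i * trig (2 * (m i)%:R) 0 1 x.

Lemma weight_gt0 i : 0 < weight i.
Proof. by rewrite exprn_gt0// invr_gt0. Qed.

Lemma sum_weight n : \sum_(i < n) weight i = 2 - 2 * weight n.
Proof.
elim: n => [|n IH]; first by rewrite big_ord0 /weight expr0; lra.
by rewrite big_ord_recr/= IH /weight exprS; field.
Qed.

Lemma lacunary_term_le i x : `|weight i * trig (2 * (m i)%:R) 0 1 x| <= weight i.
Proof.
rewrite normrM (gtr0_norm (weight_gt0 i)) -[leRHS]mulr1 ler_pM2l ?weight_gt0//.
by rewrite /trig mul0r add0r mul1r; exact: sin_max.
Qed.

Lemma lacunary_le n x : `|lacunary n x| <= 2.
Proof.
apply: le_trans (ler_norm_sum _ _ _) _.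
apply: (@le_trans _ _ (\sum_(i < n) weight i)).
  by apply: ler_sum => i _; exact: lacunary_term_le.
by rewrite sum_weight; have := weight_gt0 n; lra.
Qed.

Lemma continuous_lacunary n : continuous (lacunary n).
Proof.
elim: n => [|n IH].
  rewrite (_ : lacunary 0 = fun=> 0); first exact: cst_continuous.
  by apply/funext => x; rewrite /lacunary big_ord0.
rewrite (_ : lacunary n.+1 = fun x => lacunary n x +
    weight n * trig (2 * (m n)%:R) 0 1 x).
  move=> x; apply: cvgD; first exact: IH.
  by apply: cvgM; [exact: cvg_cst|exact: continuous_trig].
by apply/funext => x; rewrite /lacunary big_ord_recr.
Qed.

Lemma lacunary_cvg x : cvgn (fun n => lacunary n x).
Proof.
have -> : (fun n => lacunary n x) =
    series (fun i => weight i * trig (2 * (m i)%:R) 0 1 x).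
  by apply/funext => n; rewrite /series/= big_mkord.
apply: normed_cvg.
apply: (series_le_cvg (v_ := geometric 1 2^-1)).
- by move=> i; exact: normr_ge0.
- by move=> i; rewrite /geometric/= mul1r ltW// weight_gt0.
- by move=> i; rewrite /geometric/= mul1r; exact: lacunary_term_le.
- by apply: is_cvg_geometric_series; rewrite ger0_norm ?invr_ge0// invf_lt1// ltr1n.
Qed.

Lemma sin_even_halfpi j : sin (2 * j%:R * halfpi) = 0.
Proof. by rewrite (_ : _ * halfpi = j%:R * pi) ?sin_natpi//; field. Qed.

Lemma ip_trig_even j A B A' B' : (0 < j)%N ->
  ip (trig (2 * j%:R) A B) (trig (2 * j%:R) A' B') = (A * A' + B * B') * halfpi.
Proof.
move=> j0; have h0 := halfpi_gt0 (R := R).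
rewrite /ip /Omega integral_trig ?mulrN ?sinN ?sin_even_halfpi ?oppr0//.
- by congr (_ * _); field.
- by lra.
- by rewrite mulf_neq0// pnatr_eq0 -lt0n.
Qed.

Lemma ip_sin_even_ge0 i j : 0 <= ip (trig (2 * i%:R) 0 1) (trig (2 * j%:R) 0 1) :> R.
Proof.
have [->|ij] := eqVneq i j; first exact: ip_ge0.
rewrite ip_sin_orth ?sin_even_halfpi// eqrXn2 ?mulr_ge0//.
by rewrite (inj_eq (mulfI _)) ?eqr_nat.
Qed.

(** The frequencies [m i] may repeat. Inner products of these sines are never negative, so
    repetitions only enlarge the coefficient; hence an inequality. *)
Lemma ip_lacunary_ge n i : (i < n)%N ->
  weight i * halfpi <= ip (lacunary n) (trig (2 * (m i)%:R) 0 1).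
Proof.
pose phi : R -> R := trig (2 * (m i)%:R) 0 1.
have sphi : sqint phi by apply: sqint_continuous; exact: continuous_trig.
suff H : (if (i < n)%N then weight i * halfpi else 0) <= ip (lacunary n) phi.
  by move=> ij; rewrite ij in H.
elim: n => [|n IH].
  rewrite (_ : lacunary 0 = fun=> 0) ?ip0//.
  by apply/funext => x; rewrite /lacunary big_ord0.
rewrite (_ : lacunary n.+1 = fun x => lacunary n x +
    weight n * trig (2 * (m n)%:R) 0 1 x); last first.
  by apply/funext => x; rewrite /lacunary big_ord_recr.
have st : sqint (trig (2 * (m n)%:R) 0 1 : R -> R).
  by apply: sqint_continuous; exact: continuous_trig.
rewrite ipDl//; [|by apply: sqint_continuous; exact: continuous_lacunary|exact: sqintZ].
rewrite ipZl//.
have t0 : 0 <= weight n * ip (trig (2 * (m n)%:R) 0 1) phi.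
  by rewrite mulr_ge0 ?(ltW (weight_gt0 n))// ip_sin_even_ge0.
move: IH; rewrite ltnS [(i <= n)%N]leq_eqVlt; case: eqP => [ni|_] /=.
  rewrite ni ltnn => IH; rewrite -[leLHS]add0r; apply: lerD => //.
  by rewrite /phi ni ip_trig_even// !mul0r mul1r add0r mul1r.
case: ifP => _ IH; first by rewrite -[leLHS]addr0; exact: lerD.
exact: addr_ge0.
Qed.

Lemma lacunary_limit : exists2 g, sqint g &
  forall i, weight i * halfpi <= ip g (trig (2 * (m i)%:R) 0 1).
Proof.
pose g x := limn (fun n => lacunary n x).
have cg x : lacunary n x @[n --> \oo] --> g x by exact: lacunary_cvg.
have gb x : `|g x| <= 2.
  have c : `|lacunary n x| @[n --> \oo] --> `|g x| by apply: cvg_norm.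
  apply: (cvgr_to_le c).
  by apply: nearW => n; exact: lacunary_le.
have ml n := (sqint_continuous (@continuous_lacunary n)).1.
have mg := measurable_fun_cvg ml (fun x _ => cg x).
exists g; first exact: (sqint_bounded mg (fun x _ => gb x)).
move=> i; pose phi : R -> R := trig (2 * (m i)%:R) 0 1.
have sphi : sqint phi by apply: sqint_continuous; exact: continuous_trig.
have phi1 x : `|phi x| <= 1.
  by rewrite /phi /trig mul0r add0r mul1r; exact: sin_max.
have C : ip (lacunary n) phi @[n --> \oo] --> ip g phi.
  apply: (@Rintegral_cvg _ (fun n x => lacunary n x * phi x) _ (fun=> 2)).
  - by move=> n; apply: measurable_funM; [exact: ml|exact: sphi.1].
  - move=> n x _; rewrite normrM -[leRHS]mulr1.
    by apply: ler_pM => //; exact: lacunary_le.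
  - by apply: (@integrable_bounded _ _ 2) => // x _; rewrite ger0_norm.
  - by move=> x _; apply: cvgM; [exact: cg|exact: cvg_cst].
apply: (cvgr_to_ge C); near=> n; apply: ip_lacunary_ge.
by near: n; exact: nbhs_infty_gt.
Unshelve. all: by end_near. Qed.

End Lacunary.

(** * Coefficients of an expansion in eigenfunctions *)

Section NotBasis.
Context {R : realType} (a : R) (aN1 : -1 < a) (a1 : a < 1) (psi : nat -> R -> R[i])
  (lam : nat -> R[i]) (eig : forall j, eigenvalueH a (lam j))
  (basis : forall l, eigenvalueH a l -> Defs.basis_of (kerH a l) (fun j => lam j == l) psi)
  (irr : irrational a).
Local Notation halfpi := (pi / 2 : R).
Local Notation Lpsi := (family_L2 eig basis).
Local Notation re f := (fun x => complex.Re (f x)).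
Local Notation im f := (fun x => complex.Im (f x)).

(** The eigenfunction cos (2 m x - u), whose squared norm is pi / 2 for every m > 0. *)
Definition emode m : R -> R :=
  trig (2 * m%:R) (cos (phaseL a (2 * m%:R))) (sin (phaseL a (2 * m%:R))).

Lemma sqint_emode m : sqint (emode m).
Proof. by apply: sqint_continuous; exact: continuous_trig. Qed.

Lemma ip_emode m : (0 < m)%N -> ip (emode m) (emode m) = halfpi.
Proof. by move=> m0; rewrite ip_trig_even// -!expr2 cos2Dsin2 mul1r. Qed.

(** Enumeration and normalisation of the family are arbitrary; this locates its term for the
    eigenvalue (2 m) ^ 2 and records the unknown factor [beta]. If no term had this eigenvalue, the
    expansion of [emode m] would be an empty sum. *)
Lemma emode_member m : (0 < m)%N -> exists j beta,
  lam j = ((2 * m%:R) ^+ 2)%:C /\ eq_L2 (psi j) (fun x => beta * (emode m x)%:C).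
Proof.
move=> m0; have ke := kerH_trig (trig_bc_even a m).
have h0 := halfpi_gt0 (R := R).
have e0 : ~ eq_L2 (fun x => (emode m x)%:C) (fun=> 0).
  move=> e0; have s0 : sqint (fun=> 0 : R).
    by apply: sqint_continuous; exact: cst_continuous.
  have E : ae_eq (@lebesgue_measure R) Omega (emode m) (fun=> 0).
    by apply: filterS e0 => x H /H [].
  have := ip_emode m0; rewrite (ip_ae_eq (sqint_emode m) s0 (sqint_emode m) E) ip0.
  by move=> hE; rewrite -hE ltxx in h0.
have ev : eigenvalueH a ((2 * m%:R) ^+ 2)%:C by exists (fun x => (emode m x)%:C).
have [_ _ /(_ _ ke)[n [alpha E]]] := basis ev.
have [[j lj]|nj] := pselect (exists j, lam j = ((2 * m%:R) ^+ 2)%:C); last first.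
  case: e0; apply: filterS E => x H /H ->; rewrite /lincomb big1// => j /eqP lj.
  by case: nj; exists j.
have [e _ line] := kerH_line ((2 * m%:R) ^+ 2)%:C aN1 a1 irr.
have [z0 E0] := line _ ke.
have kj : kerH a ((2 * m%:R) ^+ 2)%:C (psi j) by rewrite -lj; exact: family_kerH.
have [z Ej] := line _ kj.
have z00 : z0 != 0.
  apply/eqP => z00; apply: e0; apply: filterS E0 => x H /H.
  by rewrite z00 mul0r.
exists j, (z / z0); split=> //.
have Fi : Filter (almost_everywhere (@lebesgue_measure R)) by exact: ae_filter_ringOfSetsType.
apply: filterS2 E0 Ej => x H0 Hj Ox.
by rewrite (Hj Ox) (H0 Ox) mulrA divfK.
Qed.

Context (g : R -> R) (sg : sqint g) (alpha : nat -> R[i]).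
Let rest n x := (g x)%:C - lincomb xpredT psi n alpha x.
Context (cvg_rest : L2norm (rest n) @[n --> \oo] --> (0 : R)).

Let L2_rest n : L2 (rest n).
Proof. by apply: L2B; [exact: L2_real|apply: lincomb_L2 => j _; exact: Lpsi]. Qed.

(** Paired with sin (2 m x), every term except the j-th drops out, so the pairing with the remainder
    is the same number for all n > j. By Cauchy-Schwarz it is bounded by a multiple of remainder
    norms that tend to 0. *)
Lemma coefficient m j beta : (0 < m)%N -> lam j = ((2 * m%:R) ^+ 2)%:C ->
  eq_L2 (psi j) (fun x => beta * (emode m x)%:C) ->
  complex.Re (alpha j * beta) * (sin (phaseL a (2 * m%:R)) * halfpi) =
  ip g (trig (2 * m%:R) 0 1).
Proof.
move=> m0 lj Ej; pose phi : R -> R := trig (2 * m%:R) 0 1; rewrite -/phi.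
have h0 := halfpi_gt0 (R := R).
have sphi : sqint phi by apply: sqint_continuous; exact: continuous_trig.
have pp : ip phi phi = halfpi by rewrite ip_trig_even// mul0r add0r !mul1r.
have dphi := dual_sin_even aN1 a1 (sin_even_halfpi m).
have L2t : L2 (fun x => alpha j * psi j x) by apply: L2Z; exact: Lpsi.
have ipj : ip (re (fun x => alpha j * psi j x)) phi =
    complex.Re (alpha j * beta) * (sin (phaseL a (2 * m%:R)) * halfpi).
  rewrite (@ip_ae_eq _ _ (fun x => complex.Re (alpha j * beta) * emode m x) phi)//.
  - rewrite ipZl//; last exact: sqint_emode.
    by rewrite ip_trig_even// mulr0 add0r mulr1.
  - by have [] := (L2P _).1 L2t.
  - by apply: sqintZ; exact: sqint_emode.
  - apply: filterS Ej => x H /H ->; rewrite mulrA.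
    by case: (alpha j * beta) => p q /=; rewrite mulr0 subr0.
have oS n : ip (re (lincomb (fun i => i != j) psi n alpha)) phi = 0.
  have [] // := @lincomb_orth _ phi (fun i => i != j) psi n alpha sphi.
    by move=> i _; exact: Lpsi.
  move=> i ij; apply: (kerH_orth aN1 a1 dphi (family_kerH eig basis i)) => li.
  by move/eqP: ij; apply; apply: (family_injective aN1 a1 eig basis irr); rewrite li lj.
pose D := ip g phi - complex.Re (alpha j * beta) * (sin (phaseL a (2 * m%:R)) * halfpi).
have rD n : (j < n)%N -> ip (re (rest n)) phi = D.
  move=> jn; have L2S := @lincomb_L2 _ (fun i => i != j) psi n alpha (fun i _ => Lpsi i).
  have -> : re (rest n) = fun x => g x -
      (complex.Re (lincomb (fun i => i != j) psi n alpha x) + complex.Re (alpha j * psi j x)).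
    apply/funext => x; rewrite /rest.
    have -> : lincomb xpredT psi n alpha x =
        lincomb (fun i => i != j) psi n alpha x + alpha j * psi j x.
      by rewrite /lincomb (bigD1 (Ordinal jn))//= addrC.
    by case: (lincomb _ _ _ _ _) (alpha j * psi j x) => ? ? [].
  have [sS _] := (L2P _).1 L2S; have [st _] := (L2P _).1 L2t.
  rewrite ipBl//; last exact: sqintD.
  by rewrite ipDl// oS add0r ipj.
have le n : (j < n)%N -> D ^+ 2 <= L2norm (rest n) ^+ 2 * halfpi.
  move=> jn; rewrite -(rD n jn); have [sr si] := (L2P _).1 (L2_rest n).
  apply: (le_trans (ip_sqr_le sr sphi _)); rewrite pp//.
  by rewrite ler_pM2r// L2norm_sqr// lerDl ip_ge0.
have C : L2norm (rest n) ^+ 2 * halfpi @[n --> \oo] --> (0 : R).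
  have -> : 0 = 0 * 0 * halfpi :> R by rewrite !mul0r.
  by under eq_fun do rewrite expr2; apply: cvgMl; exact: cvgM.
have D2 : D ^+ 2 <= 0.
  by apply: (cvgr_to_ge C); exists j.+1 => // n /= jn; exact: le.
have : D ^+ 2 == 0 by rewrite eq_le D2 sqr_ge0.
by rewrite sqrf_eq0 subr_eq0 => /eqP.
Qed.

(** The j-th term of the series is a difference of consecutive remainders, whose norms are bounded
    since they converge; [emode m] has a norm independent of m. *)
Lemma coefficient_bounded : exists K, forall m j beta, (0 < m)%N ->
  eq_L2 (psi j) (fun x => beta * (emode m x)%:C) ->
  complex.Re (alpha j * beta) ^+ 2 * halfpi <= K.
Proof.
have cvgr : cvgn (fun n => L2norm (rest n)) by apply/cvg_ex; exists 0.
have [K [_ HK]] := cvg_seq_bounded cvgr.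
have rK n : L2norm (rest n) ^+ 2 <= (K + 1) ^+ 2.
  have K1 : K < K + 1 by rewrite ltrDl.
  have /= := HK (K + 1) K1 n I.
  rewrite ger0_norm ?L2norm_ge0// => H.
  by apply: lerXn2r; rewrite ?nnegrE ?L2norm_ge0// (le_trans _ H)// L2norm_ge0.
exists (4 * (K + 1) ^+ 2) => m j beta m0 Ej.
have L2t : L2 (fun x => alpha j * psi j x) by apply: L2Z; exact: Lpsi.
have -> : complex.Re (alpha j * beta) ^+ 2 * halfpi =
    ip (re (fun x => alpha j * psi j x)) (re (fun x => alpha j * psi j x)).
  have sg' := sqintZ (complex.Re (alpha j * beta)) (sqint_emode m).
  have E : ae_eq (@lebesgue_measure R) Omega (re (fun x => alpha j * psi j x))
      (fun x => complex.Re (alpha j * beta) * emode m x).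
    apply: filterS Ej => x H /H ->; rewrite mulrA.
    by case: (alpha j * beta) => p q /=; rewrite mulr0 subr0.
  have [st _] := (L2P _).1 L2t.
  rewrite (ip_ae_eq st sg' st E) ipC (ip_ae_eq st sg' sg' E).
  rewrite ipZl//; last exact: sqint_emode.
  rewrite ipC ipZl//; [|exact: sqint_emode..].
  by rewrite ip_emode// mulrA -expr2.
have -> : re (fun x => alpha j * psi j x) = re (fun x => rest j x + (-1) * rest j.+1 x).
  by apply/funext => x; congr complex.Re; rewrite /rest lincombS; ring.
have := L2norm_sqrD (L2_rest j) (L2Z (-1) (L2_rest j.+1)).
rewrite L2norm_sqr; last by apply: L2D => //; exact: L2Z.
rewrite (L2norm_sqrZ (-1) (L2_rest j.+1))/= sqrrN expr1n oppr0 expr0n addr0 mul1r.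
move=> H; have := ip_ge0 (im (fun x => rest j x + (-1) * rest j.+1 x)).
have := rK j; have := rK j.+1; move: H; rewrite /=; lra.
Qed.

End NotBasis.

Lemma family_not_basis (R : realType) (a : R) (psi : nat -> R -> R[i])
    (lam : nat -> R[i]) : -1 < a -> a < 1 -> irrational a ->
  (forall j, eigenvalueH a (lam j)) ->
  (forall l, eigenvalueH a l -> Defs.basis_of (kerH a l) (fun j => lam j == l) psi) ->
  ~ conditional_basis psi.
Proof.
move=> aN1 a1 irr eig basis cb; have h0 := halfpi_gt0 (R := R).
have exm i : exists m, (0 < m)%N /\ `|sin (phaseL a (2 * m%:R))| <= (weight i : R) ^+ 2.
  have e0 : 0 < (weight i : R) ^+ 2 by rewrite exprn_gt0 ?weight_gt0.
  have [m m0 H] := small_sin (pi / 2 * (1 + a)) e0.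
  exists m; split=> //; rewrite (_ : phaseL _ _ = m%:R * (pi / 2 * (1 + a)))//.
  by rewrite /phaseL; field.
have [m Hm] := choice exm.
have m0 i : (0 < m i)%N by have [] := Hm i.
have [g sg gip] := @lacunary_limit R m m0.
have [alpha [cvg_rest _]] := cb _ (L2_real sg).
have [K HK] := coefficient_bounded eig basis sg cvg_rest.
(* Let w = 2 ^ (- i), s the sine of the phase and r the real part of the coefficient. From w <= r s
   and |s| <= w ^ 2 follows |r| >= 1 / w, whereas r ^ 2 pi / 2 <= K. *)
have bd i : pi / 2 <= K * (4^-1) ^+ i.
  have w0 := @weight_gt0 R i.
  have [j [beta [lj Ej]]] := emode_member aN1 a1 eig basis irr (m0 i).
  have c := coefficient aN1 a1 eig basis irr sg cvg_rest (m0 i) lj Ej.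
  have := HK _ _ _ (m0 i) Ej; have [_] := Hm i; have := gip i; rewrite -c.
  have -> : (4^-1) ^+ i = (weight i : R) ^+ 2.
    by rewrite /weight -exprM mulnC exprM; congr (_ ^+ i); field.
  move: (sin _) (complex.Re _) w0 h0; set w := (weight i : R) => s r w0 h0.
  rewrite [r * _]mulrA ler_pM2r// => wrs sw rK.
  have wr : w <= `|r| * w ^+ 2.
    apply: (le_trans wrs); apply: (le_trans (ler_norm _)); rewrite normrM.
    by apply: ler_wpM2l.
  have wr1 : 1 <= `|r| * w by rewrite -(ler_pM2r w0) mul1r -mulrA -expr2.
  have wr2 : 1 <= r ^+ 2 * w ^+ 2.
    by rewrite -[r ^+ 2]real_normK ?num_real// -exprMn exprn_ege1.
  apply: (@le_trans _ _ (r ^+ 2 * w ^+ 2 * (pi / 2))).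
    by rewrite -[leLHS]mul1r ler_pM2r.
  by rewrite mulrAC ler_pM2r// exprn_gt0.
have C : K * (4^-1) ^+ n @[n --> \oo] --> (0 : R).
  have -> : 0 = K * 0 :> R by rewrite mulr0.
  apply: cvgM; first exact: cvg_cst.
  by apply: cvg_expr; rewrite ger0_norm ?invr_ge0// invf_lt1// ltr1n.
have : pi / 2 <= 0 :> R by apply: (cvgr_to_ge C); apply: nearW.
by rewrite leNgt h0.
Qed.

(** * Rational parameter *)

Section Rational.
Context {R : realType}.
Implicit Types (a k A B x : R).
Local Notation halfpi := (pi / 2 : R).

(* For a = p / q and k = 4 q the interior point is a zero of [sin (k x)], so any
   two dilates of it on the two subintervals give an adjoint eigenfunction; these
   weights make it orthogonal to the two-dimensional eigenspace as well. *)
Lemma rational_orth a k : -1 < a -> a < 1 -> 0 < k ->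
  sin (k * halfpi) = 0 -> cos (k * halfpi) = 1 ->
  sin (phaseL a k) = 0 -> sin (phaseR a k) = 0 ->
  exists phi, [/\ sqint phi, 0 < ip phi phi &
    forall l f, kerH a l f -> orth phi f].
Proof.
move=> aN1 a1 k0 sk ck sL sR; have h0 := halfpi_gt0 (R := R).
have [cN c1] := interior_point aN1 a1.
have sc : sin (k * (halfpi * a)) = 0 by rewrite phaseB sinB sL sR; ring.
(* Against sin (k x) the pieces contribute half the lengths of their subintervals times [al] and
   [be], and these weights cancel the sum; against cos (k x) each contributes 0. *)
pose al := 1 - a; pose be := - (1 + a).
have E1 : al * (sin (phaseL a k) * cos (phaseL a k)) +
    be * (sin (phaseR a k) * cos (phaseR a k)) = 0 by rewrite sL sR; ring.
have E2 : al * sin (phaseL a k) ^+ 2 = be * sin (phaseR a k) ^+ 2.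
  by rewrite sL sR; ring.
have := dual_sin aN1 a1 E1 E2; set g := (fun x => al * _); set h := (fun x => be * _).
have cst (r d : R) : continuous (fun x : R => r * sin (k * x + d)).
  by move=> x; exact: has_derivative_continuous
    (has_derivativeZ r (has_derivative_sin x k d)).
move=> [sphi dphi]; exists (glue (halfpi * a) g h); split=> //.
  apply: (ip_glue_gt0 aN1 a1 (cst _ _) (cst _ _)); left.
  by apply: sin_affine_neq0; rewrite ?gt_eqF// /al subr_gt0.
move=> l f kf; apply: (kerH_orth_trig aN1 a1 sphi _ kf) => k' A B bc _.
have [kk|] := eqVneq (k' ^+ 2) (k ^+ 2); last exact: dphi.
have k'0 : k' != 0 by rewrite -sqrf_eq0 kk sqrf_eq0 gt_eqF.
have {kk} : k' = k \/ k' = - k by move/eqP: kk; rewrite eqf_sqr => /orP[]/eqP; auto.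
move=> kk.
(* The sign of k' is free, so k' = - k can occur; it is absorbed into the sine coefficient. *)
have -> : trig k' A B = trig k A (if k' == k then B else - B).
  apply/funext => x; rewrite /trig; case: eqP kk => [-> //|_ [//|->]].
  by rewrite mulNr cosN sinN mulrN mulNr.
move: (if _ then _ else _) => B'.
have gE x : g x = trig k 0 al x.
  by rewrite /g /trig sinD ck sk; ring.
have hE x : h x = trig k 0 be x.
  by rewrite /h /trig sinD cosN sinN ck sk; ring.
rewrite (ip_glue cN c1)//; [|exact: continuous_trig|exact: cst|exact: cst].
under eq_Rintegral do rewrite gE.
under [X in _ + X]eq_Rintegral do rewrite hE.
rewrite !integral_trig ?mulrN ?sinN ?sk ?sc ?oppr0 ?(ltW cN) ?(ltW c1) ?gt_eqF//.
by rewrite /al /be; ring.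
Qed.

Lemma rational_phases a : -1 < a -> a < 1 -> rational a ->
  exists k, [/\ 0 < k, sin (k * halfpi) = 0, cos (k * halfpi) = 1,
    sin (phaseL a k) = 0 & sin (phaseR a k) = 0].
Proof.
move=> aN1 a1 ra.
have [p [q [q0 aq]]] : exists (p : int) (q : nat), (0 < q)%N /\ a * q%:R = p%:~R.
  (* The denominator may be 0 here; division by zero then yields a = 0, rewritten as 0 / 1. *)
  move/rationalP: ra => [p [q aE]]; have [q0|q0] := posnP q.
    by exists 0, 1%N; split=> //; rewrite aE q0 invr0 !mulr0 mul0r.
  by exists p, q; split=> //; rewrite aE divfK// pnatr_eq0 -lt0n.
have qR : 0 < q%:R :> R by rewrite ltr0n.
have sq n : sin (n%:R * pi) = 0 :> R := sin_natpi n.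
have pos (z : R) n : 0 < z -> z = n%:~R -> sin (z * pi) = 0.
  move=> z0 zn; rewrite zn; case: n zn => n zn; first exact: sin_natpi.
  by move: z0; rewrite zn ltr0z.
(* With a = p / q this makes k pi / 2 = 2 pi q, and the phases become (q + p) pi and (q - p) pi. *)
exists (4 * q%:R); split.
- by rewrite mulr_gt0.
- by rewrite (_ : _ * halfpi = (2 * q)%:R * pi) ?sin_natpi// natrM; field.
- rewrite (_ : _ * halfpi = 0 + pi *+ 2 *+ q); last first.
    by rewrite add0r -(mulr_natr _ q) -(mulr_natr _ 2); field.
  by rewrite (periodicn (@cosD2pi R)) cos0.
- rewrite (_ : phaseL _ _ = (q%:R + a * q%:R) * pi); last by rewrite /phaseL; field.
  apply: (pos _ (q%:Z + p)); last by rewrite rmorphD/= aq.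
  by rewrite -[X in X + _]mul1r -mulrDl mulr_gt0//; lra.
- rewrite (_ : phaseR _ _ = (q%:R - a * q%:R) * pi); last by rewrite /phaseR; field.
  apply: (pos _ (q%:Z - p)); last by rewrite rmorphB/= aq.
  by rewrite -[X in X - _]mul1r -mulrBl mulr_gt0// subr_gt0.
Qed.

Lemma rational_not_complete a psi : -1 < a -> a < 1 -> rational a ->
  (forall j, exists l, kerH a l (psi j)) -> ~ complete_family xpredT psi.
Proof.
move=> aN1 a1 /(rational_phases aN1 a1)[k [k0 sk ck sL sR]] ker.
have [phi [sphi phi0 ophi]] := rational_orth aN1 a1 k0 sk ck sL sR.
apply: (not_complete_orth sphi phi0) => j _.
- by have [l kj] := ker j; exact: kerH_L2 kj.
- by have [l kj] := ker j; exact: ophi kj.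
Qed.

End Rational.

Local Close Scope complex_scope.

Theorem theorem2 (R : realType) (a : R) (a_gtN1 : -1 < a) (a_lt1 : a < 1) :
  (irrational a ->
     forall psi : nat -> R -> R[i], eigenfunctionsH a psi ->
       minimal_complete psi /\ ~ conditional_basis psi) /\
  (rational a ->
     forall psi : nat -> R -> R[i], eigenfunctionsH a psi ->
       ~ minimal_complete psi).
Proof.
split=> [irr|rat] psi [lam [eig basis]].
  split; last exact: (family_not_basis a_gtN1 a_lt1 irr eig basis).
  split; first exact: (family_complete a_gtN1 a_lt1 eig basis irr).
  by move=> k; exact: (family_minimal a_gtN1 a_lt1 eig basis irr).
move=> [compl _]; apply: (rational_not_complete a_gtN1 a_lt1 rat _ compl) => j.
by exists (lam j); exact: (family_kerH eig basis).
Qed.
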